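(* Let $c$ be a $\mathcal P$-value. Then $M(c)$ has the following decomposition into non-isomorphic irreducible $KG$-modules: $$M(c)=\bigoplus N(P),$$ where the sum runs through all different submodules $N(P)$ produced by the $P\in\mathcal P^*(c)$.
   Context: Let $n\ge 2$ and $G=\mathrm{GL}_n(q)$, the general linear group over the finite field $F_q$ of characteristic $p$. Let $\ell\ne p$ be a prime, and let $R$ be a local principal ideal domain of characteristic $0$ with maximal ideal $\ell R$, containing a primitive $p$-th root of unity; $R^*$ is its unit group and $K=R/\ell R$. Modules are left modules. $\nu_\ell$ denotes the $\ell$-adic valuation of integers. $B$ is the group of upper triangular matrices in $G$ and $U$ the group of upper unitriangular matrices; $S_n$ is viewed as the subgroup of permutation matrices of $G$; $\widehat{S}=\sum_{s\in S}s\in RG$ for $S\subseteq G$. Put $\varepsilon=\sum_{\sigma\in S_n}\mathrm{sg}(\sigma)\,\sigma\widehat{B}\in RG$. The Steinberg lattice is the left ideal $I=RG\cdot\varepsilon$, and $L=I/\ell I$, a $KG$-module. Let $f:I\times I\to R$ be the restriction to $I$ of the $R$-bilinear form on $RG$ given by $(g,h)\mapsto\delta_{g,h}$ for $g,h\in G$, scaled by $1/|B|$ (it takes values in $R$). For $c\ge 0$ put $I(c)=\{x\in I : f(x,I)\subseteq \ell^cR\}$, $L(c)=(I(c)+\ell I)/\ell I$ and $M(c)=L(c)/L(c+1)$. $\mathcal P$ is the set of standard parabolic subgroups (subgroups of $G$ containing $B$). A $\mathcal P$-value is an integer of the form $\nu_\ell([G:P])$ with $P\in\mathcal P$. A composition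 $(a_1,\dots,a_k)$ of $n$ is identified with the block upper triangular subgroup with diagonal blocks of sizes $a_1,\dots,a_k$; this gives a bijection between compositions of $n$ and $\mathcal P$. Let $e=\min\{i\ge 2 : \ell \mid \frac{q^i-1}{q-1}\}$. $\mathcal P^*$ is the set of $P\in\mathcal P$ whose composition is nondecreasing with every part equal to $1$ or of the form $e\ell^i$, $i\ge 0$ (so $\mathcal P^*$ corresponds to partitions of $n$ with such parts). $\mathcal P^*(c)=\{P\in\mathcal P^* : \nu_\ell([G:P])=c\}$. For a group homomorphism $\lambda:U\to R^*$, let $P(\lambda)\in\mathcal P$ be the subgroup generated by $B$ and the transpositions $(i,i+1)$, $1\le i<n$, such that $\lambda$ is non-trivial on $X_{i,i+1}=\{I_n+aE^{i,i+1} : a\in F_q\}$. Put $E_\lambda=\sum_{u\in U}\lambda(u)u\varepsilon\in I$ and $F_\lambda=E_\lambda+\ell I\in L$. For $P\in\mathcal P$ with $c=\nu_\ell([G:P])$, define $N(P)=KG\cdot(F_\lambda+L(c+1))\subseteq M(c)$ for any $\lambda$ with $P(\lambda)=P$ (such $\lambda$ exist, $F_\lambda\in L(c)$, and $N(P)$ does not depend on the choice). *)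

(* Defs.v *)
From HB Require Import structures.
From mathcomp Require Import all_boot all_order all_algebra all_fingroup.
From mathcomp Require Import generic_quotient ring_quotient fraction.
From mathcomp Require Import boolp classical_sets functions cardinality fsbigop.

Set Implicit Arguments.
Unset Strict Implicit.
Unset Printing Implicit Defensive.

Import GRing.Theory.
Local Open Scope ring_scope.

Section Submodules.
Variables (A : pzRingType) (V : lmodType A).

(* Membership is boolean, but [asbool] turns any property into such a
   predicate, so that these are all the submodules of V; unlike
   [submodClosed V], this bundle is extensional (lemma [submodP]). *)
Record submod := Submod {
  submod_pred :> {pred V};
  submod_closedP : submod_closed submod_pred
}.

HB.instance Definition _ (N : submod) :=
  GRing.isSubmodClosed.Build A V (submod_pred N) (submod_closedP N).

HB.instance Definition _ := gen_eqMixin submod.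
HB.instance Definition _ := gen_choiceMixin submod.

Lemma submodP (N W : submod) : N =i W -> N = W.
Proof.
case: N W => [N hN] [W hW] /= NW.
have eqNW : N = W by apply/funext => x; exact: NW.
by case: W / eqNW hW {NW} => hW; congr Submod; exact: Prop_irrelevance.
Qed.

Record submod_of (N : submod) := SubmodOf {
  submod_val :> V;
  submod_valP : submod_val \in N
}.

HB.instance Definition _ (N : submod) := [isSub for @submod_val N].
HB.instance Definition _ (N : submod) := [Choice of submod_of N by <:].
HB.instance Definition _ (N : submod) :=
  [SubChoice_isSubLmodule of submod_of N by <:].

Definition cyclic_pred (v : V) : {pred V} :=
  fun x => `[< exists a : A, x = a *: v >].

Lemma cyclic_closed v : submod_closed (cyclic_pred v).
Proof.
split=> [|a x y /asboolP[b ->] /asboolP[b' ->]]; apply/asboolP.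
  by exists 0; rewrite scale0r.
by exists (a * b + b'); rewrite scalerDl scalerA.
Qed.

Definition cyclic v := Submod (cyclic_closed v).

End Submodules.

Section QuotientModule.
Variables (A : pzRingType) (V : lmodType A) (W : submod V).

Definition qmod := Quotient.quot W.

HB.instance Definition _ := GRing.Zmodule.on qmod.

Definition qmod_pi (x : V) : qmod := \pi_qmod%qT x.
Definition qmod_scale (a : A) (u : qmod) : qmod :=
  qmod_pi (a *: repr (u : Quotient.quot W)).

Lemma qmod_piE x y : (qmod_pi x = qmod_pi y) <-> (x - y \in W).
Proof. by rewrite Quotient.idealrBE; split => [/eqP|/eqP]. Qed.

Lemma qmod_reprK u : qmod_pi (repr (u : Quotient.quot W)) = u.
Proof. exact: reprK. Qed.

Lemma qmod_piD x y : qmod_pi (x + y) = qmod_pi x + qmod_pi y.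
Proof. exact: (raddfD (\pi_(Quotient.quot W)%qT)). Qed.

Lemma qmod_piZ a x : qmod_pi (a *: x) = qmod_scale a (qmod_pi x).
Proof.
apply/qmod_piE; rewrite -scalerBr rpredZ //.
by apply/qmod_piE; rewrite qmod_reprK.
Qed.

Lemma qmod_scaleA a b u :
  qmod_scale a (qmod_scale b u) = qmod_scale (a * b) u.
Proof. by rewrite -[u]qmod_reprK -!qmod_piZ scalerA. Qed.

Lemma qmod_scale1 : left_id 1 qmod_scale.
Proof. by move=> u; rewrite -[u]qmod_reprK -qmod_piZ scale1r. Qed.

Lemma qmod_scaleDr : right_distributive qmod_scale +%R.
Proof.
move=> a u v; rewrite -[u]qmod_reprK -[v]qmod_reprK.
by rewrite -qmod_piD -!qmod_piZ -qmod_piD scalerDr.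
Qed.

Lemma qmod_scaleDl u : {morph qmod_scale^~ u : a b / a + b}.
Proof.
by move=> a b; rewrite -[u]qmod_reprK -!qmod_piZ -qmod_piD scalerDl.
Qed.

HB.instance Definition _ := GRing.Zmodule_isLmodule.Build A qmod
  qmod_scaleA qmod_scale1 qmod_scaleDr qmod_scaleDl.

End QuotientModule.

Section Subquotient.
Variables (A : pzRingType) (V : lmodType A) (N W : submod V).

Definition restr_pred : {pred submod_of N} := fun x => submod_val x \in W.

Lemma restr_closed : submod_closed restr_pred.
Proof.
by split=> [|a x y xW yW]; rewrite unfold_in /= ?rpred0 // rpredD ?rpredZ.
Qed.

(* N / W, in the situation where W is contained in N. *)
Definition subquo := qmod (Submod restr_closed).

End Subquotient.

Definition irreducible_lmod (A : pzRingType) (V : lmodType A) : Prop :=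
  (exists x : V, x != 0) /\
  forall W : submod V,
    (forall x, x \in W -> x = 0) \/ (forall x, x \in W).

Definition isomorphic_lmod (A : pzRingType) (V W : lmodType A) : Prop :=
  exists f : {linear V -> W}, bijective f.

(* S may be infinite here, hence finitely supported families u; [\sum_(N \in S)]
   is the finitely supported sum. *)
Definition is_direct_sum (A : pzRingType) (V : lmodType A)
    (S : set (submod V)) : Prop :=
  forall x : V, exists! u : submod V -> V,
    [/\ forall N, S N -> u N \in N,
        forall N, ~ S N -> u N = 0,
        finite_set [set N | u N <> 0]
      & x = \sum_(N \in S) u N].

Section GroupAlgebra.
Variables (R : pzRingType) (gT : finGroupType).

Definition gralg := {ffun gT -> R}.

HB.instance Definition _ := GRing.Zmodule.on gralg.

Implicit Types x y z : gralg.

Definition gr (g : gT) : gralg := [ffun h => (h == g)%:R].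
Definition gralg_one : gralg := gr 1%g.
Definition gralg_mul x y : gralg :=
  [ffun h => \sum_g x g * y (g^-1 * h)%g].

Lemma gralg_mulA : associative gralg_mul.
Proof.
move=> x y z; apply/ffunP => h; rewrite !ffunE.
transitivity (\sum_g \sum_k x g * (y (g^-1 * k)%g * z (k^-1 * h)%g)).
  apply: eq_bigr => g _; rewrite ffunE mulr_sumr.
  rewrite (reindex_inj (mulgI g^-1%g)) /=; apply: eq_bigr => k _.
  by rewrite invMg invgK -!mulgA mulKVg.
rewrite exchange_big /=; apply: eq_bigr => k _.
by rewrite ffunE mulr_suml; apply: eq_bigr => g _; rewrite mulrA.
Qed.

Lemma gralg_mul1l : left_id gralg_one gralg_mul.
Proof.
move=> x; apply/ffunP => h; rewrite ffunE (bigD1 1%g) //= ffunE eqxx mul1r.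
rewrite invg1 mul1g big1 ?addr0 // => g /negPf g1.
by rewrite ffunE g1 mul0r.
Qed.

Lemma gralg_mul1r : right_id gralg_one gralg_mul.
Proof.
move=> x; apply/ffunP => h; rewrite ffunE (bigD1 h) //= ffunE mulVg eqxx mulr1.
rewrite big1 ?addr0 // => g /negPf gh.
by rewrite ffunE -eq_mulVg1 gh mulr0.
Qed.

Lemma gralg_mulDl : left_distributive gralg_mul +%R.
Proof.
move=> x y z; apply/ffunP => h; rewrite !ffunE -big_split /=.
by apply: eq_bigr => g _; rewrite ffunE mulrDl.
Qed.

Lemma gralg_mulDr : right_distributive gralg_mul +%R.
Proof.
move=> x y z; apply/ffunP => h; rewrite !ffunE -big_split /=.
by apply: eq_bigr => g _; rewrite ffunE mulrDr.
Qed.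

HB.instance Definition _ := GRing.Zmodule_isPzRing.Build gralg
  gralg_mulA gralg_mul1l gralg_mul1r gralg_mulDl gralg_mulDr.

Definition gralg_scale (a : R) x : gralg := [ffun h => a * x h].

Lemma gralg_scaleA a b x :
  gralg_scale a (gralg_scale b x) = gralg_scale (a * b) x.
Proof. by apply/ffunP => h; rewrite !ffunE mulrA. Qed.

Lemma gralg_scale1 : left_id 1 gralg_scale.
Proof. by move=> x; apply/ffunP => h; rewrite ffunE mul1r. Qed.

Lemma gralg_scaleDr : right_distributive gralg_scale +%R.
Proof. by move=> a x y; apply/ffunP => h; rewrite !ffunE mulrDr. Qed.

Lemma gralg_scaleDl x : {morph gralg_scale^~ x : a b / a + b}.
Proof. by move=> a b; apply/ffunP => h; rewrite !ffunE mulrDl. Qed.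

HB.instance Definition _ := GRing.Zmodule_isLmodule.Build R gralg
  gralg_scaleA gralg_scale1 gralg_scaleDr gralg_scaleDl.

Definition hatsum (S : {set gT}) : gralg := \sum_(s in S) gr s.

End GroupAlgebra.

Section ResidueRing.
Variables (R : comPzRingType) (l : nat).

Definition lR_pred : {pred R} := fun x => `[< exists y : R, x = l%:R * y >].

Lemma lR_closed : zmod_closed lR_pred.
Proof.
split=> [|x y /asboolP[a ->] /asboolP[b ->]]; apply/asboolP.
  by exists 0; rewrite mulr0.
by exists (a - b); rewrite mulrBr.
Qed.

HB.instance Definition _ := GRing.isZmodClosed.Build R lR_pred lR_closed.

(* R / lR. The quotient rings of ring_quotient.v are restricted to proper
   ideals, whence this direct construction. *)
Definition residue := Quotient.quot lR_pred.

HB.instance Definition _ := GRing.Zmodule.on residue.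

Definition res_pi (x : R) : residue := \pi_residue%qT x.
Definition res_repr (a : residue) : R := repr (a : Quotient.quot lR_pred).
Definition res_one : residue := res_pi 1.
Definition res_mul (a b : residue) : residue := res_pi (res_repr a * res_repr b).

Lemma res_piP x y : res_pi x = res_pi y <-> exists z, x - y = l%:R * z.
Proof.
split=> [xy|xy].
  by apply/asboolP; have := Quotient.idealrBE lR_pred x y;
     rewrite (_ : _ == _) ?unfold_in //; apply/eqP.
apply/eqP; rewrite /res_pi; have := Quotient.idealrBE lR_pred x y.
by rewrite -[x - y \in _]/(lR_pred _) (_ : lR_pred _ = true) //; apply/asboolP.
Qed.

Lemma res_reprK a : res_pi (res_repr a) = a.
Proof. exact: reprK. Qed.

Lemma res_pi0 : res_pi 0 = 0.
Proof. exact: (raddf0 (\pi_(Quotient.quot lR_pred)%qT)). Qed.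

Lemma res_piD x y : res_pi (x + y) = res_pi x + res_pi y.
Proof. exact: (raddfD (\pi_(Quotient.quot lR_pred)%qT)). Qed.

Lemma res_piM x y : res_pi (x * y) = res_mul (res_pi x) (res_pi y).
Proof.
have [a ha] : exists a, res_repr (res_pi x) - x = l%:R * a.
  by apply/res_piP; rewrite res_reprK.
have [b hb] : exists b, res_repr (res_pi y) - y = l%:R * b.
  by apply/res_piP; rewrite res_reprK.
apply/esym/res_piP; move/eqP: ha; rewrite subr_eq => /eqP ->.
move/eqP: hb; rewrite subr_eq => /eqP ->.
exists (a * (l%:R * b + y) + x * b).
rewrite mulrDl [x * (_ + _)]mulrDr addrA addrK [RHS]mulrDr [l%:R * (a * _)]mulrA.
by rewrite [x * (_ * _)]mulrCA.
Qed.

Lemma res_mulA : associative res_mul.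
Proof.
move=> a b c; rewrite -[a]res_reprK -[b]res_reprK -[c]res_reprK.
by rewrite -!res_piM mulrA.
Qed.

Lemma res_mulC : commutative res_mul.
Proof. by move=> a b; rewrite /res_mul mulrC. Qed.

Lemma res_mul1 : left_id res_one res_mul.
Proof. by move=> a; rewrite -[a]res_reprK -res_piM mul1r. Qed.

Lemma res_mulDl : left_distributive res_mul +%R.
Proof.
move=> a b c; rewrite -[a]res_reprK -[b]res_reprK -[c]res_reprK.
by rewrite -res_piD -!res_piM -res_piD mulrDl.
Qed.

HB.instance Definition _ := GRing.Zmodule_isComPzRing.Build residue
  res_mulA res_mulC res_mul1 res_mulDl.

End ResidueRing.

Section ReductionModule.
Variables (R : comPzRingType) (l : nat) (gT : finGroupType).
Local Notation RG := (gralg R gT).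
Local Notation K := (residue R l).
Local Notation KG := (gralg K gT).
Variable V : lmodType RG.

Definition lV_pred : {pred V} := fun x => `[< exists y : V, x = y *+ l >].

Lemma lV_closed : submod_closed lV_pred.
Proof.
split=> [|a x y /asboolP[u ->] /asboolP[v ->]]; apply/asboolP.
  by exists 0; rewrite mul0rn.
by exists (a *: u + v); rewrite mulrnDl scalerMnr.
Qed.

Definition lV := Submod lV_closed.

(* V / lV as a KG-module: coefficients in K act through any lifting to R. *)
Definition redmod := Quotient.quot lV.

HB.instance Definition _ := GRing.Zmodule.on redmod.

Definition red_pi (x : V) : redmod := \pi_redmod%qT x.
Definition red_repr (u : redmod) : V := repr (u : Quotient.quot lV).
Definition red_lift (a : KG) : RG := [ffun g => res_repr (a g)].
Definition red_scale (a : KG) (u : redmod) : redmod :=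
  red_pi (red_lift a *: red_repr u).

Definition red_coef (a : RG) : KG := [ffun g => res_pi l (a g)].

Lemma red_piP x y : red_pi x = red_pi y <-> exists z, x - y = z *+ l.
Proof.
transitivity (x - y \in lV).
  by rewrite Quotient.idealrBE; split => [/eqP|/eqP].
by split=> /asboolP.
Qed.

Lemma red_reprK u : red_pi (red_repr u) = u.
Proof. exact: reprK. Qed.

Lemma red_piD x y : red_pi (x + y) = red_pi x + red_pi y.
Proof. exact: (raddfD (\pi_(Quotient.quot lV)%qT)). Qed.

Lemma red_liftK a : red_coef (red_lift a) = a.
Proof. by apply/ffunP => g; rewrite !ffunE res_reprK. Qed.

Lemma red_coefP (a b : RG) : red_coef a = red_coef b ->
  exists c : RG, a - b = c *+ l.
Proof.
move=> ab; have /choice[c hc] g : exists z, a g - b g = l%:R * z.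
  by apply/res_piP; move/ffunP/(_ g): ab; rewrite !ffunE.
exists (finfun c); apply/ffunP => g; rewrite ffunE ffunE hc mulr_natl.
by rewrite ffunMnE ffunE.
Qed.

Lemma red_piZ (a : RG) x : red_pi (a *: x) = red_scale (red_coef a) (red_pi x).
Proof.
have [c hc] : exists c : RG, a - red_lift (red_coef a) = c *+ l.
  by apply: red_coefP; rewrite red_liftK.
have [z hz] : exists z, x - red_repr (red_pi x) = z *+ l.
  by apply/red_piP; rewrite red_reprK.
apply/red_piP; exists (c *: x + red_lift (red_coef a) *: z).
rewrite mulrnDl [c *: x *+ l]scalerMnl -hc scalerMnr -hz.
by rewrite scalerBl scalerBr addrA subrK.
Qed.

Lemma red_coef1 : red_coef 1 = 1.
Proof.
apply/ffunP => g; rewrite !ffunE; case: (g == _) => //.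
exact: res_pi0.
Qed.

Lemma red_coefD (a b : RG) : red_coef (a + b) = red_coef a + red_coef b.
Proof. by apply/ffunP => g; rewrite !ffunE res_piD. Qed.

Lemma red_coefM (a b : RG) : red_coef (a * b) = red_coef a * red_coef b.
Proof.
apply/ffunP => g; rewrite !ffunE (big_morph _ (@res_piD R l) (@res_pi0 R l)).
by apply: eq_bigr => h _; rewrite !ffunE res_piM.
Qed.

Lemma red_scaleA a b u : red_scale a (red_scale b u) = red_scale (a * b) u.
Proof.
rewrite -[a]red_liftK -[b]red_liftK -[u]red_reprK.
by rewrite -red_coefM -!red_piZ scalerA.
Qed.

Lemma red_scale1 : left_id 1 red_scale.
Proof.
by move=> u; rewrite -red_coef1 -[u]red_reprK -red_piZ scale1r.
Qed.

Lemma red_scaleDr : right_distributive red_scale +%R.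
Proof.
move=> a u v; rewrite -[a]red_liftK -[u]red_reprK -[v]red_reprK.
by rewrite -red_piD -!red_piZ -red_piD scalerDr.
Qed.

Lemma red_scaleDl u : {morph red_scale^~ u : a b / a + b}.
Proof.
move=> a b; rewrite -[a]red_liftK -[b]red_liftK -[u]red_reprK.
by rewrite -red_coefD -!red_piZ -red_piD scalerDl.
Qed.

HB.instance Definition _ := GRing.Zmodule_isLmodule.Build KG redmod
  red_scaleA red_scale1 red_scaleDr red_scaleDl.

(* (N + lV) / lV *)
Definition red_image_pred (N : submod V) : {pred redmod} := fun u =>
  `[< exists x y : V, [/\ x \in N, y \in lV & u = red_pi (x + y)] >].

Lemma red_image_closed N : submod_closed (red_image_pred N).
Proof.
split=> [|a u v /asboolP[x [y [xN yl ->]]] /asboolP[x' [y' [xN' yl' ->]]]];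
  apply/asboolP.
  exists 0, 0; rewrite !rpred0; split=> //; rewrite addr0.
  by apply/esym; exact: (raddf0 (\pi_(Quotient.quot lV)%qT)).
exists (red_lift a *: x + x'), (red_lift a *: y + y').
split; rewrite ?rpredD ?rpredZ //.
by rewrite addrACA -scalerDr [RHS]red_piD red_piZ red_liftK.
Qed.

Definition red_image N := Submod (red_image_closed N).

End ReductionModule.

Section LocalPID.
Variable R : comNzRingType.

(* [idealr_closed] is the library's notion of a proper ideal. *)
Definition is_PID : Prop :=
  forall J : {pred R}, idealr_closed J ->
    exists a : R, forall x, x \in J <-> exists y, x = a * y.

Definition maximal_ideal (J : {pred R}) : Prop :=
  idealr_closed J /\
  forall J' : {pred R}, idealr_closed J' -> {subset J <= J'} -> J' =i J.

Definition local_with_maximal_ideal (m : {pred R}) : Prop :=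
  forall J : {pred R}, maximal_ideal J <-> J =i m.

End LocalPID.

(* {'GL_n[F]} consists of matrices of size n.-1.+1, which is n when n > 0. *)
Section Parabolics.
Variables (F : finFieldType) (n : nat).
Local Notation GL := {'GL_n[F]}.
Local Notation idx := 'I_n.-1.+1.

Definition borel : {set GL} :=
  [set g : GL | [forall i : idx, forall j : idx,
     (j < i)%N ==> (GLval g i j == 0)]].

Definition unitri : {set GL} :=
  [set g in borel | [forall i : idx, GLval g i i == 1]].

Definition perm_GL (s : 'S_n.-1.+1) : GL :=
  FinRing.Unit (unitmx_perm F s).

Definition root_subgroup (i j : idx) : {set GL} :=
  [set g : GL | [exists a : F, GLval g == 1%:M + a *: delta_mx i j]].

Definition standard_parabolic (P : {group GL}) : Prop := borel \subset P.

Definition index_val (l : nat) (P : {group GL}) : nat :=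
  logn l #|'GL_n[F] : P|%g.

Definition is_Pvalue (l c : nat) : Prop :=
  exists2 P : {group GL}, standard_parabolic P & c = index_val l P.

Definition is_composition (a : seq nat) : Prop :=
  all (leq 1) a /\ sumn a = n.

(* [reshape_index a i] is the number of the block containing row i. *)
Definition block_parabolic (a : seq nat) : {set GL} :=
  [set g : GL | [forall i : idx, forall j : idx,
     (reshape_index a j < reshape_index a i)%N ==> (GLval g i j == 0)]].

Definition is_e (l e : nat) : Prop :=
  let good i := (2 <= i)%N && (l %| (#|F| ^ i - 1) %/ (#|F| - 1))%N in
  good e /\ forall i, good i -> (e <= i)%N.

Definition Pstar (l e c : nat) (P : {group GL}) : Prop :=
  [/\ standard_parabolic P,
      exists a : seq nat,
        [/\ is_composition a, sorted leq a,
            forall x, x \in a -> x = 1%N \/ exists i, x = (e * l ^ i)%N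
          & P :=: block_parabolic a]
    & index_val l P = c].

End Parabolics.

Section Steinberg.
Variables (F : finFieldType) (n : nat) (R : idomainType) (l : nat).
Local Notation GL := {'GL_n[F]}.
Local Notation RG := (gralg R GL).
Local Notation K := (residue R l).
Local Notation KG := (gralg K GL).

Definition steinberg_elt : RG :=
  \sum_(s : 'S_n.-1.+1)
     (-1) ^+ odd_perm s *: (gr R (perm_GL F s) * hatsum R (borel F n)).

(* The left ideal I = RG.eps, in the regular left RG-module. *)
Definition st_ideal : submod (RG^o) := cyclic (steinberg_elt : RG^o).
Definition st_lattice := submod_of st_ideal.

Lemma steinberg_elt_in : (steinberg_elt : RG^o) \in st_ideal.
Proof. by apply/asboolP; exists 1; rewrite scale1r. Qed.

Definition st_eps : st_lattice := SubmodOf steinberg_elt_in.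

Definition dotg (x y : RG) : R := \sum_g x g * y g.

(* The form f on I. It takes values in R, but is written in the fraction field
   because |B| need not be invertible in R. *)
Definition st_form (x y : st_lattice) : {fraction R} :=
  tofrac (dotg (submod_val x) (submod_val y)) / #|borel F n|%:R.

Definition gr_adj (a : RG) : RG := [ffun g => a g^-1%g].

Lemma dotg_adj (a x y : RG) : dotg (a * x) y = dotg x (gr_adj a * y).
Proof.
rewrite /dotg.
transitivity (\sum_h \sum_g a g * x (g^-1 * h)%g * y h).
  by apply: eq_bigr => h _; rewrite ffunE mulr_suml.
transitivity (\sum_h \sum_g x h * (a g * y (g * h)%g)); last first.
  apply: eq_bigr => h _; rewrite ffunE -mulr_sumr; congr (_ * _).
  rewrite (reindex_inj invg_inj) /=.
  by apply: eq_bigr => g _; rewrite ffunE.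
rewrite exchange_big [RHS]exchange_big /=; apply: eq_bigr => g _.
rewrite (reindex_inj (mulgI g)) /=; apply: eq_bigr => h _.
by rewrite mulKg mulrCA mulrA.
Qed.

Definition st_filt_pred (c : nat) : {pred st_lattice} := fun x =>
  `[< forall y, exists r : R, st_form x y = tofrac (l%:R ^+ c * r) >].

Lemma st_filt_closed c : submod_closed (st_filt_pred c).
Proof.
split=> [|a x x' /asboolP xc /asboolP xc']; apply/asboolP => y.
  exists 0; rewrite mulr0 /st_form /dotg big1 ?tofrac0 ?mul0r // => g _.
  by rewrite ffunE mul0r.
have [r hr] := xc (gr_adj a *: y); have [r' hr'] := xc' y.
exists (r + r'); rewrite mulrDr tofracD -hr -hr' /st_form -mulrDl -tofracD.
congr (tofrac _ / _).
transitivity (dotg (a * submod_val x) (submod_val y)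
              + dotg (submod_val x') (submod_val y)).
  by rewrite /dotg -big_split /=; apply: eq_bigr => g _; rewrite ffunE mulrDl.
by congr (_ + _); rewrite dotg_adj.
Qed.

(* I(c) = {x in I | f(x, I) is contained in l^c R} *)
Definition st_filt c : submod st_lattice := Submod (st_filt_closed c).

(* L = I / lI *)
Definition st_red := redmod l st_lattice.

(* L(c) = (I(c) + lI) / lI *)
Definition red_filt c : submod st_red := red_image l (st_filt c).

(* M(c) = L(c) / L(c+1) *)
Definition layer c := subquo (red_filt c) (red_filt c.+1).

(* lam is only relevant on U, where it is a homomorphism to the units of R. *)
Definition is_char (lam : GL -> R) : Prop :=
  {in unitri F n, forall u, lam u \is a GRing.unit} /\
  {in unitri F n &, forall u v, lam (u * v)%g = lam u * lam v}.

Definition char_reflections (lam : GL -> R) : {set GL} :=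
  [set perm_GL F (tperm ij.1 ij.2) | ij : 'I_n.-1.+1 * 'I_n.-1.+1 &
     (ij.2 == ij.1.+1 :> nat) &&
     [exists u in root_subgroup F ij.1 ij.2, lam u != 1]].

(* P(lam), generated by B and the transpositions (i, i+1) such that lam is
   non-trivial on the root subgroup X_(i,i+1). *)
Definition char_parabolic (lam : GL -> R) : {group GL} :=
  <<borel F n :|: char_reflections lam>>%G.

Definition E_elt (lam : GL -> R) : st_lattice :=
  \sum_(u in unitri F n) (lam u *: gr R u) *: st_eps.

Definition F_elt (lam : GL -> R) : st_red := red_pi l (E_elt lam).

(* N = KG.(F_lam + L(c+1)) in M(c) for some lam with P(lam) = P; y is F_lam as
   an element of L(c). When c is the l-adic valuation of [G : P], exactly one
   N satisfies this, whatever the choice of lam. *)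
Definition is_NP c (P : {group GL}) (N : submod (layer c)) : Prop :=
  exists (lam : GL -> R) (y : submod_of (red_filt c)),
    [/\ is_char lam, char_parabolic lam = P, submod_val y = F_elt lam
      & N = cyclic (qmod_pi _ y)].

End Steinberg.

(* Main.v *)
From HB Require Import structures.
Require Import Defs.
From Stdlib Require Import Lia.
From mathcomp Require Import all_boot all_order all_algebra all_fingroup pgroup.
From mathcomp Require Import generic_quotient ring_quotient fraction.
From mathcomp Require Import boolp classical_sets functions cardinality fsbigop.

Set Implicit Arguments.
Unset Strict Implicit.
Unset Printing Implicit Defensive.

Import GRing.Theory.
Local Open Scope ring_scope.

(** Linear arithmetic on the boolean order and equality of natural numbers. *)
Ltac nat_hyps := repeat match goal with
  | H : is_true (leq ?a ?b) |- _ => apply (elimT (@leP a b)) in H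
  | H : is_true (~~ leq ?a ?b) |- _ => apply (elimN (@leP a b)) in H
  | H : leq ?a ?b = true |- _ => apply (elimT (@leP a b)) in H
  | H : leq ?a ?b = false |- _ => apply (elimF (@leP a b)) in H
  | H : is_true (@eq_op _ ?a ?b) |- _ => apply (elimT (@eqP nat a b)) in H
  | H : is_true (~~ @eq_op _ ?a ?b) |- _ => apply (elimN (@eqP nat a b)) in H
  | H : @eq_op _ ?a ?b = false |- _ => apply (elimF (@eqP nat a b)) in H
  | H : is_true (?a && ?b) |- _ =>
      let H1 := fresh in let H2 := fresh in case/andP: H => H1 H2
  | H : (_ && _) = true |- _ => rewrite -/(is_true (_ && _)) in H
  | H : (_ && _) = false |- _ => apply negbT in H
  | H : is_true (~~ (_ && _)) |- _ => rewrite negb_and in H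
  | H : is_true (?a || ?b) |- _ =>
      let H1 := fresh in case/orP: H => H1
  | H : ?a /\ ?b |- _ =>
      let H1 := fresh in let H2 := fresh in case: H => H1 H2
  end.
Ltac nat_goal := repeat match goal with
  | |- forall _, _ => intro
  | |- ~ _ => intro
  | |- is_true (leq ?a ?b) => apply (introT (@leP a b))
  | |- is_true (~~ leq ?a ?b) => apply (introN (@leP a b))
  | |- leq ?a ?b = true => apply (introT (@leP a b))
  | |- leq ?a ?b = false => apply (introF (@leP a b))
  | |- is_true (@eq_op _ ?a ?b) => apply (introT (@eqP nat a b))
  | |- is_true (~~ @eq_op _ ?a ?b) => apply (introN (@eqP nat a b))
  | |- @eq_op _ ?a ?b = false => apply (introF (@eqP nat a b))
  | |- is_true (_ && _) => apply/andP; split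
  end.
Ltac nlia := nat_goal; nat_hyps; unfold addn, subn, muln in *; lia.

(** Naming the finite group structure itself makes all group operations on its
    elements be read through one and the same instance. *)
Definition GLn (F : finFieldType) (m : nat) : finGroupType := {'GL_m.+1[F]}.
Definition Bn (F : finFieldType) (m : nat) : {set GLn F m} := borel F m.+1.
Definition Un (F : finFieldType) (m : nat) : {set GLn F m} := unitri F m.+1.
Definition pm (F : finFieldType) (m : nat) (s : 'S_m.+1) : GLn F m := @perm_GL F m.+1 s.

Section Matrices.
Variables (F : finFieldType) (m : nat).
Local Notation GL := (GLn F m).
Local Notation idx := 'I_m.+1.
Local Notation B := (Bn F m).
Local Notation U := (Un F m).
Local Notation pm := (@pm F m).
Implicit Types (g h u : GL) (s t w : 'S_m.+1) (i j k : idx).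

Definition to_GL (A : 'M[F]_m.+1) : GL := insubd (1%g : GL) A.

Lemma to_GLE (A : 'M[F]_m.+1) : A \in unitmx -> GLval (to_GL A) = A.
Proof. by move=> Au; rewrite /to_GL /insubd insubT. Qed.

Lemma GLP g h : (forall i j, GLval g i j = GLval h i j) -> g = h.
Proof. by move=> e; apply: val_inj; apply/matrixP => i j; exact: e. Qed.

Lemma GLmE g h i j : GLval (g * h)%g i j = \sum_k GLval g i k * GLval h k j.
Proof. by rewrite GL_MxE mxE. Qed.

Lemma GL1E i j : GLval (1%g : GL) i j = (i == j)%:R.
Proof. by rewrite GL_1E mxE. Qed.

Lemma pmE s i j : GLval (pm s) i j = (s i == j)%:R.
Proof. by rewrite /= !mxE. Qed.

Lemma pm_mulE s g i j : GLval (pm s * g)%g i j = GLval g (s i) j.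
Proof. by rewrite GL_MxE -row_permE mxE. Qed.

Lemma mul_pmE s g i j : GLval (g * pm s)%g i j = GLval g i (s^-1 j)%g.
Proof.
rewrite GLmE (bigD1 (s^-1 j)%g) //= [perm_mx _ _ _]mxE mxE permKV eqxx mulr1.
rewrite big1 ?addr0 // => k kj; rewrite !mxE.
by case: eqP => [e|_]; rewrite ?mulr0 //; rewrite -e permK eqxx in kj.
Qed.

Lemma pmM s t : pm (s * t)%g = (pm s * pm t)%g.
Proof. by apply: GLP => i j; rewrite pm_mulE !pmE permM. Qed.

Lemma pm1 : pm 1%g = 1%g.
Proof. by apply: GLP => i j; rewrite pmE GL1E perm1. Qed.

Lemma pmV s : pm s^-1%g = (pm s)^-1%g.
Proof. by apply/(mulgI (pm s)); rewrite -pmM !mulgV pm1. Qed.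

Lemma conj_pmE s g i j :
  GLval (g ^ pm s)%g i j = GLval g (s^-1 i)%g (s^-1 j)%g.
Proof. by rewrite conjgE -pmV pm_mulE mul_pmE. Qed.

(** Membership in B and U, entry by entry. *)
Lemma borelP g : reflect (forall i j, (j < i)%N -> GLval g i j = 0) (g \in B).
Proof.
rewrite inE; apply: (iffP forallP) => [H i j ji|H i].
  by move/forallP/(_ j)/implyP/(_ ji)/eqP: (H i).
by apply/forallP => j; apply/implyP => ji; rewrite H.
Qed.

Lemma in_Un g : (g \in U) = (g \in B) && [forall i, GLval g i i == 1].
Proof. by rewrite [LHS]inE. Qed.

Lemma unitriP g : reflect
  ((forall i j, (j < i)%N -> GLval g i j = 0) /\ forall i, GLval g i i = 1)
  (g \in U).
Proof.
rewrite in_Un; apply: (iffP andP) => [[/borelP gB /forallP H]|[/borelP gB H]].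
  by split=> // i; apply/eqP.
by split=> //; apply/forallP => i; rewrite H.
Qed.

Lemma unitri_borel u : u \in U -> u \in B.
Proof. by rewrite in_Un => /andP[]. Qed.

Lemma borelM_diag g h i : g \in B -> h \in B ->
  GLval (g * h)%g i i = GLval g i i * GLval h i i.
Proof.
move=> /borelP gB /borelP hB; rewrite GLmE (bigD1 i) //= big1 ?addr0 // => k ki.
case: (ltngtP k i) => [/gB->|/hB->|/val_inj e]; rewrite ?mul0r ?mulr0 //.
by rewrite e eqxx in ki.
Qed.

Lemma group_set_borel : group_set B.
Proof.
apply/group_setP; split.
  by apply/borelP => i j ji; rewrite GL1E -val_eqE gtn_eqF.
move=> g h /borelP gB /borelP hB; apply/borelP => i j ji.
rewrite GLmE big1 // => k _; case: (ltnP k i) => [/gB->|ik]; first by rewrite mul0r.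
by rewrite hB ?mulr0 //; exact: leq_trans ji ik.
Qed.
Canonical borel_group := Group group_set_borel.

Lemma group_set_unitri : group_set U.
Proof.
apply/group_setP; split.
  by rewrite in_Un group1; apply/forallP => i; rewrite GL1E eqxx.
move=> g h gU hU; rewrite in_Un groupM ?unitri_borel //; apply/forallP => i.
rewrite borelM_diag ?unitri_borel //.
by case/unitriP: gU => _ ->; case/unitriP: hU => _ ->; rewrite mulr1.
Qed.
Canonical unitri_group := Group group_set_unitri.

Lemma borel_diag_neq0 g i : g \in B -> GLval g i i != 0.
Proof.
move=> gB; have gVB : g^-1%g \in B by rewrite groupV.
have := @borelM_diag g g^-1%g i gB gVB.
rewrite mulgV GL1E eqxx => e; apply: contra_eq_neq e => ->.
by rewrite mul0r oner_eq0.
Qed.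

(** The part of U preserved by the permutation s, as a set of matrices with
    prescribed zeros: it is the intersection of U and its conjugate by s. *)
Definition Upat s : {set GL} :=
  [set u in U | [forall i : idx, forall j : idx, (i < j)%N && (s j < s i)%N ==> (GLval u i j == 0)]].

Lemma UpatP s u : reflect
  (u \in U /\ forall i j, (i < j)%N -> (s j < s i)%N -> GLval u i j = 0)
  (u \in Upat s).
Proof.
rewrite [_ \in Upat _]inE; apply: (iffP andP) => -[uU H]; split=> //.
  by move=> i j ij sji; move/forallP/(_ i)/forallP/(_ j): H; rewrite ij sji => /eqP.
by apply/forallP => i; apply/forallP => j; apply/implyP => /andP[ij sji]; rewrite H.
Qed.

Lemma Upat_conj s u : u \in U -> (u \in Upat s) = (u ^ pm s \in B)%g.
Proof.
move=> uU; apply/UpatP/borelP => [[_ H] i j ji|H].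
  rewrite conj_pmE; case: (ltngtP (s^-1 i)%g (s^-1 j)%g) => [lt|gt|/val_inj e].
  - by apply: H; rewrite ?permKV.
  - by case/unitriP: uU => H1 _; exact: H1.
  - by rewrite (perm_inj e) ltnn in ji.
split=> // i j ij sji; have := H _ _ sji.
by rewrite conj_pmE !permK.
Qed.

Lemma conj_diag s g i : (forall j, GLval g j j = 1) -> GLval (g ^ pm s)%g i i = 1.
Proof. by move=> H; rewrite conj_pmE H. Qed.

Lemma Upat_conjU s u : u \in Upat s -> (u ^ pm s \in U)%g.
Proof.
move=> us; have [uU _] := UpatP _ _ us; rewrite Upat_conj // in us.
rewrite in_Un us; apply/forallP => i; rewrite conj_diag //.
by case/unitriP: uU.
Qed.

Lemma UpatE s : Upat s = (U :&: (B :^ (pm s)^-1))%g.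
Proof.
apply/setP => u; rewrite finset.in_setI mem_conjgV.
case uU: (u \in U); first by rewrite -(Upat_conj s).
by apply/UpatP; rewrite uU => -[].
Qed.

Lemma group_set_Upat s : group_set (Upat s).
Proof. by rewrite UpatE; exact: groupP. Qed.
Canonical Upat_group s := Group (group_set_Upat s).

Lemma Upat_sub s : Upat s \subset U.
Proof. by apply/fintype.subsetP => u /UpatP[]. Qed.

Lemma upper_unit (A : 'M[F]_m.+1) : (forall i j, (j < i)%N -> A i j = 0) ->
  (forall i, A i i != 0) -> A \in unitmx.
Proof.
move=> A0 Ai; rewrite -unitmx_tr unitmxE det_trig; last first.
  by apply/is_trig_mxP => i j ij; rewrite mxE A0.
by rewrite unitfE; apply/prodf_neq0 => i _; rewrite mxE Ai.
Qed.

(** One free coefficient for each increasing pair kept in order by s. *)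
Lemma card_Upat s : #|Upat s| =
  (#|F| ^ #|[set a : idx * idx | (a.1 < a.2)%N && (s a.1 < s a.2)%N]|)%N.
Proof.
set D := [set _ | _].
pose f (u : GL) : {ffun idx * idx -> F} := [ffun a => GLval u a.1 a.2 - (a.1 == a.2)%:R].
have f_inj : injective f.
  move=> u v /ffunP e; apply: GLP => i j; have := e (i, j).
  by rewrite !ffunE /= => /addIr.
rewrite -(card_imset _ f_inj) -(card_pffun_on (0 : F) D predT).
apply: eq_card => a; apply/imsetP/pffun_onP => [[u /UpatP[/unitriP[u0 u1] us] ->]|[aD _]].
  split=> //; apply/fintype.subsetP => -[i j]; rewrite inE ffunE /= => H.
  rewrite inE /=; move: H; case: (i =P j) => [->|/eqP ne]; first by rewrite u1 subrr eqxx.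
  rewrite subr0 => H.
  have ij : (i < j)%N.
    case: ltngtP => // [/u0 e|/val_inj e]; first by rewrite e eqxx in H.
    by rewrite e eqxx in ne.
  rewrite ij /=; case: ltngtP => // [sji|/val_inj/perm_inj e].
    by rewrite us ?eqxx in H.
  by rewrite e eqxx in ne.
pose A : 'M[F]_m.+1 := \matrix_(i, j) (a (i, j) + (i == j)%:R).
have a0 i j : (i, j) \notin D -> a (i, j) = 0.
  by move=> ijD; apply: contraNeq ijD => ij; apply: (fintype.subsetP aD); rewrite inE.
have A0 i j : (j < i)%N -> A i j = 0.
  move=> ji; rewrite mxE a0; last by rewrite inE /= negb_and -leqNgt ltnW.
  by rewrite -val_eqE gtn_eqF // addr0.
have A1 i : A i i = 1 by rewrite mxE a0 ?add0r ?eqxx // inE /= ltnn.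
have Au : A \in unitmx by apply: upper_unit => // i; rewrite A1 oner_neq0.
exists (to_GL A); last first.
  by apply/ffunP => -[i j]; rewrite ffunE /= to_GLE // mxE addrK.
apply/UpatP; rewrite to_GLE //; split.
  by apply/unitriP; rewrite to_GLE.
move=> i j ij sji; rewrite mxE a0; last by rewrite inE /= ij -leqNgt ltnW.
by rewrite -val_eqE ltn_eqF // addr0.
Qed.

Definition w0 : 'S_m.+1 := perm (@rev_ord_inj m.+1).

Lemma w0E i : w0 i = rev_ord i. Proof. by rewrite permE. Qed.

Lemma ltn_w0 i j : (w0 i < w0 j)%N = (j < i)%N.
Proof.
by rewrite !w0E /= ltn_sub2lE.
Qed.

Lemma Upat1 : Upat 1 = U.
Proof.
apply/setP => u; apply/UpatP/idP => [[]//|uU]; split=> // i j ij.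
by rewrite !perm1 ltnNge ltnW.
Qed.

Lemma Upat_w0 : Upat w0 = 1%g.
Proof.
apply/setP => u; apply/UpatP/set1gP => [[/unitriP[u0 u1] us]|->]; last first.
  split=> [|i j ij _]; first exact: group1.
  by rewrite GL1E -val_eqE ltn_eqF.
apply: GLP => i j; rewrite GL1E; case: eqP => [->//|ne].
case: (ltngtP i j) => [ij|/u0//|/val_inj//].
by apply: us => //; rewrite ltn_w0.
Qed.

(** The pairs kept in order by s and those reversed by s fill all pairs. *)
Lemma Upat_mul s : (Upat s * Upat (s * w0) = U)%g.
Proof.
have le : (Upat s * Upat (s * w0))%g \subset U by rewrite mul_subG ?Upat_sub.
apply/eqP; rewrite eqEcard le /=.
have := mul_cardG (Upat_group s) (Upat_group (s * w0)%g).
rewrite (_ : Upat_group _ :&: _ = 1%g); last first.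
  apply/trivgP/fintype.subsetP => u; rewrite inE => /andP[/UpatP[uU us] /UpatP[_ ut]].
  rewrite -Upat_w0; apply/UpatP; split=> // i j ij _.
  case: (ltngtP (s i) (s j)) => [sij|sji|/val_inj/perm_inj e].
  - by apply: ut; rewrite // !permM ltn_w0.
  - exact: us.
  - by rewrite e ltnn in ij.
rewrite cards1 muln1 => <-; rewrite -{1}Upat1 !card_Upat -expnD.
rewrite leq_exp2l; last by rewrite card_finNzRing_gt1.
rewrite -cardsUI; apply: leq_trans (leq_addr _ _); apply: subset_leq_card.
apply/fintype.subsetP => -[i j]; rewrite !inE /= !perm1 !permM ltn_w0 => /andP[ij _].
rewrite ij /=; case: ltngtP => // /val_inj/perm_inj e.
by rewrite e ltnn in ij.
Qed.

End Matrices.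

Section PermFacts.
Variable m : nat.
Local Notation idx := 'I_m.+1.
Implicit Types (s t w : 'S_m.+1) (i j : idx).

Lemma eq_leq_sum (I : finType) (f g : I -> nat) :
  (forall i : I, (f i <= g i)%N) -> (\sum_i f i = \sum_i g i)%N -> f =1 g.
Proof.
move=> le e a; apply/eqP; rewrite eqn_leq le /= leqNgt; apply/negP => lt.
have : (\sum_i f i < \sum_i g i)%N.
  by rewrite (bigD1 a) //= [ltnRHS](bigD1 a) //= -addSn leq_add ?leq_sum.
by rewrite e ltnn.
Qed.

Lemma perm_leq_eq s t : (forall i, (s i <= t i)%N) -> s = t.
Proof.
move=> le; apply/permP => i; apply: val_inj.
apply: (eq_leq_sum (f := fun i => val (s i)) (g := fun i => val (t i))) => //=.
have sumE w : (\sum_i w i = \sum_(i < m.+1) i)%N.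
  by rewrite [RHS](reindex_inj (@perm_inj _ w)).
by rewrite !sumE.
Qed.

Lemma increasing_perm s : (forall i j, (i < j)%N -> (s i < s j)%N) -> s = 1%g.
Proof.
move=> inc; apply/esym/perm_leq_eq => i; rewrite perm1.
case: i => a lt_a; elim: a lt_a => [//|a IH] lt_a /=.
by apply: leq_ltn_trans (IH (ltnW lt_a)) _; apply: inc => /=.
Qed.

(** The transposition of two consecutive indices. *)
Definition refl (k : nat) : 'S_m.+1 := tperm (inord k) (inord k.+1).

Lemma reflK k : (refl k * refl k = 1)%g. Proof. exact: tperm2. Qed.
Lemma reflV k : (refl k)^-1%g = refl k. Proof. exact: tpermV. Qed.

Lemma ltn_refl k i j : (k < m)%N -> (i < j)%N ->
  (i != inord k) || (j != inord k.+1) -> (refl k i < refl k j)%N.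
Proof.
move=> km ij; rewrite -!val_eqE /= !inordK //; last exact: ltnW.
rewrite !permE /= -!val_eqE /= !inordK //; last exact: ltnW.
do ![case: eqP => /= ?]; rewrite ?inordK //; nlia.
Qed.

Lemma refl_ind (C : 'S_m.+1 -> Prop) : C 1%g ->
  (forall s t, C s -> C t -> C (s * t)%g) ->
  (forall k, (k < m)%N -> C (refl k)) -> forall s, C s.
Proof.
move=> C1 CM Cr s.
have Ct d i : (i + d < m.+1)%N -> C (tperm (inord i) (inord (i + d))).
  elim: d => [|d IH] lt; first by rewrite addn0 tperm1.
  case: d IH lt => [|d] IH lt; first by rewrite addn1; apply: Cr; nlia.
  have [j jE] : {j | j = (i + d.+1)%N} by exists (i + d.+1)%N.
  have -> : tperm (inord i) (inord (i + d.+2)) =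
     (tperm (inord i) (inord j) ^ refl j)%g :> 'S_m.+1.
    rewrite tpermJ /refl tpermL tpermD; first by rewrite jE -addnS.
      by rewrite -val_eqE /= !inordK; nlia.
    by rewrite -val_eqE /= !inordK; nlia.
  by rewrite conjgE reflV; apply: (CM); [|apply: (CM)]; rewrite ?jE; first [apply: Cr|apply: IH]; nlia.
have Ct2 i j : C (tperm i j).
  wlog ij : i j / (i <= j)%N.
    by move=> H; case: (leqP i j) => [/H//|/ltnW/H]; rewrite tpermC.
  have := Ct (j - i)%N i; rewrite subnKC // !inord_val; exact.
by case: (prod_tpermP s) => ts -> _; elim/big_ind: _.
Qed.

End PermFacts.

Section Bruhat.
Variables (F : finFieldType) (m : nat).
Local Notation GL := (GLn F m).
Local Notation idx := 'I_m.+1.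
Local Notation B := (Bn F m).
Local Notation U := (Un F m).
Local Notation pm := (@pm F m).
Local Notation refl := (@refl m).
Implicit Types (g h u : GL) (s w : 'S_m.+1) (i j : idx).

Definition xroot i j (t : F) : GL := to_GL (1%:M + t *: delta_mx i j).

Lemma xrootE i j t a b : (i < j)%N ->
  GLval (xroot i j t) a b = (a == b)%:R + t * ((a == i) && (b == j))%:R.
Proof.
move=> ij; rewrite to_GLE ?mxE //; apply: upper_unit => [c d dc|c].
  rewrite !mxE -val_eqE gtn_eqF // add0r.
  case: (c =P i) => [e|_]; case: (d =P j) => [e'|_]; rewrite ?mulr0 //.
  by rewrite -e -e' ltnNge (ltnW dc) in ij.
rewrite !mxE eqxx; case: (c =P i) => [->|_]; last by rewrite mulr0 addr0 oner_neq0.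
by rewrite -val_eqE ltn_eqF // mulr0 addr0 oner_neq0.
Qed.

Lemma xroot_mulE i j t g a b : (i < j)%N ->
  GLval (xroot i j t * g)%g a b = GLval g a b + t * (a == i)%:R * GLval g j b.
Proof.
move=> ij; rewrite GLmE.
under eq_bigr => k _ do rewrite xrootE // mulrDl.
rewrite big_split /=; congr (_ + _).
  rewrite (bigD1 a) //= eqxx mul1r big1 ?addr0 // => k /negPf ka.
  by rewrite eq_sym ka mul0r.
rewrite (bigD1 j) //= eqxx andbT big1 ?addr0 // => k /negPf kj.
by rewrite kj andbF mulr0 mul0r.
Qed.

Lemma mul_xrootE i j t g a b : (i < j)%N ->
  GLval (g * xroot i j t)%g a b = GLval g a b + t * (b == j)%:R * GLval g a i.
Proof.
move=> ij; rewrite GLmE.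
under eq_bigr => k _ do rewrite xrootE // mulrDr.
rewrite big_split /=; congr (_ + _).
  rewrite (bigD1 b) //= eqxx mulr1 big1 ?addr0 // => k /negPf kb.
  by rewrite kb mulr0.
rewrite (bigD1 i) //= eqxx big1 ?addr0 => [|k /negPf ki]; first by rewrite mulrC.
by rewrite ki mulr0 mulr0.
Qed.

Lemma xroot_U i j t : (i < j)%N -> xroot i j t \in U.
Proof.
move=> ij; apply/unitriP; split=> [a b ba|a]; rewrite xrootE //.
  rewrite -val_eqE gtn_eqF // add0r.
  case: (a =P i) => [e|_]; case: (b =P j) => [e'|_]; rewrite ?mulr0 //.
  by rewrite -e -e' ltnNge (ltnW ba) in ij.
rewrite eqxx; case: (a =P i) => [->|_]; last by rewrite mulr0 addr0.
by rewrite -val_eqE ltn_eqF // mulr0 addr0.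
Qed.

Lemma xrootD i j t t' : (i < j)%N ->
  (xroot i j t * xroot i j t')%g = xroot i j (t + t').
Proof.
move=> ij; apply: GLP => a b; rewrite xroot_mulE // !xrootE //.
rewrite [j == i]eq_sym -[i == j]val_eqE /= ltn_eqF //= mulr0 addr0 [j == b]eq_sym.
rewrite mulrDl addrAC !addrA -mulrA -natrM mulnb; congr (_ + _).
Qed.

Lemma xroot0 i j : xroot i j 0 = 1%g.
Proof.
by apply: GLP => a b; rewrite /xroot scale0r addr0 to_GLE ?unitmx1 // GL1E mxE.
Qed.

Definition dgm (f : idx -> F) : GL := to_GL (diag_mx (\row_i f i)).

Lemma dgmE f i j : (forall i, f i != 0) -> GLval (dgm f) i j = f i *+ (i == j).
Proof.
move=> f0; rewrite to_GLE ?mxE ?mxE //; apply: upper_unit => [a b ba|a].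
  by rewrite !mxE -val_eqE gtn_eqF.
by rewrite !mxE eqxx mulr1n.
Qed.

Lemma dgm_mulE f g i j : (forall i, f i != 0) ->
  GLval (dgm f * g)%g i j = f i * GLval g i j.
Proof.
move=> f0; rewrite GLmE (bigD1 i) //= dgmE // eqxx mulr1n.
rewrite big1 ?addr0 // => k /negPf ki.
by rewrite dgmE // eq_sym ki mulr0n mul0r.
Qed.

Lemma dgm_B f : (forall i, f i != 0) -> dgm f \in B.
Proof.
by move=> f0; apply/borelP => i j ji; rewrite dgmE // -val_eqE gtn_eqF.
Qed.

Lemma dgm_pm f s : (forall i, f i != 0) ->
  (dgm f * pm s = pm s * dgm (f \o s^-1%g))%g.
Proof.
move=> f0; apply: GLP => i j; rewrite dgm_mulE // pm_mulE pmE dgmE //=.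
by rewrite permK mulr_natr.
Qed.

Lemma mul_dgmE f g i j : (forall i, f i != 0) ->
  GLval (g * dgm f)%g i j = GLval g i j * f j.
Proof.
move=> f0; rewrite GLmE (bigD1 j) //= dgmE // eqxx mulr1n.
rewrite big1 ?addr0 // => k /negPf kj.
by rewrite dgmE // kj mulr0n mulr0.
Qed.

Section Rank1.
Variables (k : nat) (km : (k < m)%N).
Local Notation i := (inord k : idx).
Local Notation j := (inord k.+1 : idx).
Local Notation s := (pm (refl k)).
Local Notation x := (xroot i j).

Lemma rank1_lt : (i < j)%N. Proof. by rewrite !inordK //; nlia. Qed.
Let ij := rank1_lt.
Let nij : (i == j) = false. Proof. by rewrite -val_eqE ltn_eqF. Qed.
Let nji : (j == i) = false. Proof. by rewrite eq_sym. Qed.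

(** The relation in SL_2 that expresses a nontrivial element of the lower root
    subgroup in terms of the upper one. *)
Lemma rank1 (t : F) : t != 0 -> exists2 d : idx -> F, forall a, d a != 0 &
  (s * x t * s = x (t^-1)%R * (dgm d * (s * x (t^-1)%R)))%g.
Proof.
move=> t0; pose d (a : idx) := if a == i then - t^-1 else if a == j then t else 1.
have d0 a : d a != 0.
  by rewrite /d; case: ifP => _; [|case: ifP => _]; rewrite ?oppr_eq0 ?invr_eq0 ?oner_neq0.
exists d => //; apply: GLP => a b.
rewrite -mulgA pm_mulE !xroot_mulE // !pmE !dgm_mulE // !pm_mulE.
rewrite !xrootE // /d /refl tpermK nji !tpermR !eqxx [b == j]eq_sym /=.
case: (a =P i) => [->|ai].
  by rewrite tpermL nji /= !(mulr0, mul0r, addr0, mulr1) mulKf // mulNr addrC addrK.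
case: (a =P j) => [->|aj].
  by rewrite tpermR eqxx /= !(mulr0, mul0r, addr0, mulr1) mulrDr mulVKf // addrC.
have [ai' aj'] : (i != a) /\ (j != a) by split; rewrite eq_sym; apply/eqP.
rewrite tpermD //; move/eqP/negPf: ai => ->.
by rewrite /= !(mulr0, mul0r, addr0, mul1r).
Qed.

(** Splitting off the root subgroup leaves a factor that s keeps in B. *)
Lemma borel_split b : b \in B -> exists t b',
  [/\ b = (b' * x t)%g, (s * b' * s)%g \in B & b \in U -> (s * b' * s)%g \in U].
Proof.
move=> bB; have bi := borel_diag_neq0 i bB.
have hb := borelP _ bB.
pose t := GLval b i j / GLval b i i; pose b' := (b * x (- t))%g.
have b'E a c : GLval (s * b' * s)%g a c =
    GLval b (refl k a) (refl k c) - t * (refl k c == j)%:R * GLval b (refl k a) i.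
  by rewrite mul_pmE pm_mulE reflV mul_xrootE // !mulNr.
have b'B : (s * b' * s)%g \in B.
  apply/borelP => a c ca; rewrite b'E.
  case: (boolP ((c != i) || (a != j))) => [H|].
    have lt := ltn_refl km ca H; rewrite hb // sub0r.
    case: (refl k c =P j) => [e|_]; last by rewrite mulr0 mul0r oppr0.
    by rewrite hb ?mulr0 ?oppr0 // (leq_trans ij) // -e ltnW.
  rewrite negb_or !negbK => /andP[/eqP-> /eqP->].
  by rewrite /refl tpermR tpermL eqxx mulr1 divfK ?subrr.
exists t, b'; split=> //.
  by rewrite /b' -mulgA xrootD // addNr xroot0 mulg1.
move=> bU; rewrite in_Un b'B; apply/forallP => a; rewrite b'E.
have [b0 ->] := unitriP _ bU.
case: (refl k a =P j) => [->|_]; last by rewrite mulr0 mul0r subr0.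
by rewrite (b0 _ _ ij) mulr0 subr0.
Qed.

Lemma xroot_refl_conj w t : (w i < w j)%N ->
  exists2 u, u \in U & (x t * pm w = pm w * u)%g.
Proof.
move=> wij; exists (x t ^ pm w)%g; last by rewrite -conjgC.
apply: (Upat_conjU (s := w)); apply/UpatP; split; first exact: xroot_U.
move=> a b ab wba; rewrite xrootE // -val_eqE ltn_eqF // add0r.
case: (a =P i) => [e|_]; case: (b =P j) => [e'|_]; rewrite ?mulr0 //.
by rewrite e e' ltnNge ltnW in wba.
Qed.
End Rank1.

(** G is generated by B and the simple reflections: a permuted LU decomposition
    provides permutation matrices, upper triangular matrices, and lower
    triangular ones, which are conjugate to upper ones by the longest element. *)
Lemma GL_gen (C : GL -> Prop) : (forall g h, C g -> C h -> C (g * h)%g) ->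
  (forall b, b \in B -> C b) ->
  (forall k, (k < m)%N -> C (pm (refl k))) -> forall g, C g.
Proof.
move=> CM CB Cr g.
have Cp s : C (pm s).
  elim/(@refl_ind m): s => [|s t Cs Ct|//]; first by rewrite pm1; apply: CB.
  by rewrite pmM; apply: CM.
have := cormen_lup_correct (GLval g).
have := cormen_lup_perm (GLval g); have := cormen_lup_detL (GLval g).
have := @cormen_lup_lower _ _ (GLval g); have := @cormen_lup_upper _ _ (GLval g).
case: (cormen_lup (GLval g)) => -[P L] V /= V0 L0 L1 /is_perm_mxP[s ->] e.
have Lu : L \in unitmx by rewrite unitmxE L1 unitr1.
have Vu : V \in unitmx.
  have : L *m V \in unitmx by rewrite -[L *m V]e unitmx_mul unitmx_perm GL_unitmx.
  by rewrite unitmx_mul => /andP[].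
have -> : g = ((pm s)^-1 * (pm (@w0 m) * (to_GL L ^ pm (@w0 m)) * (pm (@w0 m))^-1) * to_GL V)%g.
  rewrite -conjgC mulgK -mulgA; apply/(canRL (mulKg _))/val_inj.
  by rewrite [LHS]e [RHS]GL_ME !to_GLE.
apply: (CM); last by apply: CB; apply/borelP => i j ji; rewrite to_GLE // V0.
apply: (CM); first by rewrite -pmV.
apply: (CM); last by rewrite -pmV.
apply: (CM) => //; apply: CB; apply/borelP => i j ji; rewrite conj_pmE to_GLE //.
have lt : ((@w0 m)^-1 i < (@w0 m)^-1 j)%N%g by rewrite -(ltn_w0 ((@w0 m)^-1 j)%g) !permKV.
by rewrite L0 ?(ltnW lt) // -val_eqE ltn_eqF.
Qed.

(** The Bruhat decomposition. *)
Lemma bruhat g : exists b s u, [/\ b \in B, u \in U & g = (b * pm s * u)%g].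
Proof.
pose Br g := exists b s u, [/\ b \in B, u \in U & g = (b * pm s * u)%g].
suff H h : forall g, Br g -> Br (h * g)%g.
  by rewrite -[g]mulg1; apply: H; exists 1%g, 1%g, 1%g; rewrite pm1 !group1 !mulg1.
elim/GL_gen: h => [h1 h2 H1 H2 x /H2/H1|b bB x [b' [s [u [b'B uU ->]]]]|k km x].
- by rewrite mulgA.
- by exists (b * b')%g, s, u; rewrite groupM // !mulgA.
case=> b [w [u [bB uU ->]]].
have [t [b' [-> sB _]]] := borel_split km bB.
pose i : idx := inord k; pose j : idx := inord k.+1.
set s := pm _ in sB *; have sM : (s * s = 1)%g by rewrite -pmM reflK pm1.
have step c t' w' : c \in B -> (w' i < w' j)%N ->
    Br (c * (s * xroot i j t' * pm w') * u)%g.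
  move=> cB lt; have [u' u'U e] := xroot_refl_conj km t' lt.
  exists c, (refl k * w')%g, (u' * u)%g; rewrite groupM //; split=> //.
  by rewrite -(mulgA s) e pmM !mulgA.
have -> : (s * (b' * xroot i j t * pm w * u) =
           (s * b' * s) * (s * xroot i j t * pm w) * u)%g.
  by rewrite !mulgA -[(s * b' * s * s)%g]mulgA sM mulg1.
case: (ltngtP (w i) (w j)) => [lt|lt|/val_inj/perm_inj e]; first exact: step.
  have [->|t0] := eqVneq t 0.
    exists (s * b' * s)%g, (refl k * w)%g, u; split=> //.
    by rewrite xroot0 mulg1 pmM.
  have [d d0 e] := rank1 km t0.
  have -> : (s * xroot i j t * pm w =
     xroot i j (t^-1)%R * dgm d * (s * xroot i j (t^-1)%R * pm (refl k * w)))%g.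
    have -> : (s * xroot i j t = s * xroot i j t * s * s)%g by rewrite -mulgA sM mulg1.
    by rewrite e pmM !mulgA.
  rewrite mulgA; apply: step; last by rewrite !permM /refl /i /j tpermL tpermR.
  by rewrite groupM // groupM ?dgm_B ?unitri_borel ?xroot_U ?rank1_lt.
by have := rank1_lt km; rewrite -/i -/j e ltnn.
Qed.
End Bruhat.

Section Blocks.
Variables (F : finFieldType) (m : nat).
Local Notation GL := (GLn F m).
Local Notation idx := 'I_m.+1.
Local Notation B := (Bn F m).
Local Notation U := (Un F m).
Local Notation pm := (@pm F m).
Local Notation refl := (@refl m).
Local Notation w0 := (@w0 m).
Implicit Types (g h u : GL) (s t w : 'S_m.+1) (i j : idx).

Lemma card_Upat_w0V s : #|Upat F (s^-1 * w0)%g| = #|Upat F (s * w0)%g|.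
Proof.
rewrite !card_Upat; congr (_ ^ _)%N.
pose f (a : idx * idx) := (s^-1 a.2, s^-1 a.1)%g.
have f_inj : injective f by move=> [a b] [c d] [/perm_inj-> /perm_inj->].
rewrite -(card_imset _ f_inj); apply: eq_card => -[a b].
apply/imsetP/idP => [[[c d]]|].
  rewrite !inE /= !permM !ltn_w0 => /andP[cd sdc] [-> ->].
  by rewrite sdc !permKV cd.
rewrite !inE /= !permM !ltn_w0 => /andP[ab sba].
by exists (s b, s a); rewrite ?inE /f /= ?permM ?ltn_w0 !permK ?sba ?ab.
Qed.

Lemma card_Upat_mul s : (#|Upat F s| * #|Upat F (s * w0)%g| = #|U|)%N.
Proof.
rewrite -(Upat_mul F s).
have := mul_cardG (Upat_group F s) (Upat_group F (s * w0)%g) => /= ->.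
rewrite (_ : Upat_group _ _ :&: _ = 1%g) ?cards1 ?muln1 //.
apply/trivgP/fintype.subsetP => u; rewrite finset.in_setI => /andP[/UpatP[uU us] /UpatP[_ ut]].
rewrite -Upat_w0; apply/UpatP; split=> // i j ij _.
case: (ltngtP (s i) (s j)) => [sij|sji|/val_inj/perm_inj e].
- by apply: ut; rewrite // !permM ltn_w0.
- exact: us.
- by rewrite e ltnn in ij.
Qed.

Variable blk : nat -> nat.
Hypothesis blk_mono : forall a b, (a <= b)%N -> (b <= m)%N -> (blk a <= blk b)%N.

Definition Pblk : {set GL} := [set g : GL | [forall i : idx, forall j : idx,
     (blk j < blk i)%N ==> (GLval g i j == 0)]].

Definition blk_asc s := [forall k : 'I_m, (blk k == blk k.+1) ==>
  (s (inord k) < s (inord k.+1))%N].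
Definition blk_desc s := [forall k : 'I_m, (blk k == blk k.+1) ==>
  (s (inord k.+1) < s (inord k))%N].

Lemma PblkP g : reflect (forall i j, (blk j < blk i)%N -> GLval g i j = 0) (g \in Pblk).
Proof.
rewrite inE; apply: (iffP forallP) => [H i j ji|H i].
  by move/forallP/(_ j)/implyP/(_ ji)/eqP: (H i).
by apply/forallP => j; apply/implyP => ji; rewrite H.
Qed.

Lemma group_set_Pblk : group_set Pblk.
Proof.
apply/group_setP; split.
  apply/PblkP => i j ji; rewrite GL1E; case: eqP => // e.
  by rewrite e ltnn in ji.
move=> g h /PblkP gP /PblkP hP; apply/PblkP => i j ji.
rewrite GLmE big1 // => k _; case: (ltnP (blk k) (blk i)) => [/gP->|ik]; first by rewrite mul0r.
by rewrite hP ?mulr0 //; exact: leq_trans ji ik.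
Qed.
Canonical Pblk_group := Group group_set_Pblk.

Lemma blk_lt i j : (blk i < blk j)%N -> (i < j)%N.
Proof.
by move=> lt; rewrite ltnNge; apply: contraL lt => ji; rewrite -leqNgt blk_mono // -ltnS.
Qed.

Lemma borel_Pblk : B \subset Pblk.
Proof.
apply/fintype.subsetP => g /borelP gB; apply/PblkP => i j /blk_lt; exact: gB.
Qed.

(** Ascent between consecutive indices of a block extends to the whole block. *)
Lemma blk_asc_lt s i j : blk_asc s -> (i < j)%N -> blk i = blk j -> (s i < s j)%N.
Proof.
move=> /forallP sa ij bij.
have H d : (i + d.+1 <= j)%N -> (s i < s (inord (i + d.+1)))%N.
  have jm : (j < m.+1)%N by [].
  have step c : (i + c.+1 <= j)%N -> (s (inord (i + c)) < s (inord (i + c.+1)))%N.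
    move=> le; have cm : (i + c < m)%N by nlia.
    have := sa (Ordinal cm); rewrite /= addnS => /implyP; apply.
    have h1 : (blk i <= blk (i + c))%N by apply: blk_mono; nlia.
    have h2 : (blk (i + c) <= blk (i + c).+1)%N by apply: blk_mono; nlia.
    have h3 : (blk (i + c).+1 <= blk j)%N by apply: blk_mono; nlia.
    nlia.
  elim: d => [|d IH] le; first by have := step 0 le; rewrite addn0 inord_val.
  by apply: ltn_trans (step _ le); apply: IH; nlia.
have := H (j - i).-1; rewrite prednK ?subn_gt0 // subnKC ?(ltnW ij) // inord_val.
by apply.
Qed.

Lemma rPblk k : (k < m)%N -> blk k = blk k.+1 -> pm (refl k) \in Pblk.
Proof.
move=> km bk; apply/PblkP => i j ji; rewrite pmE; case: eqP => // e.
suff bE : blk (refl k i) = blk i by rewrite -e bE ltnn in ji.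
by rewrite /refl; case: tpermP => [->|->|//]; rewrite !inordK // ltnW.
Qed.

(** Distinct ascending permutations give distinct double cosets of P and U. *)
Lemma blk_asc_uniq s t p p' u u' : blk_asc s -> blk_asc t ->
  p \in Pblk -> p' \in Pblk -> u \in U -> u' \in U ->
  (p * pm s * u = p' * pm t * u')%g -> s = t.
Proof.
move=> sa ta pP pP' uU uU' e.
have e1 : (pm t * (u' * u^-1) * (pm s)^-1 = p'^-1 * p)%g.
  by apply: (mulgI p'); rewrite mulKVg !mulgA -e !mulgK.
have qP : (p'^-1 * p)%g \in Pblk by rewrite groupM ?groupV.
have vU : (u' * u^-1)%g \in U by rewrite groupM ?groupV.
have le c : (blk (t^-1 c)%g <= blk (s^-1 c)%g)%N.
  rewrite leqNgt; apply/negP => /(PblkP _ qP) /eqP.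
  rewrite -e1 -pmV mul_pmE invgK pm_mulE !permKV.
  by case/unitriP: vU => _ ->; rewrite oner_eq0.
have sumE w : (\sum_i blk (w i) = \sum_(i < m.+1) blk i)%N.
  by rewrite [RHS](reindex_inj (@perm_inj _ w)).
have bE := eq_leq_sum le (etrans (sumE _) (esym (sumE _))).
suff r1 : (t * s^-1 = 1)%g by apply/esym/eqP; rewrite eq_mulgV1 r1.
have bE' i : blk (s^-1 (t i))%g = blk i by rewrite -bE permK.
apply: increasing_perm => i j ij; rewrite !permM.
have le_b : (blk i <= blk j)%N by apply: blk_mono; [exact: ltnW | rewrite -ltnS; exact: ltn_ord].
case: (ltngtP (blk i) (blk j)) le_b => // bij _.
  by apply: blk_lt; rewrite !bE'.
have tij := blk_asc_lt ta ij bij.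
case: ltngtP => // [lt|/val_inj/perm_inj/perm_inj e2]; last by rewrite e2 ltnn in ij.
have := blk_asc_lt sa lt; rewrite !bE' bij !permKV => /(_ erefl).
by rewrite ltnNge ltnW.
Qed.

(** Every element lies in such a double coset: among the permutations that
    represent it, one maximising sum i * s(i) has no descent within a block. *)
Lemma blk_asc_exists (H : {group GL}) g : B \subset H ->
  (forall k, (k < m)%N -> blk k = blk k.+1 -> pm (refl k) \in H) ->
  exists h s u, [/\ h \in H, u \in U, blk_asc s & g = (h * pm s * u)%g].
Proof.
move=> /fintype.subsetP BH rH.
pose D s := [exists h, [exists u, [&& h \in H, u \in U & g == (h * pm s * u)%g]]].
have [b [s0 [u [bB uU gE]]]] := bruhat g.
have D0 : D s0.
  by apply/existsP; exists b; apply/existsP; exists u; rewrite BH // uU gE eqxx.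
case: (@arg_maxnP _ s0 D (fun s => \sum_(i : idx) i * s i)%N D0) => s /existsP[h /existsP[v]].
move=> /and3P[hH vU /eqP gE'] max_s.
exists h, s, v; split=> //; apply/forallP => k; apply/implyP => /eqP bk.
rewrite ltnNge; apply/negP => le.
have kr : (k < m)%N by [].
have lt : (s (inord k.+1) < s (inord k))%N.
  rewrite ltn_neqAle le andbT; apply/eqP => /val_inj/perm_inj e.
  by have := rank1_lt kr; rewrite e ltnn.
have Ds : D (refl k * s)%g.
  apply/existsP; exists (h * pm (refl k))%g; apply/existsP; exists v.
  rewrite groupM ?rH //= vU gE' pmM mulgA -(mulgA h (pm (refl k)) (pm (refl k))) -pmM reflK pm1 mulg1.
  by rewrite eqxx.
have := max_s _ Ds; rewrite /= leqNgt => /negP; apply.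
have nji : (inord k.+1 : idx) != inord k.
  by rewrite eq_sym -val_eqE ltn_eqF // rank1_lt.
rewrite (bigD1 (inord k)) //= (bigD1 (inord k.+1)) //=.
rewrite [ltnRHS](bigD1 (inord k)) //= [X in (_ < _ + X)%N](bigD1 (inord k.+1)) //=.
rewrite !permM /refl tpermL tpermR !addnA -addSn leq_add //.
  by rewrite !inordK; nlia.
apply: leq_sum => i /andP[ik ik1]; rewrite permM tpermD // eq_sym //.
Qed.

Lemma card_PsU (H : {group GL}) s :
  (#|(H :* pm s * U)%g| * #|(H :^ pm s :&: U)%g| = #|H| * #|U|)%N.
Proof.
have e : (H :* pm s * U = pm s *: (H :^ pm s * U))%g.
  by rewrite conjsgE !mulgA mulg_set1 mulgV mul1g.
rewrite e card_lcoset -(cardJg H (pm s)).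
by rewrite (mul_cardG (H :^ pm s)%G (unitri_group F m)).
Qed.

Lemma Upat_conj_sub (H : {set GL}) s : B \subset H ->
  Upat F s^-1%g \subset (H :^ pm s :&: U)%g.
Proof.
move=> /fintype.subsetP BH; apply/fintype.subsetP => u us.
have [uU _] := UpatP _ _ us; rewrite finset.in_setI uU andbT mem_conjg -pmV BH //.
by rewrite -Upat_conj.
Qed.

Lemma Pblk_conjI s : blk_asc s -> (Pblk :^ pm s :&: U)%g = Upat F s^-1%g.
Proof.
move=> sa; apply/eqP; rewrite finset.eqEsubset Upat_conj_sub ?borel_Pblk // andbT.
apply/fintype.subsetP => u; rewrite finset.in_setI mem_conjg -pmV => /andP[/PblkP uP uU].
rewrite Upat_conj //; apply/borelP => i j ji.
case: (ltngtP (blk j) (blk i)) => [|lt|bij]; first exact: uP.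
  by have := blk_lt lt; rewrite ltnNge (ltnW ji).
rewrite conj_pmE invgK; have [u0 _] := unitriP _ uU; apply: u0.
exact: blk_asc_lt.
Qed.

Lemma blk_descE s : blk_desc (s * w0)%g = blk_asc s.
Proof. by apply: eq_forallb => k; rewrite !permM ltn_w0. Qed.

(** The index of P counted by double cosets: the coset space of P in P s U has
    as many elements as there are unipotent matrices with entries at the pairs
    that s inverts. *)
Lemma sum_descE : (\sum_(s | blk_desc s) #|Upat F s| =
  \sum_(s | blk_asc s) #|Upat F (s^-1 * w0)%g|)%N.
Proof.
rewrite (reindex_inj (mulIg w0)) /=; apply: eq_big => s; first by rewrite blk_descE.
by move=> _; exact: esym (card_Upat_w0V s).
Qed.

Lemma card_Pblk : #|[set: GL]| = (#|Pblk| * \sum_(s | blk_desc s) #|Upat F s|)%N.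
Proof.
rewrite sum_descE big_distrr /=.
transitivity (\sum_(s | blk_asc s) #|(Pblk :* pm s * U)%g|)%N; last first.
  apply: eq_bigr => s sa; apply/eqP.
  rewrite -(eqn_pmul2r (cardG_gt0 (Upat_group F s^-1%g))) /= -mulnA.
  rewrite [(#|Upat F (_ * _)%g| * _)%N]mulnC card_Upat_mul -(Pblk_conjI sa).
  by rewrite -(card_PsU (Pblk_group) s).
transitivity (\sum_(g in [set: GL]) \sum_(s | blk_asc s) (g \in (Pblk :* pm s * U)%g : nat))%N.
  rewrite -sum1_card; apply: eq_bigr => g _.
  have [h [s [u [hP uU sa gE]]]] := @blk_asc_exists Pblk_group g borel_Pblk rPblk.
  rewrite (bigD1 s) //= big1 => [|t /andP[ta ts]].
    by rewrite gE mem_mulg // mem_rcoset mulgK.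
  apply/eqP; rewrite eqb0; apply: contra ts => /mulsgP[x v /rcosetP[p pP ->] vU gE'].
  by rewrite eq_sym; apply/eqP/(blk_asc_uniq sa ta hP pP uU vU); rewrite -gE.
rewrite exchange_big /=; apply: eq_bigr => s _.
by rewrite -sum1_card big_mkcond [RHS]big_mkcond; apply: eq_bigr => g _; rewrite inE; case: (g \in _).
Qed.

Lemma Pblk_gen (H : {group GL}) : B \subset H -> 
  (forall k, (k < m)%N -> blk k = blk k.+1 -> pm (refl k) \in H) ->
  H \subset Pblk -> H :=: Pblk.
Proof.
move=> BH rH HP; apply/eqP; rewrite eqEcard HP /=.
have sum_gt0 : (0 < \sum_(s | blk_desc s) #|Upat F s|)%N.
  by have := cardG_gt0 [group of [set: GL]]; rewrite /= card_Pblk muln_gt0 => /andP[].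
rewrite -(leq_pmul2r sum_gt0) -card_Pblk sum_descE big_distrr /=.
apply: (@leq_trans (\sum_(s | blk_asc s) #|(H :* pm s * U)%g|)%N); last first.
  apply: leq_sum => s sa.
  rewrite -(leq_pmul2r (cardG_gt0 (Upat_group F s^-1%g))) /= -mulnA.
  rewrite [(#|Upat F (_ * _)%g| * _)%N]mulnC card_Upat_mul -(card_PsU H s).
  by rewrite leq_mul2l subset_leq_card ?orbT // Upat_conj_sub.
apply: (@leq_trans (\sum_(g in [set: GL]) \sum_(s | blk_asc s) (g \in (H :* pm s * U)%g : nat))%N).
  rewrite -sum1_card; apply: leq_sum => g _.
  have [h [s [u [hP uU sa gE]]]] := blk_asc_exists g BH rH.
  by rewrite (bigD1 s) //= gE mem_mulg // mem_rcoset mulgK.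
rewrite exchange_big /=; apply: leq_sum => s _.
rewrite -sum1_card big_mkcond [leqRHS]big_mkcond; apply: leq_sum => g _.
by rewrite inE; case: (g \in _).
Qed.

End Blocks.

Section GroupRing.
Variables (R : pzRingType) (gT : finGroupType).
Local Notation RG := (gralg R gT).
Implicit Types (x y : RG) (g h : gT) (a b : R).

Lemma gr_mulE g x h : (gr R g * x) h = x (g^-1 * h)%g.
Proof.
rewrite ffunE (bigD1 g) //= ffunE eqxx mul1r big1 ?addr0 // => k /negPf kg.
by rewrite ffunE kg mul0r.
Qed.

Lemma grM g h : gr R (g * h)%g = gr R g * gr R h.
Proof.
apply/ffunP => k; rewrite gr_mulE !ffunE.
by rewrite -[in RHS](inj_eq (mulgI g)) mulKVg.
Qed.

Lemma gr1 : gr R (1%g : gT) = 1. Proof. by []. Qed.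

Lemma gsE a x h : (a *: x) h = a * x h. Proof. by rewrite ffunE. Qed.

Lemma gsMl a x y : (a *: x) * y = a *: (x * y).
Proof.
apply/ffunP => h; rewrite !ffunE mulr_sumr; apply: eq_bigr => g _.
by rewrite ffunE mulrA.
Qed.

Lemma gsMr_comm a x y : (forall b, b * a = a * b) -> x * (a *: y) = a *: (x * y).
Proof.
move=> ac.
apply/ffunP => h; rewrite !ffunE mulr_sumr; apply: eq_bigr => g _.
by rewrite ffunE !mulrA ac.
Qed.

Lemma gsumE (I : Type) (r : seq I) (P : pred I) (f : I -> RG) h :
  (\sum_(i <- r | P i) f i) h = \sum_(i <- r | P i) f i h.
Proof.
by elim/big_rec2: _ => [|i x y _ <-]; rewrite ffunE.
Qed.

Lemma gexpand x : x = \sum_g x g *: gr R g.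
Proof.
apply/ffunP => h; rewrite gsumE (bigD1 h) //= gsE ffunE eqxx mulr1.
rewrite big1 ?addr0 // => g /negPf gh.
by rewrite gsE ffunE eq_sym gh mulr0.
Qed.

Lemma hatsumE (S : {set gT}) h : hatsum R S h = (h \in S)%:R.
Proof.
rewrite gsumE; case: (boolP (h \in S)) => hS.
  rewrite (bigD1 h) //= ffunE eqxx big1 ?addr0 // => k /andP[_ /negPf kh].
  by rewrite ffunE eq_sym kh.
rewrite big1 // => k kS; rewrite ffunE; case: eqP => // e.
by rewrite e kS in hS.
Qed.

End GroupRing.

Section Pairing.
Variables (F : finFieldType) (m : nat).
Local Notation GL := (GLn F m).
Local Notation idx := 'I_m.+1.
Local Notation U := (Un F m).
Implicit Types (u v : GL) (y : nat -> F).

Definition superdiag u (k : nat) : F := GLval u (inord k) (inord k.+1).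
Definition pairing y u : F := \sum_(k < m) y k * superdiag u k.

Lemma superdiagM u v k : (k < m)%N -> u \in U -> v \in U ->
  superdiag (u * v)%g k = superdiag u k + superdiag v k.
Proof.
move=> km /unitriP[u0 u1] /unitriP[v0 v1]; rewrite /superdiag GLmE.
set i := inord k; set j := inord k.+1.
have ij : (i < j)%N := rank1_lt km.
rewrite (bigD1 i) //= u1 mul1r (bigD1 j) /=; last by rewrite -val_eqE gtn_eqF.
rewrite v1 mulr1 big1 ?addr0 1?addrC // => l /andP[li lj].
case: (ltngtP l i) => [lt|gt|/val_inj e]; first by rewrite u0 ?mul0r.
  have : (j < l)%N.
    rewrite ltn_neqAle eq_sym lj /=; move: gt; rewrite /i /j !inordK //; nlia.
  by move/v0 ->; rewrite mulr0.
by rewrite e eqxx in li.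
Qed.

Lemma pairingM y u v : u \in U -> v \in U ->
  pairing y (u * v)%g = pairing y u + pairing y v.
Proof.
move=> uU vU; rewrite /pairing -big_split; apply: eq_bigr => k _ /=.
by rewrite superdiagM // mulrDr.
Qed.

Lemma pairing1 y : pairing y 1%g = 0.
Proof.
rewrite /pairing big1 // => k _; rewrite /superdiag GL1E -val_eqE ltn_eqF ?mulr0 //.
exact: rank1_lt.
Qed.

Lemma pairingV y u : u \in U -> pairing y u^-1%g = - pairing y u.
Proof.
move=> uU; apply/eqP; rewrite -addr_eq0 -pairingM ?groupV // mulVg.
by rewrite pairing1.
Qed.

Lemma pairingN y u : pairing (fun k => - y k) u = - pairing y u.
Proof. by rewrite /pairing -sumrN; apply: eq_bigr => k _; rewrite mulNr. Qed.

Lemma borel_torus (b : GL) : b \in Bn F m ->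
  exists2 f : idx -> F, forall i, f i != 0 & (b * dgm f)%g \in U.
Proof.
move=> bB; pose f (i : idx) := (GLval b i i)^-1.
have f0 i : f i != 0 by rewrite invr_eq0 borel_diag_neq0.
exists f => //; rewrite in_Un groupM ?dgm_B //; apply/forallP => i.
by rewrite mul_dgmE // divff ?borel_diag_neq0.
Qed.

Lemma pm_U_pm (s t : 'S_m.+1) u : u \in U ->
  ((pm F t)^-1 * u * pm F s)%g \in Bn F m -> t = s.
Proof.
move=> /unitriP[_ u1] /borelP H; apply: perm_leq_eq => c.
rewrite leqNgt; apply/negP => /H /eqP.
by rewrite mul_pmE -pmV pm_mulE !permK u1 oner_eq0.
Qed.

Definition chr_desc y (s : 'S_m.+1) := [forall k : 'I_m,
  (y k != 0) ==> (s (inord k.+1) < s (inord k))%N].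

Lemma pairing_desc y s u : chr_desc y s -> u \in Upat F s -> pairing y u = 0.
Proof.
move=> /forallP sd /UpatP[uU us]; rewrite /pairing big1 // => k _.
have [->|yk] := eqVneq (y k) 0; first by rewrite mul0r.
rewrite /superdiag us ?mulr0 //; first exact: rank1_lt.
by have /implyP := sd k; apply.
Qed.

Lemma pairing_xroot y k t : (k < m)%N ->
  pairing y (xroot (inord k) (inord k.+1) t) = y k * t.
Proof.
move=> km; rewrite /pairing (bigD1 (Ordinal km)) //= big1 ?addr0.
  rewrite /superdiag xrootE ?rank1_lt // !eqxx mulr1.
  by rewrite -val_eqE ltn_eqF ?add0r // rank1_lt.
move=> l lk; rewrite /superdiag xrootE ?rank1_lt //.
have lm : (l < m.+1)%N by exact: leqW.
have km' : (k < m.+1)%N by exact: leqW.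
rewrite -val_eqE ltn_eqF ?rank1_lt // add0r -[inord l == _]val_eqE /= !inordK //.
by move: lk; rewrite -val_eqE /= => /negPf ->; rewrite /= mulr0 mulr0.
Qed.

Lemma xroot_Upat (s : 'S_m.+1) k t : (k < m)%N ->
  (s (inord k) < s (inord k.+1))%N -> xroot (inord k) (inord k.+1) t \in Upat F s.
Proof.
move=> km lt; apply/UpatP; split; first by rewrite xroot_U ?rank1_lt.
move=> a b ab sba; rewrite xrootE ?rank1_lt // -val_eqE ltn_eqF // add0r.
case: (a =P _) => [e|_]; case: (b =P _) => [e'|_]; rewrite ?mulr0 //.
by move: sba; rewrite e e' ltnNge ltnW.
Qed.

Lemma Upat_w0E (s : 'S_m.+1) u : (u \in Upat F (s * w0 m)%g) =
  (u \in U) && (u ^ pm F (s * w0 m)%g \in Bn F m)%g.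
Proof.
case uU: (u \in U) => /=; first by rewrite Upat_conj.
by apply/UpatP; rewrite uU => -[].
Qed.

End Pairing.

(* Unification that looks inside the group is prohibitively expensive. *)
Opaque GLn.

Section SteinbergElements.
Variables (F : finFieldType) (m : nat) (R : idomainType).
Local Notation GL := (GLn F m).
Local Notation idx := 'I_m.+1.
Local Notation B := (Bn F m).
Local Notation U := (Un F m).
Local Notation pm := (@pm F m).
Local Notation refl := (@refl m).
Local Notation w0 := (@w0 m).
Local Notation RG := (gralg R GL).
Local Notation gr := (gr R).
Implicit Types (g h u v b : GL) (s w : 'S_m.+1) (i j : idx) (x : RG) (y : nat -> F).

Lemma gsMr a x x' : x * (a *: x') = a *: (x * x').
Proof. by apply: gsMr_comm => b; rewrite mulrC. Qed.

Definition cosB g : RG := gr g * hatsum R B.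
Definition eps : RG := steinberg_elt F m.+1 R.

Lemma epsE : eps = \sum_s (-1) ^+ odd_perm s *: cosB (pm s).
Proof. by []. Qed.

Lemma cosBE g h : cosB g h = ((g^-1 * h)%g \in B)%:R.
Proof. by rewrite gr_mulE hatsumE. Qed.

Lemma gr_cosB g h : gr g * cosB h = cosB (g * h)%g.
Proof. by rewrite /cosB grM mulrA. Qed.

Lemma cosB_mulr g b : b \in B -> cosB (g * b)%g = cosB g.
Proof.
move=> bB; apply/ffunP => h; rewrite cosBE [RHS]cosBE invMg -mulgA.
have bV : b^-1%g \in B by rewrite groupV.
by rewrite (groupMl _ bV).
Qed.

Lemma eps_mulr g b : b \in B -> eps (g * b)%g = eps g.
Proof.
move=> bB; rewrite epsE !gsumE; apply: eq_bigr => s _; rewrite gsE [RHS]gsE cosBE [in RHS]cosBE.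
by rewrite mulgA (groupMr _ bB).
Qed.

Lemma dgm_eps (f : idx -> F) : (forall i, f i != 0) -> gr (dgm f) * eps = eps.
Proof.
move=> f0; rewrite epsE mulr_sumr; apply: eq_bigr => s _.
rewrite gsMr gr_cosB (dgm_pm s f0) (@cosB_mulr (pm s) (dgm (f \o s^-1%g))) //.
by apply: dgm_B => i; exact: f0.
Qed.

Lemma borel_eps b : b \in B -> exists2 u, u \in U & gr b * eps = gr u * eps.
Proof.
move=> /borel_torus[f f0 bU]; exists (b * dgm f)%g; first by [].
by rewrite grM -mulrA (dgm_eps f0).
Qed.

Section Rank1.
Variables (k : nat) (km : (k < m)%N).
Local Notation i := (inord k : idx).
Local Notation j := (inord k.+1 : idx).
Local Notation s := (pm (refl k)).

Definition half_eps : RG :=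
  \sum_(w : 'S_m.+1 | (w i < w j)%N) (-1) ^+ odd_perm w *: cosB (pm w).

Lemma eps_half : eps = half_eps - gr s * half_eps.
Proof.
rewrite epsE (bigID (fun w : 'S_m.+1 => (w i < w j)%N)) /=; congr (_ + _).
rewrite mulr_sumr -sumrN (reindex_inj (mulgI (refl k))) /=.
apply: eq_big => w; first rewrite !permM /refl tpermL tpermR -leqNgt leq_eqVlt.
  case: eqP => // /val_inj/perm_inj e.
  by have := rank1_lt km; rewrite e ltnn.
move=> _; rewrite gsMr gr_cosB -pmM odd_mul_tperm.
have -> : i != j by rewrite -val_eqE ltn_eqF // rank1_lt.
by rewrite addTb signrN scaleNr.
Qed.

Lemma xroot_half t : gr (xroot i j t) * half_eps = half_eps.
Proof.
rewrite mulr_sumr; apply: eq_bigr => w wij; rewrite gsMr gr_cosB.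
have [u /unitri_borel uB ->] := xroot_refl_conj km t wij.
by rewrite (cosB_mulr _ uB).
Qed.

Lemma refl_eps : gr s * eps = - eps.
Proof.
by rewrite eps_half mulrBr mulrA -grM -pmM reflK pm1 gr1 mul1r opprB.
Qed.

Lemma refl_xroot_eps (t : F) : t != 0 ->
  gr (s * xroot i j t)%g * eps = gr (xroot i j t^-1) * eps - eps.
Proof.
move=> t0; have [d d0 e] := rank1 km t0.
have ss : gr s * gr s = 1 by rewrite -grM -pmM reflK pm1.
have h : gr (s * xroot i j t * s)%g * half_eps =
         gr (xroot i j t^-1) * (gr s * half_eps).
  rewrite e !grM -!mulrA xroot_half; congr (_ * _).
  rewrite /half_eps !mulr_sumr; apply: eq_bigr => w wij.
  have d1 a : (d \o (refl k)^-1%g) a != 0 by exact: d0.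
  have d2 a : ((d \o (refl k)^-1%g) \o w^-1%g) a != 0 by exact: d1.
  rewrite !gsMr !gr_cosB mulgA (dgm_pm _ d0) -mulgA (dgm_pm _ d1) mulgA.
  by rewrite (cosB_mulr _ (dgm_B d2)).
have -> : gr (s * xroot i j t)%g * eps =
    gr s * half_eps - gr (xroot i j t^-1) * (gr s * half_eps).
  rewrite eps_half mulrBr [gr _ * (gr _ * _) in LHS]mulrA -[in X in _ - X * _ = _]grM h.
  by rewrite grM -mulrA xroot_half.
have -> : gr (xroot i j t^-1) * eps = half_eps - gr (xroot i j t^-1) * (gr s * half_eps).
  by rewrite eps_half mulrBr xroot_half.
by rewrite eps_half opprB [RHS]addrC addrA subrK.
Qed.
End Rank1.

(** The lattice is spanned by the translates of eps by U. *)
Definition Uspan x := exists c : GL -> R, x = \sum_(u in U) c u *: (gr u * eps).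

Lemma Uspan_eps u : u \in U -> Uspan (gr u * eps).
Proof.
move=> uU; exists (fun v => (v == u)%:R); rewrite (bigD1 u uU) /= eqxx scale1r.
rewrite big1 ?addr0; first by [].
by move=> v /andP[_ /negPf->]; rewrite scale0r.
Qed.

Lemma UspanZ a x : Uspan x -> Uspan (a *: x).
Proof.
case=> c ->; exists (fun u => a * c u); rewrite scaler_sumr.
by apply: eq_bigr => u _; rewrite scalerA.
Qed.

Lemma UspanD x x' : Uspan x -> Uspan x' -> Uspan (x + x').
Proof.
move=> [c ->] [c' ->]; exists (fun u => c u + c' u); rewrite -big_split.
by apply: eq_bigr => u _; rewrite scalerDl.
Qed.

Lemma Uspan_sum (I : Type) (r : seq I) (P : pred I) (f : I -> RG) :
  (forall a : I, P a -> Uspan (f a)) -> Uspan (\sum_(i <- r | P i) f i).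
Proof.
move=> H; elim/big_ind: _ => [||a Pa]; [|exact: UspanD|exact: H].
by exists (fun=> 0); rewrite big1 => [//|u _]; rewrite scale0r.
Qed.

Lemma Uspan_gr g x : Uspan x -> Uspan (gr g * x).
Proof.
elim/GL_gen: g x => [g h IHg IHh x xs|b bB x [c ->]|k km x [c ->]].
- by rewrite grM -mulrA; apply/IHg/IHh.
- rewrite mulr_sumr; apply: Uspan_sum => u uU; rewrite gsMr mulrA -grM.
  have [v vU ->] := borel_eps (groupM bB (unitri_borel uU)).
  exact/UspanZ/Uspan_eps.
rewrite mulr_sumr; apply: Uspan_sum => u uU; rewrite gsMr; apply: UspanZ.
have [t [u' [uE _ /(_ uU) u''U]]] := borel_split km (unitri_borel uU).
rewrite {}uE.
set s := pm _ in u''U *.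
have sM : (s * s = 1)%g by rewrite -pmM reflK pm1.
have e : (s * (u' * xroot (inord k) (inord k.+1) t) =
          (s * u' * s) * (s * xroot (inord k) (inord k.+1) t))%g.
  by rewrite !mulgA -[(s * u' * s * s)%g]mulgA sM mulg1.
rewrite mulrA -grM e grM -mulrA.
have [->|t0] := eqVneq t 0.
  rewrite xroot0 mulg1 (refl_eps km) -scaleN1r gsMr.
  exact/UspanZ/Uspan_eps.
rewrite (refl_xroot_eps km t0) mulrBr mulrA -grM -scaleN1r; apply: UspanD.
  by apply: Uspan_eps; rewrite groupM // xroot_U // rank1_lt.
exact/UspanZ/Uspan_eps.
Qed.

Lemma Uspan_mul x x' : Uspan x -> Uspan (x' * x).
Proof.
move=> xs; rewrite [x']gexpand mulr_suml; apply: Uspan_sum => g _.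
by rewrite gsMl; apply/UspanZ/Uspan_gr.
Qed.

Lemma Uspan_ideal x : Uspan (x * eps).
Proof. by apply: Uspan_mul; rewrite -[eps]mul1r -gr1; apply: Uspan_eps. Qed.

End SteinbergElements.
Transparent GLn.

Opaque GLn.
Section Characters.
Variables (F : finFieldType) (m : nat) (R : idomainType).
Local Notation GL := (GLn F m).
Local Notation idx := 'I_m.+1.
Local Notation B := (Bn F m).
Local Notation U := (Un F m).
Local Notation pm := (@pm F m).
Local Notation w0 := (@w0 m).
Local Notation RG := (gralg R GL).
Local Notation gr := (gr R).
Local Notation eps := (eps F m R).
Implicit Types (g h u v b : GL) (s w : 'S_m.+1) (i j : idx) (x : RG) (y : nat -> F).

Variable psi : F -> R.
Hypotheses (psi0 : psi 0 = 1) (psiD : forall a a', psi (a + a') = psi a * psi a').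

Lemma psiNK a : psi a * psi (- a) = 1.
Proof. by rewrite -psiD subrr psi0. Qed.

Definition chr y u : R := psi (pairing y u).

Lemma chrM y u v : u \in U -> v \in U -> chr y (u * v)%g = chr y u * chr y v.
Proof. by move=> uU vU; rewrite /chr pairingM // psiD. Qed.

Lemma chrVK y u : u \in U -> chr y u * chr y u^-1%g = 1.
Proof. by move=> uU; rewrite /chr pairingV // psiNK. Qed.

Lemma chrVK' y u : u \in U -> chr y u^-1%g * chr y u = 1.
Proof. by move=> uU; rewrite mulrC chrVK. Qed.

Definition hatU y : RG := \sum_(u in U) chr y u *: gr u.
Definition Ey y : RG := hatU y * eps.

Lemma hatU_gr y u : u \in U -> hatU y * gr u = chr y u^-1%g *: hatU y.
Proof.
move=> uU; rewrite /hatU mulr_suml scaler_sumr.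
rewrite (reindex_inj (mulIg u^-1%g)) /=; apply: eq_big => v.
  by rewrite groupMr ?groupV.
rewrite groupMr ?groupV // => vU.
by rewrite gsMl -grM mulgKV scalerA chrM ?groupV // mulrC.
Qed.

Lemma gr_hatU y u : u \in U -> gr u * hatU y = chr y u^-1%g *: hatU y.
Proof.
move=> uU; rewrite /hatU mulr_sumr scaler_sumr.
rewrite (reindex_inj (mulgI u^-1%g)) /=; apply: eq_big => v.
  by rewrite groupMl ?groupV.
rewrite groupMl ?groupV // => vU.
by rewrite gsMr -grM mulKVg scalerA chrM ?groupV.
Qed.

Lemma hatU_idem y : hatU y * hatU y = #|U|%:R *: hatU y.
Proof.
rewrite {1}/hatU mulr_suml -sum1_card natr_sum scaler_suml.
by apply: eq_bigr => u uU; rewrite gsMl gr_hatU // scalerA chrVK.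
Qed.

Lemma gr_Ey y u : u \in U -> gr u * Ey y = chr y u^-1%g *: Ey y.
Proof. by move=> uU; rewrite /Ey mulrA gr_hatU // gsMl. Qed.

Lemma hatU_Ey y : hatU y * Ey y = #|U|%:R *: Ey y.
Proof. by rewrite /Ey mulrA hatU_idem gsMl. Qed.

(** The character occurs once in the lattice. *)
Lemma hatU_line y x : Uspan x -> exists r, hatU y * x = r *: Ey y.
Proof.
case=> c ->; exists (\sum_(u in U) c u * chr y u^-1%g).
rewrite mulr_sumr scaler_suml; apply: eq_bigr => u uU.
by rewrite gsMr mulrA hatU_gr // gsMl scalerA.
Qed.

(** Values of E on the group, as a function that is equivariant for U on the
    left and invariant under B on the right. *)
Lemma Ey_left y u g : u \in U -> Ey y (u * g)%g = chr y u * Ey y g.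
Proof.
move=> uU; have := gr_Ey y (groupVr uU); rewrite invgK => e.
by rewrite -gsE -e gr_mulE invgK.
Qed.

Lemma Ey_right y b g : b \in B -> Ey y (g * b)%g = Ey y g.
Proof.
move=> bB; rewrite /Ey /hatU mulr_suml !gsumE; apply: eq_bigr => u uU.
by rewrite gsMl gsE [RHS]gsE !gr_mulE mulgA eps_mulr.
Qed.

Lemma pm_in_B s t u : u \in U -> ((pm t)^-1 * u * pm s)%g \in B -> t = s.
Proof. exact: pm_U_pm. Qed.

Lemma eps_pm u s : u \in U ->
  eps (u^-1 * pm s)%g = (-1) ^+ odd_perm s * (u \in Upat F s)%:R.
Proof.
move=> uU; rewrite epsE gsumE (bigD1 s) //= big1 => [|t ts]; last first.
  rewrite gsE cosBE mulgA; case: (boolP (_ \in _)) => [|_]; last by rewrite mulr0.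
  by move/(pm_in_B (groupVr uU))/eqP; rewrite (negPf ts).
rewrite addr0 gsE cosBE Upat_conj // conjgE -(groupV _ ((_ * (u * _))%g)).
by rewrite !invMg invgK !mulgA.
Qed.

Lemma Ey_pm y s : Ey y (pm s) =
  (-1) ^+ odd_perm s * \sum_(u in Upat F s) chr y u.
Proof.
rewrite /Ey /hatU mulr_suml gsumE mulr_sumr [RHS]big_mkcond [LHS]big_mkcond /=.
apply: eq_bigr => u _; case: (boolP (u \in U)) => uU; last first.
  by case: (boolP (_ \in Upat _ _)) => // /UpatP[]; rewrite (negPf uU).
rewrite gsMl gsE gr_mulE eps_pm //; case: (u \in Upat F s).
  by rewrite mulr1 mulrC.
by rewrite !mulr0.
Qed.
Hypothesis natR : forall n, (0 < n)%N -> n%:R != 0 :> R.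
Hypothesis psi_nontriv : exists a, psi a != 1.

Lemma sum_chr_Upat y s :
  \sum_(u in Upat F s) chr y u = (#|Upat F s| * chr_desc y s)%:R.
Proof.
case: (boolP (chr_desc y s)) => sd.
  rewrite muln1 -sum1_card natr_sum; apply: eq_bigr => u us.
  by rewrite /chr (pairing_desc sd us) psi0.
move: sd; rewrite negb_forall muln0 => /existsP[k]; rewrite negb_imply.
move=> /andP[yk]; rewrite -leqNgt => le.
have km : (k < m)%N by [].
have lt : (s (inord k) < s (inord k.+1))%N.
  rewrite ltn_neqAle le andbT; apply/eqP => /val_inj/perm_inj e.
  by have := rank1_lt km; rewrite e ltnn.
have [a psia] := psi_nontriv.
pose x0 := xroot (inord k) (inord k.+1) (a / y k) : GL.
have x0s : x0 \in Upat F s by exact: xroot_Upat.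
have /fintype.subsetP sU := Upat_sub F s.
have chrx : chr y x0 = psi a by rewrite /chr pairing_xroot // mulrC divfK.
have e : \sum_(u in Upat F s) chr y u = psi a * \sum_(u in Upat F s) chr y u.
  rewrite {1}(reindex_inj (mulgI x0)) mulr_sumr /=; apply: eq_big => u.
    by rewrite groupMl.
  by rewrite groupMl // => us; rewrite chrM ?sU // chrx.
move/eqP: e; rewrite -subr_eq0 -{1}[X in X - _]mul1r -mulrBl mulf_eq0 subr_eq0.
by rewrite eq_sym (negPf psia) => /eqP.
Qed.

Lemma Ey_pmE y s : Ey y (pm s) =
  (-1) ^+ odd_perm s * (#|Upat F s| * chr_desc y s)%:R.
Proof. by rewrite Ey_pm sum_chr_Upat. Qed.

Lemma Ey_w0 y : Ey y (pm w0) = (-1) ^+ odd_perm w0.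
Proof.
rewrite Ey_pmE Upat_w0 cards1 mul1n; case: (boolP (chr_desc _ _)) => [|/negP[]].
  by rewrite mulr1.
by apply/forallP => k; rewrite ltn_w0 rank1_lt ?implybT.
Qed.

Lemma dotg_cosB x g : (forall b h, b \in B -> x (h * b)%g = x h) ->
  dotg x (cosB R g) = #|B|%:R * x g.
Proof.
move=> xB; rewrite /dotg (reindex_inj (mulgI g)) /=.
rewrite -sum1_card natr_sum mulr_suml [RHS]big_mkcond /=; apply: eq_bigr => b _.
rewrite cosBE mulKg; case: (boolP (b \in B)) => bB; last by rewrite mulr0.
by rewrite xB // mulr1 mul1r.
Qed.

Lemma dotgC x x' : dotg x x' = dotg x' x.
Proof. by apply: eq_bigr => g _; rewrite mulrC. Qed.

Lemma dotgDl x x' z : dotg (x + x') z = dotg x z + dotg x' z.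
Proof. by rewrite /dotg -big_split; apply: eq_bigr => g _; rewrite ffunE mulrDl. Qed.

Lemma dotgZl a x z : dotg (a *: x) z = a * dotg x z.
Proof. by rewrite /dotg mulr_sumr; apply: eq_bigr => g _; rewrite gsE mulrA. Qed.

Lemma dotgDr x x' z : dotg z (x + x') = dotg z x + dotg z x'.
Proof. by rewrite dotgC dotgDl !(dotgC z). Qed.

Lemma dotgZr a x z : dotg z (a *: x) = a * dotg z x.
Proof. by rewrite dotgC dotgZl dotgC. Qed.

Lemma dotg_sumr (I : Type) (r : seq I) (P : pred I) (f : I -> RG) z :
  dotg z (\sum_(i <- r | P i) f i) = \sum_(i <- r | P i) dotg z (f i).
Proof.
elim/big_rec2: _ => [|i a x Pi <-]; last by rewrite dotgDr.
by rewrite /dotg big1 // => g _; rewrite ffunE mulr0.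
Qed.

Definition ind y : nat := (\sum_(s : 'S_m.+1 | chr_desc y s) #|Upat F s|)%N.

(** The value of the form that governs the filtration. *)
Lemma dotg_Ey_eps y : dotg (Ey y) eps = (#|B| * ind y)%:R.
Proof.
rewrite epsE dotg_sumr /ind big_distrr natr_sum [RHS]big_mkcond /=.
apply: eq_bigr => s _; rewrite dotgZr dotg_cosB; last by move=> b h; exact: Ey_right.
rewrite Ey_pmE mulrCA signrMK.
by case: (chr_desc y s); rewrite ?muln1 ?muln0 ?mulr0 ?natrM.
Qed.

Lemma gr_adj_gr g : gr_adj (gr g) = gr g^-1%g.
Proof. by apply/ffunP => h; rewrite !ffunE -{1}[g]invgK (inj_eq invg_inj). Qed.

Lemma dotg_Ey_gr y u : u \in U -> dotg (Ey y) (gr u * eps) = chr y u * dotg (Ey y) eps.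
Proof.
move=> uU; rewrite dotgC dotg_adj gr_adj_gr gr_Ey ?groupV // invgK.
by rewrite dotgZr dotgC.
Qed.

Lemma dotg_Ey y x : Uspan x -> exists r, dotg (Ey y) x = r * dotg (Ey y) eps.
Proof.
case=> c ->; exists (\sum_(u in U) c u * chr y u).
rewrite dotg_sumr mulr_suml; apply: eq_bigr => u uU.
by rewrite dotgZr dotg_Ey_gr // mulrA.
Qed.

(** Change of character: the coefficient is found at the single point pm w * pm w0,
    where the translate of E by w takes its value on the big cell. *)
Lemma hatU_pm_Ey y y' w :
  (forall u, u \in Upat F w -> chr y (u ^ pm w)%g = chr y' u) ->
  chr_desc y' (w * w0)%g ->
  hatU y' * (gr (pm w) * Ey y) = ((-1) ^+ odd_perm w * #|Upat F w|%:R) *: Ey y'.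
Proof.
move=> hw hd.
have yS : Uspan (Ey y) by apply: Uspan_ideal.
have [r e] := hatU_line y' (Uspan_gr (pm w) yS); rewrite e; congr (_ *: _).
have e1 : (hatU y' * (gr (pm w) * Ey y)) (pm (w * w0)%g) = #|U|%:R * Ey y (pm w0).
  rewrite /hatU mulr_suml gsumE -sum1_card natr_sum mulr_suml.
  rewrite (reindex_inj invg_inj) /=; apply: eq_big => u; first by rewrite groupV.
  rewrite groupV => uU; rewrite gsMl gsE !gr_mulE invgK pmM.
  have : u \in (Upat F w * Upat F (w * w0))%g by rewrite Upat_mul.
  case/mulsgP => v z vw zw uE.
  have /fintype.subsetP sU := Upat_sub F w.
  have /fintype.subsetP sU' := Upat_sub F (w * w0)%g.
  have [vU zU] : v \in U /\ z \in U by split; [exact: sU|exact: sU'].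
  have zB : (z ^ (pm w * pm w0) \in B)%g.
    by rewrite -pmM; move: zw; rewrite Upat_w0E => /andP[].
  have -> : ((pm w)^-1 * (u * (pm w * pm w0)) =
             v ^ pm w * (pm w0 * z ^ (pm w * pm w0)))%g.
    by rewrite uE !conjgE !invMg !mulgA !mulgK.
  rewrite Ey_left; last exact: Upat_conjU.
  rewrite Ey_right // hw // mulrA mul1r uE invMg chrM ?groupV //.
  have -> : chr y' z^-1%g = 1.
    by rewrite /chr pairingV // (pairing_desc hd zw) oppr0.
  by rewrite mul1r chrVK' // mul1r.
move: e1; rewrite e gsE Ey_w0 Ey_pmE hd muln1 odd_permM.
rewrite -(card_Upat_mul F w) natrM => e2.
have U0 : #|Upat F (w * w0)%g|%:R != 0 :> R by apply: natR; exact: cardG_gt0.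
have S0 : (-1) ^+ odd_perm w * (-1) ^+ odd_perm w0 * #|Upat F (w * w0)%g|%:R != 0 :> R.
  by rewrite !mulf_neq0 ?signr_eq0.
apply: (mulIf S0); move: e2; rewrite signr_addb => ->.
by rewrite mulrACA signrMK mulrC.
Qed.

End Characters.
Transparent GLn.

Section Columns.
Variables (F : finFieldType) (m : nat).
Local Notation GL := (GLn F m).
Local Notation idx := 'I_m.+1.
Local Notation B := (Bn F m).
Local Notation U := (Un F m).
Implicit Types (g h u v w : GL) (i j k a b : idx) (c d f : idx -> F) (y : nat -> F).

(** Unipotent matrices with nothing off the diagonal but the column k. *)
Definition acol k c : GL :=
  to_GL (\matrix_(a, b) ((a == b)%:R + ((b == k) && (a < k)%N)%:R * c a)).

Lemma acolE k c a b :
  GLval (acol k c) a b = (a == b)%:R + ((b == k) && (a < k)%N)%:R * c a.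
Proof.
have H a' b' : ~~ (a' < b')%N -> ((b' == k) && (a' < k)%N) = false.
  by apply: contraNF => /andP[/eqP->].
rewrite to_GLE ?mxE //; apply: upper_unit => [a' b' ba|a']; rewrite mxE H ?mul0r ?addr0.
- by rewrite -val_eqE gtn_eqF.
- by rewrite -leqNgt ltnW.
- by rewrite eqxx oner_neq0.
- by rewrite ltnn.
Qed.

Lemma acol_U k c : acol k c \in U.
Proof.
have H a' b' : ~~ (a' < b')%N -> ((b' == k) && (a' < k)%N) = false.
  by apply: contraNF => /andP[/eqP->].
apply/unitriP; split=> [a b ba|a]; rewrite acolE H ?mul0r ?addr0.
- by rewrite -val_eqE gtn_eqF.
- by rewrite -leqNgt ltnW.
- by rewrite eqxx.
- by rewrite ltnn.
Qed.

Lemma acol_mulE k c g a b :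
  GLval (acol k c * g)%g a b = GLval g a b + (a < k)%N%:R * c a * GLval g k b.
Proof.
rewrite GLmE; under eq_bigr => l _ do rewrite acolE mulrDl.
rewrite big_split /=; congr (_ + _).
  rewrite (bigD1 a) //= eqxx mul1r big1 ?addr0 // => l /negPf la.
  by rewrite eq_sym la mul0r.
rewrite (bigD1 k) //= eqxx big1 ?addr0 // => l /negPf lk.
by rewrite lk !mul0r.
Qed.

Lemma eq_acol k c d : (forall a, (a < k)%N -> c a = d a) -> acol k c = acol k d.
Proof.
move=> e; apply: GLP => a b; rewrite !acolE; congr (_ + _).
by case: (boolP (_ && _)) => [/andP[_ /e->]|]; rewrite ?mul0r.
Qed.

Lemma acolD k c d : (acol k c * acol k d)%g = acol k (fun a => c a + d a).
Proof.
apply: GLP => a b; rewrite acol_mulE !acolE.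
rewrite ltnn andbF mul0r addr0 [k == b]eq_sym mulrDr.
rewrite -addrA; congr (_ + _); rewrite addrC; congr (_ + _).
by rewrite mulrAC -natrM mulnb andbC.
Qed.

Lemma acol0 k c : (forall a, (a < k)%N -> c a = 0) -> acol k c = 1%g.
Proof.
move=> c0; apply: GLP => a b; rewrite acolE GL1E.
by case: (boolP (_ && _)) => [/andP[_ /c0->]|]; rewrite ?mul0r ?mulr0 addr0.
Qed.

Lemma superdiag_acol k c (l : nat) : (l < m)%N ->
  superdiag (acol k c) l = (l.+1 == k)%:R * c (inord l).
Proof.
move=> lm; have lm' : (l < m.+1)%N by exact: leqW.
rewrite /superdiag acolE -val_eqE ltn_eqF ?rank1_lt // add0r.
rewrite -[inord l.+1 == k]val_eqE /= !inordK //.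
by case: (l.+1 =P k) => [<-|]; rewrite ?ltnSn.
Qed.

Lemma pairing_acol y k c :
  pairing y (acol k c) = if (0 < k)%N then y k.-1 * c (inord k.-1) else 0.
Proof.
rewrite /pairing; case: ifP => k0; last first.
  rewrite big1 // => l _; rewrite superdiag_acol //.
  by rewrite (_ : (_ == _) = false) ?mul0r ?mulr0 //; apply/eqP; nlia.
have lt : (k.-1 < m)%N by have := ltn_ord k; nlia.
rewrite (bigD1 (Ordinal lt)) //= superdiag_acol // prednK // eqxx mul1r.
rewrite big1 ?addr0 // => l lk; rewrite superdiag_acol //.
move: lk; rewrite -val_eqE /= => lk.
by rewrite (_ : (_ == _) = false) ?mul0r ?mulr0 //; apply/eqP; nlia.
Qed.

(** The part of U that is trivial in the columns before k. *)
Definition Uge (k : nat) : {set GL} := [set u in U | [forall i : idx, forall j : idx,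
  (j < k)%N ==> (GLval u i j == (i == j)%:R)]].

Lemma in_Uge (k : nat) u : (u \in Uge k) = (u \in U) && [forall i : idx, forall j : idx,
  (j < k)%N ==> (GLval u i j == (i == j)%:R)].
Proof. by rewrite [LHS]inE. Qed.

Lemma UgeP (k : nat) u : reflect
  (u \in U /\ forall i j, (j < k)%N -> GLval u i j = (i == j)%:R) (u \in Uge k).
Proof.
rewrite in_Uge; apply: (iffP andP) => -[uU H]; split=> //.
  by move=> i j jk; move/forallP/(_ i)/forallP/(_ j): H; rewrite jk => /eqP.
by apply/forallP => i; apply/forallP => j; apply/implyP => jk; rewrite H.
Qed.

Lemma UgeT u : u \in U -> u \in Uge 1.
Proof.
move=> uU; apply/UgeP; split=> // i j; rewrite ltnS leqn0 => /eqP j0.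
have [u0 u1] := unitriP _ uU.
case: (i =P j) => [->|/eqP ij]; first by rewrite u1.
rewrite u0 // j0 lt0n; apply: contra ij => i0; rewrite -val_eqE /= j0.
by rewrite -(eqP i0).
Qed.

Lemma Uge1 u : u \in Uge m.+1 -> u = 1%g.
Proof. by move=> /UgeP[_ H]; apply: GLP => i j; rewrite H // GL1E. Qed.

Lemma Uge_split k u : u \in Uge k -> exists2 w, w \in Uge k.+1 &
  u = (acol k (fun a => GLval u a k) * w)%g.
Proof.
move=> /UgeP[uU uk]; have [u0 u1] := unitriP _ uU.
exists (acol k (fun a => - GLval u a k) * u)%g; last first.
  by rewrite mulgA acolD acol0 ?mul1g // => a _; rewrite addrN.
apply/UgeP; split=> [|i j]; first by rewrite groupM ?acol_U.
rewrite ltnS leq_eqVlt => /orP[/eqP/val_inj->|jk]; rewrite acol_mulE; last first.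
  by rewrite (uk i j) // (u0 k j) // mulr0 addr0.
rewrite u1 mulr1; case: (ltngtP i k) => [ik|ki|/val_inj->].
- by rewrite mul1r addrN -val_eqE ltn_eqF.
- by rewrite mul0r addr0 u0 // -val_eqE gtn_eqF.
- by rewrite mul0r addr0 u1 eqxx.
Qed.

Lemma Uge_conj (k : nat) u g : u \in Uge k -> g \in U -> (u ^ g)%g \in Uge k.
Proof.
move=> /UgeP[uU uk] gU; apply/UgeP; split=> [|i j jk].
  by rewrite groupJ.
have [g0 g1] := unitriP _ gU.
have e b : GLval (u * g)%g b j = GLval g b j.
  rewrite GLmE; transitivity (\sum_a (b == a)%:R * GLval g a j).
    apply: eq_bigr => a _; case: (leqP a j) => aj; last by rewrite g0 // !mulr0.
    by rewrite uk // (leq_ltn_trans aj).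
  rewrite (bigD1 b) //= eqxx mul1r big1 ?addr0 // => a /negPf ab.
  by rewrite eq_sym ab mul0r.
rewrite conjgE GLmE; under eq_bigr => a _ do rewrite e.
by rewrite -GLmE mulVg GL1E.
Qed.

Section Move.
Variables (k : idx) (h : GL) (f : idx -> F) (t : F).
Hypothesis hk : forall i j, (k <= i)%N || (k <= j)%N -> GLval h i j = (i == j)%:R.

Let hmulE g i j : (k <= i)%N -> GLval (h * g)%g i j = GLval g i j.
Proof.
move=> ki; rewrite GLmE (bigD1 i) //= hk ?ki // eqxx mul1r big1 ?addr0 // => a /negPf ai.
by rewrite hk ?ki // eq_sym ai mul0r.
Qed.

Let mulhE g i j : (k <= j)%N -> GLval (g * h)%g i j = GLval g i j.
Proof.
move=> kj; rewrite GLmE (bigD1 j) //= hk ?kj ?orbT // eqxx mulr1 big1 ?addr0 // => a /negPf aj.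
by rewrite hk ?kj ?orbT // aj mulr0.
Qed.

Let conj_ge u i j : (k <= i)%N -> (k <= j)%N -> GLval (u ^ h)%g i j = GLval u i j.
Proof. by move=> ki kj; rewrite -hmulE // -conjgC mulhE. Qed.

Lemma Uge_conj_block u : u \in Uge k -> (u ^ h)%g \in Uge k.
Proof.
move=> /UgeP[uU uk]; have [u0 u1] := unitriP _ uU.
have fixc i j : (j < k)%N -> GLval (u ^ h)%g i j = (i == j)%:R.
  move=> jk; have e b : GLval (u * h)%g b j = GLval h b j.
    rewrite GLmE; transitivity (\sum_a (b == a)%:R * GLval h a j).
      apply: eq_bigr => a _; case: (leqP k a) => ka; last by rewrite uk.
      rewrite hk ?ka // -[a == j]val_eqE gtn_eqF ?mulr0 //.
      exact: leq_trans ka.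
    rewrite (bigD1 b) //= eqxx mul1r big1 ?addr0 // => a /negPf ab.
    by rewrite eq_sym ab mul0r.
  rewrite conjgE GLmE; under eq_bigr => a _ do rewrite e.
  by rewrite -GLmE mulVg GL1E.
apply/UgeP; split=> //; apply/unitriP; split=> [i j ji|i].
  case: (ltnP j k) => jk; first by rewrite fixc // -val_eqE gtn_eqF.
  by rewrite conj_ge ?u0 // (leq_trans jk) // ltnW.
case: (ltnP i k) => ik; first by rewrite fixc // eqxx.
by rewrite conj_ge // u1.
Qed.

Lemma superdiag_conj_block u (l : nat) : (k <= l)%N -> (l < m)%N ->
  superdiag (u ^ h)%g l = superdiag u l.
Proof.
by move=> kl lm; rewrite /superdiag conj_ge // inordK //; nlia.
Qed.

Lemma col_conj_block u : (0 < k)%N ->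
  (forall i : idx, (i < k)%N -> f i = t * GLval h (inord k.-1) i) ->
  \sum_(i : idx | (i < k)%N) f i * GLval (u ^ h)%g i k = t * GLval u (inord k.-1) k.
Proof.
move=> k0 fE.
have e : GLval (h * u ^ h)%g (inord k.-1) k = GLval u (inord k.-1) k.
  by rewrite -conjgC mulhE.
rewrite -e [in RHS]GLmE mulr_sumr [LHS]big_mkcond.
apply: eq_bigr => i _; case: (ltnP i k) => ik; first by rewrite fE // mulrA.
have hkk : (inord k.-1 : idx) = k.-1 :> nat by rewrite inordK //; have := ltn_ord k; nlia.
rewrite [GLval h _ i]hk ?ik ?orbT // -val_eqE /= hkk ltn_eqF ?mul0r ?mulr0 //.
by move: k0 ik; set a := nat_of_ord k; set b := nat_of_ord i; nlia.
Qed.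
End Move.

(** Any row vector on the first k coordinates is a multiple of the last row of
    an invertible matrix acting on these coordinates only. *)
Lemma exists_block_row (k : idx) f : (0 < k)%N -> exists h t,
  (forall i j : idx, (k <= i)%N || (k <= j)%N -> GLval h i j = (i == j)%:R) /\
  (forall i : idx, (i < k)%N -> f i = t * GLval h (inord k.-1) i).
Proof.
move=> k0; case: (pickP (fun i : idx => (i < k)%N && (f i != 0))) => [i0|f0]; last first.
  exists 1%g, 0; split=> [i j _|i ik]; first by rewrite GL1E.
  by have := f0 i; rewrite ik mul0r /= => /negbFE/eqP.
move=> /andP[i0k fi0]; pose l : idx := inord k.-1; pose s := tperm i0 l.
have lk : l = k.-1 :> nat by rewrite inordK //; have := ltn_ord k; nlia.
have l_lt : (l < k)%N by rewrite lk; nlia.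
have sk i : (k <= i)%N -> s i = i.
  move=> ki; rewrite tpermD //; apply: contraTneq ki => <-; by rewrite -ltnNge.
have slt i : (i < k)%N -> (s i < k)%N by rewrite /s; case: tpermP.
pose L : 'M[F]_m.+1 := \matrix_(a, b)
  if a == l then (if (b < k)%N then f (s b) else 0) else (a == b)%:R.
have LE a b : L a b = if a == l then (if (b < k)%N then f (s b) else 0) else (a == b)%:R.
  by rewrite mxE.
have Lu : L \in unitmx.
  rewrite -unitmx_tr; apply: upper_unit => [a b ba|a]; rewrite mxE LE.
    case: (b =P l) => [e|_]; last by rewrite -val_eqE ltn_eqF.
    by rewrite ifF //; apply/negbTE; rewrite -leqNgt; move: ba; rewrite e lk; nlia.
  case: (a =P l) => [->|_]; last by rewrite eqxx oner_neq0.
  by rewrite l_lt /s tpermR.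
exists (to_GL L * pm F s)%g, 1.
have hE a b : GLval (to_GL L * pm F s)%g a b = L a (s b).
  by rewrite mul_pmE to_GLE // tpermV.
split=> [a b|i ik]; rewrite hE LE.
  case: (leqP k b) => [kb _|bk]; last first.
    rewrite orbF => ka; have -> : (a == l) = false.
      by apply/eqP => e; rewrite e leqNgt l_lt in ka.
    by rewrite -{1}(sk a ka) (inj_eq perm_inj).
  rewrite sk // ltnNge kb /=; case: (a =P l) => // ->.
  by rewrite -val_eqE /= ltn_eqF // (leq_trans l_lt).
by rewrite eqxx slt // mul1r /s tpermK.
Qed.

Lemma acol_comm (i j k : idx) t : j = i.+1 :> nat -> (j < k)%N ->
  (xroot i j t * acol k (fun a => (a == j)%:R) =
   acol k (fun a => (a == j)%:R + t * (a == i)%:R)%R * xroot i j t)%g.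
Proof.
move=> ji jk; have ij : (i < j)%N by rewrite ji.
apply: GLP => a b; rewrite xroot_mulE // mul_xrootE // !acolE.
have ik : (i == k) = false by rewrite -val_eqE ltn_eqF // (ltn_trans ij).
rewrite ik jk eqxx andbT mulr1 mul0r addr0 [j == b]eq_sym.
case: (a =P i) => [->|_]; last by rewrite !(mulr0, mul0r, addr0).
rewrite (ltn_trans ij jk) andbT !mulr1 -!addrA; congr (_ + _).
by rewrite [in RHS]mulrDr -addrA; congr (_ + _); rewrite mulrDr addrC [t * (b == k)%:R]mulrC.
Qed.

Lemma acol_xroot (i k : idx) c : k = i.+1 :> nat -> 
  (forall a, (a < i)%N -> c a = 0) -> acol k c = xroot i k (c i).
Proof.
move=> ki c0; apply: GLP => a b; rewrite acolE xrootE ?ki //; congr (_ + _).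
case: (b =P k) => _ /=; last by rewrite andbF mul0r mulr0.
rewrite andbT ltnS; case: (ltngtP a i) => [ai|ai|/val_inj->].
- by rewrite c0 // -val_eqE ltn_eqF // mulr0 mulr0.
- by rewrite mul0r -val_eqE gtn_eqF // mulr0.
- by rewrite eqxx mulrC.
Qed.
End Columns.

Section PairingMore.
Variables (F : finFieldType) (m : nat).
Local Notation GL := (GLn F m).
Local Notation idx := 'I_m.+1.
Local Notation U := (Un F m).
Implicit Types (u v w h : GL) (k : idx) (y : nat -> F).

Lemma pairingJ y u v : u \in U -> v \in U -> pairing y (u ^ v)%g = pairing y u.
Proof.
move=> uU vU; rewrite conjgE !pairingM ?groupM ?groupV // pairingV //.
by rewrite addrC addrK.
Qed.

Lemma pairing_block y k h (t : F) (f : idx -> F) u : (0 < k)%N ->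
  (forall i j : idx, (k <= i)%N || (k <= j)%N -> GLval h i j = (i == j)%:R) ->
  (forall i : idx, (i < k)%N -> f i = t * GLval h (inord k.-1) i) ->
  u \in Uge F m k -> exists (c : idx -> F) w,
  [/\ w \in Uge F m k.+1, (u ^ h = acol k c * w)%g &
  \sum_i f i * c i + pairing y w =
    pairing (fun l => if l.+1 == k then t else y l) u].
Proof.
move=> k0 hk fE uk; have uhk := Uge_conj_block hk uk.
have [w wk e] := Uge_split uhk.
exists (fun a : idx => if (a < k)%N then GLval (u ^ h)%g a k else 0), w; split=> //.
  by rewrite {1}e; congr (_ * _)%g; apply: eq_acol => a ->.
have -> : \sum_(i < m.+1) f i * (if (i < k)%N then GLval (u ^ h)%g i k else 0) =
          t * GLval u (inord k.-1) k.
  rewrite -(col_conj_block hk u k0 fE) [RHS]big_mkcond; apply: eq_bigr => i _.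
  by case: ifP => //; rewrite mulr0.
have km : (k.-1 < m)%N by have := ltn_ord k; nlia.
have [wU wc] := UgeP _ _ wk; have [uU uc] := UgeP _ _ uk.
rewrite /pairing (bigD1 (Ordinal km)) //= [in RHS](bigD1 (Ordinal km)) //=.
have sd0 v l : (l < m)%N -> v \in Uge F m l.+2 -> superdiag v l = 0.
  move=> lm /UgeP[_ vc]; rewrite /superdiag vc ?inordK //.
  by rewrite -val_eqE ltn_eqF // rank1_lt.
have Ule (a b : nat) v : (a <= b)%N -> v \in Uge F m b -> v \in Uge F m a.
  move=> ab /UgeP[vU vc]; apply/UgeP; split=> // i j ja.
  by rewrite vc // (leq_trans ja).
have sw : superdiag w k.-1 = 0 by apply: sd0 => //; rewrite (prednK k0).
have su : superdiag u k.-1 = GLval u (inord k.-1) k.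
  by rewrite /superdiag (prednK k0) inord_val.
rewrite sw mulr0 add0r (prednK k0) eqxx su; congr (_ + _).
apply: eq_bigr => l; rewrite -val_eqE /= => lk.
have -> : (l.+1 == k) = false by apply/eqP; nlia.
congr (_ * _); case: (ltnP l k) => lk'.
  have l2k : (l.+2 <= k)%N by nlia.
  by rewrite (sd0 w) ?(sd0 u) //; [apply: Ule uk|apply: Ule wk; rewrite leqW].
have uhU : (u ^ h)%g \in U by have [] := UgeP _ _ uhk.
rewrite -(superdiag_conj_block hk u lk') // e superdiagM ?acol_U //.
rewrite superdiag_acol // (_ : (_ == _) = false) ?mul0r ?add0r //.
by apply/eqP; nlia.
Qed.
End PairingMore.

(** The scalars S and the group G act on V through a ring A, such as the group
    algebra, in which S is central. *)
Section Mirabolic.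
Variables (F : finFieldType) (m : nat) (S : comPzRingType) (A : pzRingType).
Local Notation GL := (GLn F m).
Local Notation idx := 'I_m.+1.
Local Notation U := (Un F m).
Variables (gA : GL -> A) (sA : {rmorphism S -> A}).
Hypotheses (gA1 : gA 1%g = 1) (gAM : forall g h, gA (g * h)%g = gA g * gA h).
Hypothesis sAC : forall s a, a * sA s = sA s * a.
Variable V : lmodType A.
Implicit Types (u v w h : GL) (k : idx) (y : nat -> F) (x : V).

Variable psi : F -> S.
Hypotheses (psi0 : psi 0 = 1) (psiD : forall a a', psi (a + a') = psi a * psi a').
Hypothesis sum_psi : \sum_a psi a = 0.
Variable q' : S.
Hypothesis qK : #|F|%:R * q' = 1.

Definition hatA y : A := \sum_(u in U) sA (psi (pairing y u)) * gA u.

Lemma sum_psi_mul (c : F) : \sum_t psi (t * c) = if c == 0 then #|F|%:R else 0.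
Proof.
case: eqP => [->|/eqP c0].
  under eq_bigr => t _ do rewrite mulr0 psi0.
  by rewrite sumr_const.
transitivity (\sum_t psi t); last exact: sum_psi.
by rewrite [RHS](reindex_inj (mulIf c0)).
Qed.

Lemma sum_psi_dual (c : idx -> F) :
  \sum_(f : {ffun idx -> F}) psi (\sum_i f i * c i) =
  if [forall i, c i == 0] then #|F|%:R ^+ m.+1 else 0.
Proof.
under eq_bigr => f _ do rewrite (big_morph psi psiD psi0).
rewrite -(bigA_distr_bigA (fun i t => psi (t * c i))).
under eq_bigr => i _ do rewrite sum_psi_mul.
case: (boolP [forall i, c i == 0]) => [/forallP c0|].
  under eq_bigr => i _ do rewrite c0.
  by rewrite prodr_const card_ord.
rewrite negb_forall => /existsP[i /negPf ci].
by rewrite (bigD1 i) //= ci mul0r.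
Qed.

Definition colsum k (f : {ffun idx -> F}) : A :=
  \sum_(c : {ffun idx -> F}) sA (psi (\sum_i f i * c i)) * gA (acol k c).

Lemma sum_colsum k : \sum_f colsum k f = sA (#|F|%:R ^+ m.+1).
Proof.
rewrite exchange_big /=.
under eq_bigr => c _ do rewrite -mulr_suml -rmorph_sum sum_psi_dual.
rewrite (bigD1 [ffun=> 0]) //= big1 ?addr0 => [|c c0]; last first.
  rewrite ifF ?rmorph0 ?mul0r //; apply: contraNF c0 => /forallP c0.
  by apply/eqP/ffunP => i; rewrite ffunE; apply/eqP.
rewrite ifT; last by apply/forallP => i; rewrite ffunE.
by rewrite acol0 ?gA1 ?mulr1 // => a _; rewrite ffunE.
Qed.

Lemma gA_colsum k f (c : idx -> F) :
  gA (acol k c) * colsum k f = sA (psi (- \sum_i f i * c i)) * colsum k f.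
Proof.
rewrite /colsum !mulr_sumr.
rewrite (reindex_inj (addIr (- finfun c))) /=; apply: eq_bigr => d _.
rewrite !mulrA sAC -mulrA -gAM acolD -rmorphM -psiD -sumrN -big_split.
congr (sA (psi _) * gA _) => /=.
  by apply: eq_bigr => i _; rewrite !ffunE mulrDr mulrN addrC.
by apply: eq_acol => a _; rewrite !ffunE addrC subrK.
Qed.

Definition eigen (k : nat) y x := forall u, u \in Uge F m k ->
  gA u *: x = sA (psi (pairing y u)) *: x.

Lemma eigen_colsum (k : idx) f y x u : eigen k.+1 y x -> u \in Uge F m k.+1 ->
  gA u *: (colsum k f *: x) = sA (psi (pairing y u)) *: (colsum k f *: x).
Proof.
move=> ex uk; rewrite /colsum !scaler_suml !scaler_sumr; apply: eq_bigr => c _.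
have [uU _] := UgeP _ _ uk; have aU := acol_U k c.
rewrite scalerA mulrA sAC -mulrA -gAM conjgC gAM mulrA -scalerA.
by rewrite (ex _ (Uge_conj uk aU)) (pairingJ y uU aU) scalerA [RHS]scalerA sAC.
Qed.

(** One step of the reduction: Fourier analysis along column k, followed by a
    base change in the first k coordinates which normalises the character. *)
Lemma eigen_step k y x : (0 < k)%N -> x != 0 -> eigen k.+1 y x ->
  exists a y', a *: x != 0 /\ eigen k y' (a *: x).
Proof.
move=> k0 x0 ex.
have [f fx] : exists f, colsum k f *: x != 0.
  apply/not_existsP => H; move/negP: x0; apply; apply/eqP.
  have : (\sum_f colsum k f) *: x = 0.
    by rewrite scaler_suml big1 // => f _; apply/eqP/negbNE/negP/H.
  move/(congr1 (fun z => sA (q' ^+ m.+1) *: z)).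
  rewrite sum_colsum scaler0 scalerA -rmorphM -exprMn mulrC qK expr1n.
  by rewrite rmorph1 scale1r.
have [h [t [hk fE]]] := exists_block_row (fun i => - f i) k0.
exists (gA h * colsum k f), (fun l => if l.+1 == k then t else y l); split.
  apply: contraNneq fx => /(congr1 (fun z => gA h^-1%g *: z)).
  by rewrite scaler0 scalerA mulrA -gAM mulVg gA1 mul1r => ->.
move=> u uk; have [c [w [wk e p]]] := pairing_block y k0 hk fE uk.
rewrite -p psiD -[(gA h * _) *: x]scalerA.
rewrite scalerA -gAM conjgC gAM e gAM -!scalerA.
rewrite (eigen_colsum f ex wk) !scalerA; congr (_ *: x).
have e2 : gA (acol k c) * (sA (psi (pairing y w)) * colsum k f) =
    sA (psi (\sum_i - f i * c i) * psi (pairing y w)) * colsum k f.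
  rewrite mulrA sAC -mulrA gA_colsum mulrA -rmorphM mulrC -sumrN mulrC.
  by rewrite [in RHS]mulrC; under eq_bigr => i _ do rewrite -mulNr.
by rewrite -!mulrA e2 mulrA sAC -mulrA.
Qed.

(** Every nonzero module contains an eigenvector of U: a special feature of the
    general linear group. *)
Lemma eigen_exists x : x != 0 -> exists a y, a *: x != 0 /\
  forall u, u \in U -> gA u *: (a *: x) = sA (psi (pairing y u)) *: (a *: x).
Proof.
move=> x0.
suff [a [y [ax0 ax]]] : exists a y, a *: x != 0 /\ eigen 1 y (a *: x).
  by exists a, y; split=> // u /UgeT; exact: ax.
have H d : (d <= m)%N -> exists a y, a *: x != 0 /\ eigen (m.+1 - d) y (a *: x).
  elim: d => [_|d IH dm].
    exists 1, (fun=> 0); rewrite scale1r; split=> // u; rewrite subn0 => /Uge1 ->.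
    by rewrite pairing1 psi0 gA1 rmorph1.
  have [a [y [ax0 ax]]] := IH (ltnW dm).
  have lt : (m.+1 - d.+1 < m.+1)%N by nlia.
  have k0 : (0 < Ordinal lt)%N by rewrite /=; nlia.
  have [|b [y' [bx0 bx]]] := @eigen_step (Ordinal lt) y _ k0 ax0.
    by rewrite /= (_ : (m.+1 - d.+1).+1 = (m.+1 - d)%N) //; nlia.
  by exists (b * a), y'; rewrite -scalerA.
by have := H m (leqnn m); rewrite subSnn.
Qed.

(** Some character projection of some multiple of x is nonzero. *)
Lemma hatA_neq0 x : x != 0 -> exists a y, hatA y *: (a *: x) != 0.
Proof.
move=> x0; have [a [y [ax0 ax]]] := eigen_exists x0.
exists a, (fun k : nat => - y k); apply: contraNneq ax0 => e.
have : hatA (fun k : nat => - y k) *: (a *: x) = sA #|U|%:R *: (a *: x).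
  rewrite /hatA scaler_suml -sum1_card natr_sum rmorph_sum scaler_suml.
  apply: eq_bigr => u uU; rewrite -scalerA (ax _ uU) scalerA -rmorphM.
  by rewrite pairingN -psiD addrC subrr psi0.
rewrite e -Upat1 card_Upat natrX; set N := #|_|.
move/(congr1 (fun z => sA (q' ^+ N) *: z)).
rewrite scaler0 scalerA -rmorphM -exprMn [q' * _]mulrC qK expr1n rmorph1 scale1r.
by move=> <-.
Qed.

End Mirabolic.

Section CharClass.
Variables (F : finFieldType) (m : nat) (R : idomainType).
Local Notation GL := (GLn F m).
Local Notation idx := 'I_m.+1.
Local Notation U := (Un F m).
Implicit Types (u v : GL) (k i j : idx) (y : nat -> F).

Variable psi : F -> R.
Hypotheses (psi0 : psi 0 = 1) (psiD : forall a a', psi (a + a') = psi a * psi a').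
Hypothesis psi_nontriv : exists a, psi a != 1.
Hypothesis natR : forall n, (0 < n)%N -> n%:R != 0 :> R.

Lemma sum_hom_eq0 (mu : F -> R) : (forall a a', mu (a + a') = mu a * mu a') ->
  (exists a, mu a != 1) -> \sum_a mu a = 0.
Proof.
move=> muD [a mua]; have e : \sum_t mu t = mu a * \sum_t mu t.
  by rewrite {1}(reindex_inj (addrI a)) mulr_sumr; apply: eq_bigr => t _; rewrite muD.
move/eqP: e; rewrite -subr_eq0 -{1}[X in X - _]mul1r -mulrBl mulf_eq0 subr_eq0.
by rewrite eq_sym (negPf mua) => /eqP.
Qed.

(** The characters t |-> psi (y t) are all the characters of the additive group:
    another one would be orthogonal to each of them, hence to their sum. *)
Lemma hom_psi (mu : F -> R) : (forall a a', mu (a + a') = mu a * mu a') ->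
  mu 0 = 1 -> exists z : F, forall t, mu t = psi (z * t).
Proof.
move=> muD mu0; apply/not_existsP => H.
have : \sum_(z : F) \sum_t mu t * psi (- (z * t)) = 0.
  rewrite big1 // => z _; apply: sum_hom_eq0 => [a a'|].
    by rewrite mulrDr opprD muD psiD mulrACA.
  apply/not_existsP => H'; apply: (H z) => t; move: (H' t) => /negP/negbNE/eqP e.
  by rewrite -[RHS]mul1r -e -mulrA -psiD addNr psi0 mulr1.
rewrite exchange_big /= (bigD1 0) //= [X in _ + X]big1 => [|t t0].
  rewrite addr0; under eq_bigr => z _ do rewrite mulr0 oppr0 psi0 mu0 mulr1.
  rewrite sumr_const => /eqP; apply/negP/natR.
  by apply: (leq_trans _ (max_card (pred1 (0 : F)))); rewrite card1.
rewrite -mulr_sumr; under eq_bigr => z _ do rewrite -mulrN.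
rewrite (sum_psi_mul psi0) ?oppr_eq0 ?(negPf t0) ?mulr0 //.
exact: sum_hom_eq0.
Qed.

Variable lam : GL -> R.
Hypotheses (lam0 : forall u, u \in U -> lam u != 0)
  (lamM : forall u v, u \in U -> v \in U -> lam (u * v)%g = lam u * lam v).

Let lam1 : lam 1%g = 1.
Proof.
apply: (mulfI (lam0 (group1 (unitri_group F m)))).
by rewrite -lamM ?mulg1 ?mulr1 ?group1.
Qed.

Lemma lam_acol (y : nat -> F) k c :
  (forall l t, (l < m)%N -> lam (xroot (inord l) (inord l.+1) t) = psi (y l * t)) ->
  lam (acol k c) = psi (pairing y (acol k c)).
Proof.
move=> hy.
have one i t : lam (acol k (fun a => t * (a == i)%:R)) =
               psi (pairing y (acol k (fun a => t * (a == i)%:R))).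
  case: (ltnP i k) => ik; last first.
    rewrite acol0 ?pairing1 ?psi0 // => a ak.
    by rewrite -val_eqE ltn_eqF ?mulr0 // (leq_trans ak).
  rewrite pairing_acol (leq_ltn_trans _ ik) //.
  have im : (i < m)%N by have := ltn_ord k; nlia.
  have [e|ne] := eqVneq (k : nat) i.+1.
    rewrite (acol_xroot e) => [|a ai]; last by rewrite -val_eqE ltn_eqF ?mulr0.
    have -> : xroot i k (t * (i == i)%:R) = xroot (inord i) (inord i.+1) t.
      by rewrite -e !inord_val eqxx mulr1.
    by rewrite hy // e /= inord_val eqxx mulr1.
  pose j : idx := inord i.+1.
  have jE : j = i.+1 :> nat by rewrite inordK.
  have jk : (j < k)%N by rewrite jE; nlia.
  have ij : (i < j)%N by rewrite jE.
  have -> : (inord k.-1 == i) = false.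
    by rewrite -val_eqE /= inordK; [apply/eqP|have := ltn_ord k]; nlia.
  rewrite !mulr0 psi0.
  have := congr1 lam (acol_comm t jE jk).
  rewrite -acolD !lamM ?groupM ?acol_U ?xroot_U //.
  rewrite mulrC -mulrA => /(mulfI (lam0 (acol_U _ _))).
  rewrite -[LHS]mul1r => /(mulIf (lam0 (xroot_U _ ij))) <- //.
have H (n : nat) d : (forall a : idx, (n <= a)%N -> d a = 0) ->
    lam (acol k d) = psi (pairing y (acol k d)).
  elim: n d => [|n IH] d d0.
    by rewrite acol0 ?pairing1 ?psi0 // => a _; exact: d0.
  case: (ltnP n m.+1) => nm; last first.
    by apply: IH => a na; have := leq_trans nm na; rewrite leqNgt ltn_ord.
  pose i : idx := Ordinal nm; pose d' a := if a == i then 0 else d a.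
  have -> : acol k d = (acol k d' * acol k (fun a => d i * (a == i)%:R)%R)%g.
    rewrite acolD; apply: eq_acol => a _; rewrite /d'.
    by case: (a =P i) => [->|]; rewrite ?mulr1 ?add0r ?mulr0 ?addr0.
  rewrite lamM ?acol_U // pairingM ?acol_U // psiD one IH // => a na.
  rewrite /d'; case: (a =P i) => // /eqP ai; apply: d0.
  by rewrite ltn_neqAle na andbT; apply: contra ai => /eqP e; apply/eqP/val_inj.
by apply: (H m.+1) => a; rewrite leqNgt ltn_ord.
Qed.

(** A linear character of U is determined by its values on the simple root
    subgroups, the other ones being made of commutators. *)
Lemma char_class : exists y : nat -> F, forall u, u \in U -> lam u = psi (pairing y u).
Proof.
have /choice[y hy] l : exists yl, (l < m)%N ->
    forall t, lam (xroot (inord l) (inord l.+1) t) = psi (yl * t).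
  case: (ltnP l m) => [lm|]; last by exists 0.
  have [||yl h] := @hom_psi (fun t => lam (xroot (inord l) (inord l.+1) t)).
  - by move=> a a'; rewrite -lamM ?xroot_U ?rank1_lt // xrootD ?rank1_lt.
  - by rewrite xroot0.
  by exists yl.
exists y => u uU.
have H d : (d <= m.+1)%N -> forall v, v \in Uge F m (m.+1 - d) -> lam v = psi (pairing y v).
  elim: d => [_ v|d IH dm v vk]; first by rewrite subn0 => /Uge1->; rewrite pairing1 psi0.
  have lt : (m.+1 - d.+1 < m.+1)%N by nlia.
  have [w wk ->] := @Uge_split _ _ (Ordinal lt) v vk.
  have [wU _] := UgeP _ _ wk.
  rewrite lamM ?acol_U // pairingM ?acol_U // psiD (@lam_acol y) => [|l t lm]; last exact: hy.
  rewrite IH //; first exact: ltnW.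
  by rewrite (_ : (m.+1 - d)%N = (m.+1 - d.+1).+1) //; nlia.
apply: (H m.+1 (leqnn _)); rewrite subnn; apply/UgeP; split=> //.
Qed.
End CharClass.

Section Torus.
Variables (F : finFieldType) (m : nat).
Local Notation GL := (GLn F m).
Local Notation idx := 'I_m.+1.
Local Notation U := (Un F m).
Implicit Types (u v : GL) (k i j : idx) (y : nat -> F).

Lemma conj_dgmE d u i j : (forall i : idx, d i != 0) ->
  GLval (u ^ dgm d)%g i j = (d i)^-1 * GLval u i j * d j.
Proof.
move=> d0; apply: (mulfI (d0 i)); rewrite -dgm_mulE // -conjgC mul_dgmE //.
by rewrite -mulrA mulVKf.
Qed.

Lemma dgm_conj_U d u : (forall i : idx, d i != 0) -> u \in U -> (u ^ dgm d)%g \in U.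
Proof.
move=> d0 /unitriP[u0 u1]; apply/unitriP; split=> [i j ji|i]; rewrite conj_dgmE //.
  by rewrite u0 // mulr0 mul0r.
by rewrite u1 mulr1 mulVf.
Qed.

(** The torus permutes transitively the characters with given support. *)
Lemma torus_char y y' : (forall k : nat, (k < m)%N -> (y k == 0) = (y' k == 0)) ->
  exists2 d : idx -> F, forall i, d i != 0 &
  forall u, pairing y (u ^ dgm d)%g = pairing y' u.
Proof.
move=> yy'; pose r (l : nat) := if y l == 0 then 1 else y' l / y l.
pose d (i : idx) := \prod_(l < i) r l.
have r0 (l : nat) : (l < m)%N -> r l != 0.
  rewrite /r => lm; case: (y l =P 0) => [_|/eqP yl]; first exact: oner_neq0.
  by apply: mulf_neq0; rewrite ?invr_eq0 -?yy'.
have d0 i : d i != 0.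
  by apply/prodf_neq0 => l _; apply: r0; have := ltn_ord l; have := ltn_ord i; nlia.
exists d => // u; apply: eq_bigr => k _; rewrite /superdiag conj_dgmE //.
have -> : d (inord k.+1) = d (inord k) * r k.
  rewrite /d (inordK (_ : k < m.+1)%N); last exact: leqW.
  rewrite (inordK (_ : k.+1 < m.+1)%N) ?ltnS //.
  by rewrite big_ord_recr.
rewrite /r; have [yk|yk] := eqVneq (y k) 0.
  have /eqP-> : y' k == 0 by rewrite -yy' // yk.
  by rewrite yk !mul0r.
rewrite mulrACA mulVf // mul1r mulrCA [y k * _]mulrC divfK //.
by rewrite mulrC.
Qed.
End Torus.

Section Semisimple.
Variables (A : pzRingType) (V : lmodType A) (Y : Type).
Variables (D : Y -> Prop) (v : Y -> V) (e : Y -> A).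
Implicit Types (x z : V) (y : Y) (N W : submod V) (u : submod V -> V).

Hypothesis projE : forall y x, e y *: x != 0 ->
  [/\ D y, exists a, v y = a *: x & exists b, e y *: x = b *: v y].
Hypothesis proj_v : forall y, D y -> e y *: v y != 0.
Hypothesis proj_out : forall W x, x \notin W -> exists a y, e y *: (a *: x) \notin W.
Hypothesis v_sym : forall y y', D y -> D y' ->
  (exists a, v y' = a *: v y) -> exists a, v y = a *: v y'.
Variable S : set (submod V).
Hypothesis S_cyclic : forall N, S N <-> exists2 y, D y & N = cyclic (v y).

Lemma cyclicP x z : reflect (exists a, z = a *: x) (z \in cyclic x).
Proof. by apply: (iffP idP) => [/asboolP|H]; [|apply/asboolP]. Qed.

Lemma cyclic_self x : x \in cyclic x.
Proof. by apply/cyclicP; exists 1; rewrite scale1r. Qed.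

Let zero_submod_closed : submod_closed (fun x : V => x == 0).
Proof.
by split=> [|a x z /eqP-> /eqP->]; rewrite unfold_in ?eqxx // scaler0 addr0.
Qed.

Lemma v_generated y z : D y -> z \in cyclic (v y) -> z != 0 -> exists a, v y = a *: z.
Proof.
move=> Dy /cyclicP[b zE] z0.
have [a [y']] := @proj_out (Submod zero_submod_closed) z z0.
rewrite -[_ \notin _]/(e y' *: (a *: z) != 0) => /projE[Dy' [a' vE] _].
have [|c vE'] := v_sym Dy Dy'.
  by exists (a' * (a * b)); rewrite vE zE !scalerA mulrA.
by exists (c * (a' * a)); rewrite vE' vE !scalerA mulrA.
Qed.

Lemma cyclic_v_eq y y' x : D y -> D y' -> x \in cyclic (v y') -> e y *: x != 0 ->
  cyclic (v y) = cyclic (v y').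
Proof.
move=> Dy Dy' /cyclicP[b xE] /projE[_ [a vE] _].
have vE' : v y = (a * b) *: v y' by rewrite vE xE scalerA.
have [|c vE''] := v_sym Dy' Dy; first by exists (a * b).
apply: submodP => z; apply/cyclicP/cyclicP => -[d ->].
  by exists (d * (a * b)); rewrite vE' scalerA.
by exists (d * c); rewrite vE'' scalerA.
Qed.

Lemma S_irreducible N : S N -> irreducible_lmod (submod_of N).
Proof.
move=> /S_cyclic[y Dy ->]; pose vN := SubmodOf (cyclic_self (v y)).
have v0 : v y != 0 by apply: contraNneq (proj_v Dy) => ->; rewrite scaler0.
split; first by exists vN; apply: contraNneq v0 => /(congr1 val) /= ->.
move=> W; case: (pselect (exists2 x, x \in W & x != 0)) => [[x xW x0]|H]; last first.
  left=> x xW; apply/eqP; apply: contrapT => /negP x0; apply: H; by exists x.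
right; have [|a vE] := v_generated Dy (submod_valP x).
  by apply: contraNneq x0 => e0; apply/eqP/val_inj.
move=> z; have /cyclicP[b zE] := submod_valP z.
have -> : z = (b * a) *: x.
  by apply: val_inj; rewrite /= zE -scalerA; congr (b *: _).
exact: rpredZ.
Qed.

Lemma S_non_isomorphic N N' : S N -> S N' -> N <> N' ->
  ~ isomorphic_lmod (submod_of N) (submod_of N').
Proof.
move=> /S_cyclic[y Dy ->] /S_cyclic[y' Dy' ->] ne [f [g fK gK]]; apply: ne.
pose vN := SubmodOf (cyclic_self (v y)).
apply: (@cyclic_v_eq _ _ (val (f vN))) => //; first exact: submod_valP.
apply: contraNneq (proj_v Dy) => e0.
have : f (e y *: vN) = 0 by apply: val_inj; rewrite linearZ.
by move/(congr1 g); rewrite fK -(linear0 f) fK => /(congr1 val) /= ->.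
Qed.

Lemma fsum_seq u (r : seq (submod V)) : (forall N, ~ S N -> u N = 0) -> uniq r ->
  (forall N, N \notin r -> u N = 0) -> \sum_(N \in S) u N = \sum_(N <- r) u N.
Proof.
move=> uS r_uniq ur; rewrite [RHS]fsbig_seq //.
have DS (D' : set (submod V)) : (forall N, ~ D' N -> u N = 0) ->
    \sum_(N \in D') u N = \sum_(N \in [set: submod V]) u N.
  by move=> uD; apply: fsbig_widen => [//|N [_ /uD]].
by rewrite (DS S uS); apply/esym/DS => N /= /negP; exact: ur.
Qed.

Definition decomposes x u := [/\ forall N, S N -> u N \in N,
  forall N, ~ S N -> u N = 0, finite_set [set N | u N <> 0] & x = \sum_(N \in S) u N].

Lemma support_seq u : finite_set [set N | u N <> 0] ->
  exists2 r : seq (submod V), uniq r & forall N, N \notin r -> u N = 0.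
Proof.
move=> /finite_seqP[r rE]; exists (undup r); first exact: undup_uniq.
move=> N; rewrite mem_undup => /negP Nr; apply: contrapT => uN; apply: Nr.
by have : [set N | u N <> 0]%classic N by []; rewrite rE.
Qed.

Lemma seq_support u (r : seq (submod V)) : (forall N, N \notin r -> u N = 0) ->
  finite_set [set N | u N <> 0].
Proof.
move=> ur; apply: sub_finite_set (finite_seq r) => N /= uN.
by apply: contrapT => /negP /ur.
Qed.

Lemma decomposes_lin a x z u w : decomposes x u -> decomposes z w ->
  decomposes (a *: x + z) (fun N => a *: u N + w N).
Proof.
move=> [uN uS ufin xE] [wN wS wfin zE].
have [r r_uniq ur] := support_seq ufin; have [s s_uniq sw] := support_seq wfin.
have ur' N : N \notin undup (r ++ s) -> u N = 0.
  by rewrite mem_undup mem_cat negb_or => /andP[/ur].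
have sw' N : N \notin undup (r ++ s) -> w N = 0.
  by rewrite mem_undup mem_cat negb_or => /andP[_ /sw].
have uw0 N : N \notin undup (r ++ s) -> a *: u N + w N = 0.
  by move=> Nr; rewrite ur' // sw' // scaler0 addr0.
have uw0' N : ~ S N -> a *: u N + w N = 0.
  by move=> NS; rewrite uS // wS // scaler0 addr0.
split=> // [N SN||]; first by rewrite rpredD ?rpredZ ?uN ?wN.
  exact: (seq_support uw0).
rewrite (fsum_seq uw0' (undup_uniq _) uw0) big_split /= -scaler_sumr.
by rewrite xE zE (fsum_seq uS (undup_uniq (r ++ s)) ur') (fsum_seq wS (undup_uniq (r ++ s)) sw').
Qed.

Lemma decomposes0 : decomposes 0 (fun=> 0).
Proof.
split=> // [N _||]; first exact: rpred0.
  by apply: (@seq_support _ [::]) => N.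
by rewrite fsbig1.
Qed.

Lemma decomposes1 N x : S N -> x \in N -> decomposes x (fun M => if M == N then x else 0).
Proof.
move=> SN xN; have h M : M \notin [:: N] -> (if M == N then x else 0) = 0.
  by rewrite inE => /negPf ->.
have hS M : ~ S M -> (if M == N then x else 0) = 0.
  by move=> MS; case: eqP => // e1; rewrite e1 in MS.
split=> // [M SM||]; first by case: eqP => [->|_] //; exact: rpred0.
  exact: (seq_support h).
by rewrite (fsum_seq hS _ h) // big_seq1 eqxx.
Qed.

Lemma decomposes_all x : exists u, decomposes x u.
Proof.
pose Wp : {pred V} := fun x => `[< exists u, decomposes x u >].
have Wc : submod_closed Wp.
  split=> [|a y z /asboolP[u yu] /asboolP[w zw]]; apply/asboolP.
    by exists (fun=> 0); exact: decomposes0.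
  by exists (fun N => a *: u N + w N); exact: decomposes_lin.
apply: contrapT => H.
have xW : x \notin Submod Wc by apply/asboolP.
have [a [y yW]] := proj_out xW.
have [|Dy _ [b eE]] := @projE y (a *: x).
  by apply: contraNneq yW => ->; exact: rpred0.
move/negP: yW; apply; apply/asboolP.
exists (fun M => if M == cyclic (v y) then e y *: (a *: x) else 0).
apply: decomposes1; first by apply/S_cyclic; exists y.
by apply/cyclicP; exists b.
Qed.

Lemma decomposes0_eq u : decomposes 0 u -> forall N, u N = 0.
Proof.
move=> [uN uS ufin sum0] N; apply: contrapT => uN0.
have SN : S N by apply: contrapT => /uS.
have [y Dy NE] := (S_cyclic N).1 SN.
have [r r_uniq ur] := support_seq ufin.
have Nr : N \in r by apply: contrapT => /negP/ur.
have [||a vE] := @v_generated y (u N) Dy; [by rewrite -NE uN|by apply/eqP|].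
have vE' : v y = - \sum_(M <- r | M != N) a *: u M.
  rewrite vE -scaler_sumr -scalerN; congr (_ *: _); apply/eqP.
  rewrite -addr_eq0; move: sum0; rewrite (fsum_seq uS r_uniq ur).
  by rewrite (bigD1_seq N) //= => <-.
have : exists2 M, M != N & e y *: (a *: u M) != 0.
  apply: contrapT => H; have := proj_v Dy; rewrite vE' scalerN scaler_sumr big1 ?oppr0 ?eqxx //.
  by move=> M MN; apply/eqP; apply: contrapT => /negP M0; apply: H; exists M.
case=> M MN eM; have SM : S M.
  apply: contrapT => /uS uM; move: eM; rewrite uM !scaler0 eqxx //.
have [y' Dy' ME] := (S_cyclic M).1 SM.
move/eqP: MN; apply; rewrite ME NE; apply/esym.
apply: (@cyclic_v_eq y y' (a *: u M)) => //.
by rewrite -ME rpredZ // uN.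
Qed.

Lemma S_direct_sum : is_direct_sum S.
Proof.
move=> x; have [u xu] := decomposes_all x; exists u; split=> // w xw.
apply/funext => N; have := @decomposes_lin (-1) x x w u xw xu.
rewrite scaleN1r addNr => /decomposes0_eq-/(_ N) /eqP.
by rewrite scaleN1r addrC subr_eq0 => /eqP.
Qed.

End Semisimple.

Section QNumbers.
Local Open Scope nat_scope.
Variables (q l e : nat).
Hypotheses (q2 : 2 <= q) (lp : prime l) (lq : coprime l q).

Definition qnum j := \sum_(i < j) q ^ i.

Lemma qnumE j : q ^ j - 1 = (q - 1) * qnum j.
Proof. by rewrite !subn1 predn_exp. Qed.

Lemma qnumD x y : qnum (x + y) = qnum x + q ^ x * qnum y.
Proof.
rewrite /qnum big_split_ord big_distrr /=; congr (_ + _).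
by apply: eq_bigr => i _; rewrite expnD.
Qed.

Lemma qnumM a b : qnum a %| qnum (b * a).
Proof.
elim: b => [|b IH]; first by rewrite mul0n /qnum big_ord0 dvdn0.
by rewrite mulSn qnumD dvdn_add // dvdn_mull.
Qed.

Hypotheses (e2 : 2 <= e) (le : l %| qnum e)
  (e_min : forall i, 2 <= i -> l %| qnum i -> e <= i).

Lemma dvd_qnum j : l %| qnum j -> e %| j.
Proof.
rewrite {1}(divn_eq j e) qnumD dvdn_addr; last by apply: dvdn_trans le (qnumM _ _).
rewrite Gauss_dvdr ?coprimeXr // => h; rewrite /dvdn.
have := ltn_pmod j (ltnW e2); case: (j %% e) h => [//|[|r]] h lt.
  by move: h; rewrite /qnum big_ord1 expn0 dvdn1 => /eqP l1; move: lp; rewrite l1.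
by have := e_min (isT : 2 <= r.+2) h; rewrite leqNgt lt.
Qed.

Definition dval j := logn l (q ^ j - 1).

Lemma q1_gt0 : 0 < q - 1. Proof. by rewrite subn_gt0. Qed.

Lemma qnum_gt0 j : 0 < j -> 0 < qnum j.
Proof. by case: j => // j _; rewrite /qnum big_ord_recl expn0. Qed.

Lemma dvalE j : 0 < j -> dval j = logn l (q - 1) + logn l (qnum j).
Proof. by move=> j0; rewrite /dval qnumE lognM ?q1_gt0 ?qnum_gt0. Qed.

Lemma dval_small j : 0 < j -> ~~ (e %| j) -> dval j = logn l (q - 1).
Proof.
move=> j0 ej; rewrite dvalE // (_ : logn l (qnum j) = 0) ?addn0 //.
by apply/eqP; rewrite -leqn0 leqNgt logn_gt0 mem_primes lp qnum_gt0 //= (contra _ ej) //; exact: dvd_qnum.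
Qed.

Lemma dval_e : logn l (q - 1) < dval e.
Proof.
have e0 : 0 < e by exact: ltnW.
by rewrite dvalE // -addn1 leq_add2l logn_gt0 mem_primes lp qnum_gt0.
Qed.

(** Valuations along powers of a number congruent to 1 modulo l. *)
Section Powers.
Variable Q : nat.
Hypotheses (Q1 : 1 < Q) (lQ : l %| Q - 1).

Let geom c : \sum_(i < c) Q ^ i = c %[mod l].
Proof.
have Qm : Q = 1 %[mod l] by apply/eqP; rewrite eqn_mod_dvd // ltnW.
elim: c => [|c IH]; first by rewrite big_ord0.
rewrite big_ord_recr /= -modnDm IH -modnXm Qm modnXm exp1n modnDm.
by rewrite addn1.
Qed.

Lemma logn_pow_coprime c : 0 < c -> ~~ (l %| c) -> logn l (Q ^ c - 1) = logn l (Q - 1).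
Proof.
move=> c0 lc; rewrite !subn1 predn_exp lognM.
- rewrite (_ : logn l (\sum_(i < c) Q ^ i) = 0) ?addn0 //.
  apply/eqP; rewrite -leqn0 leqNgt logn_gt0 mem_primes negb_and negb_and.
  by rewrite /dvdn geom lc !orbT.
- by rewrite -subn1 subn_gt0.
- by case: c c0 {lc} => // c _; rewrite big_ord_recl expn0.
Qed.

Lemma logn_pow_l : logn l (Q - 1) < logn l (Q ^ l - 1).
Proof.
have l0 := prime_gt0 lp.
have s0 : 0 < \sum_(i < l) Q ^ i by case: (l) l0 => // c _; rewrite big_ord_recl expn0.
rewrite !subn1 predn_exp lognM //; last by rewrite -subn1 subn_gt0.
rewrite -[X in X < _]addn0 ltn_add2l logn_gt0 mem_primes lp s0 /=.
by rewrite /dvdn geom modnn.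
Qed.
End Powers.

Lemma q_pow_gt1 x : 0 < x -> 1 < q ^ x.
Proof. by move=> x0; rewrite -(exp1n x) ltn_exp2r. Qed.

Lemma e_pow_gt0 i : 0 < e * l ^ i.
Proof. by rewrite muln_gt0 expn_gt0 (ltnW e2) prime_gt0. Qed.

Lemma l_dvd_e i : l %| q ^ (e * l ^ i) - 1.
Proof.
rewrite qnumE mulnC dvdn_mulr // mulnC; apply: dvdn_trans le (qnumM _ _).
Qed.

Lemma dval_mono i j : i < j -> dval (e * l ^ i) < dval (e * l ^ j).
Proof.
elim: j => // j IH; rewrite ltnS leq_eqVlt.
have step : dval (e * l ^ j) < dval (e * l ^ j.+1).
  rewrite /dval expnSr mulnA (expnM q (e * l ^ j) l); apply: logn_pow_l; last exact: l_dvd_e.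
  by rewrite q_pow_gt1 // e_pow_gt0.
by case/orP => [/eqP->//|/IH lt]; apply: ltn_trans lt step.
Qed.

Lemma dval_lt i j : 0 < j -> ~~ (e * l ^ i %| j) -> dval j < dval (e * l ^ i).
Proof.
move=> j0 xj; case: (boolP (e %| j)) => ej; last first.
  rewrite dval_small //; apply: leq_trans dval_e _.
  case: i {xj} => [|i]; first by rewrite muln1.
  by have := dval_mono (ltn0Sn i); rewrite muln1 => /ltnW.
have /dvdnP[j' jE] := ej; have j'0 : 0 < j' by case: j' jE j0 => // ->.
pose i' := logn l j'; have [c lc j'E] := pfactor_coprime lp j'0.
have c0 : 0 < c by case: c j'E j'0 {lc} => // ->.
have lt : i' < i.
  rewrite ltnNge; apply: contra xj => le'.
  by rewrite jE j'E mulnC dvdn_pmul2r ?(ltnW e2) // dvdn_mull // dvdn_exp2l.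
have -> : dval j = dval (e * l ^ i').
  rewrite /dval jE j'E -/i' [X in q ^ X](_ : _ = (e * l ^ i') * c); last first.
    by rewrite mulnC mulnA mulnAC.
  rewrite expnM logn_pow_coprime ?l_dvd_e ?q_pow_gt1 ?e_pow_gt0 //.
  by rewrite -prime_coprime.
exact: dval_mono.
Qed.

Lemma logn_add_lt a b : 0 < a -> logn l a < logn l b -> logn l (b + a) = logn l a.
Proof.
move=> a0 lt; have b0 : 0 < b by rewrite lt0n; apply: contraTneq lt => ->; rewrite logn0.
have ba0 : 0 < b + a by rewrite addn_gt0 b0.
have db k : k <= logn l b -> (l ^ k %| b + a) = (k <= logn l a).
  by move=> kb; rewrite dvdn_addr pfactor_dvdn.
apply/eqP; rewrite eqn_leq; apply/andP; split.
  by rewrite leqNgt -pfactor_dvdn // db // ltnn.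
by rewrite -pfactor_dvdn // db // ltnW.
Qed.

(** The valuation of [j] is not changed by adding the largest x = e * l ^ i below. *)
Lemma dval_add i j : 0 < j -> e * l ^ i + j < e * l ^ i.+1 ->
  dval (e * l ^ i + j) = dval j.
Proof.
set x := e * l ^ i => j0 lt; have x0 : 0 < x := e_pow_gt0 i.
case: (boolP (x %| j)) => [/dvdnP[c jE]|xj]; last first.
  rewrite /dval (_ : q ^ (x + j) - 1 = q ^ j * (q ^ x - 1) + (q ^ j - 1)); last first.
    have h1 := q_pow_gt1 j0; have h2 := q_pow_gt1 x0.
    rewrite expnD; move: (q ^ x) (q ^ j) h1 h2 => b a a1 b1.
    have : a <= a * b by rewrite leq_pmulr // ltnW.
    by rewrite mulnBr muln1 [b * a]mulnC; move: (a * b) => c; nlia.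
  apply: logn_add_lt; first by rewrite subn_gt0 q_pow_gt1.
  rewrite lognM ?expn_gt0 ?subn_gt0 ?q_pow_gt1 ?(ltnW q2) // lognX.
  rewrite (_ : logn l q = 0) ?muln0 ?add0n; first exact: dval_lt.
  by apply/eqP; rewrite -leqn0 leqNgt logn_gt0 mem_primes !negb_and -prime_coprime // lq !orbT.
have c0 : 0 < c by case: c jE j0 => // ->.
have cl : c.+1 < l.
  by move: lt; rewrite jE -mulSn expnSr mulnA -/x mulnC ltn_pmul2l.
have nd a : 0 < a < l -> ~~ (l %| a).
  by case/andP => a0 al; apply/negP => /(dvdn_leq a0); rewrite leqNgt al.
have H a : 0 < a < l -> dval (a * x) = logn l (q ^ x - 1).
  move=> a0; rewrite /dval mulnC expnM; apply: logn_pow_coprime.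
  - exact: q_pow_gt1.
  - exact: l_dvd_e.
  - by case/andP: a0.
  - exact: nd.
by rewrite jE -mulSn !H // c0 ltnW.
Qed.

Definition Dval k := \sum_(j < k) dval j.+1.

Lemma DvalD x z : (forall j, j < z -> dval (x + j.+1) = dval j.+1) ->
  Dval (x + z) = Dval x + Dval z.
Proof.
move=> h; rewrite /Dval big_split_ord /=; congr (_ + _).
by apply: eq_bigr => j _; rewrite -addnS h.
Qed.

Lemma Dval_split k : 0 < k -> k <> 1 -> (forall i, k <> e * l ^ i) ->
  exists x z, [/\ 0 < x, 0 < z, k = x + z & Dval k = Dval x + Dval z].
Proof.
move=> k0 k1 ke; case: (ltnP k e) => [lt|le_ek].
  exists 1, k.-1; split=> //; [by nlia|by nlia|].
  rewrite (_ : k = 1 + k.-1); last by nlia.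
  rewrite [in X in _ = X](_ : (1 + k.-1).-1 = k.-1) //; apply: DvalD => j jk.
  rewrite !dval_small //; apply/negP => /dvdn_leq; move/(_ isT); nlia.
have e0 : 0 < e by exact: ltnW.
have l1 := prime_gt1 lp.
pose h := k %/ e; have h0 : 0 < h by rewrite divn_gt0.
pose i := trunc_log l h; have /andP[il ir] := trunc_log_bounds l1 h0.
have xk : e * l ^ i <= k.
  by apply: leq_trans (leq_trunc_div k e); rewrite mulnC leq_mul2r il orbT.
have kx : k < e * l ^ i.+1.
  by apply: leq_trans (ltn_ceil k e0) _; rewrite mulnC leq_mul2l ir orbT.
have ne := ke i.
exists (e * l ^ i), (k - e * l ^ i); split; [exact: e_pow_gt0| by nlia|by nlia|].
rewrite -{1}(subnKC xk); apply: DvalD => j jk; apply: dval_add => //; nlia.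
Qed.
End QNumbers.

Section Compositions.
Local Open Scope nat_scope.
Implicit Types (a s t : seq nat).

Lemma reshape_index_cons x s i :
  reshape_index (x :: s) i = if i < x then 0 else (reshape_index s (i - x)).+1.
Proof.
rewrite /reshape_index /= subn_eq0; case: ltnP => // xi.
by rewrite subSn.
Qed.

Lemma reshape_offset_cons x s i :
  reshape_offset (x :: s) i = if i < x then i else reshape_offset s (i - x).
Proof.
rewrite /reshape_offset reshape_index_cons; case: ltnP => [ix|xi] /=.
  by rewrite subn0.
by rewrite subnDA.
Qed.

Lemma reshape_index_mono a i j : i <= j -> reshape_index a i <= reshape_index a j.
Proof.
elim: a i j => [|x s IH] i j ij //; rewrite !reshape_index_cons.
case: (ltnP i x) => // xi; case: (ltnP j x) => [jx|xj]; first by nlia.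
by apply: IH; rewrite leq_sub2r.
Qed.

Lemma reshape_start a i j : i < sumn a -> 
  (reshape_index a j < reshape_index a i) = (j < i - reshape_offset a i).
Proof.
elim: a i j => [|x s IH] i j //= ia.
rewrite !reshape_index_cons reshape_offset_cons; case: (ltnP i x) => ix.
  by rewrite subnn ltn0; case: (j < x).
have ofs : reshape_offset s (i - x) <= i - x by rewrite leq_subr.
case: (ltnP j x) => jx; first by rewrite ltn0Sn; apply/esym; nlia.
rewrite ltnS IH; last by nlia.
by apply/idP/idP; nlia.
Qed.

(** k and k + 1 lie in the same part of the composition. *)
Definition joined a k := reshape_index a k == reshape_index a k.+1.

Lemma joined_cons x s k : 0 < x ->
  joined (x :: s) k = if k < x then k.+1 < x else joined s (k - x).
Proof.
move=> x0; rewrite /joined !reshape_index_cons; case: (ltnP k x) => kx.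
  by case: (ltnP k.+1 x).
by rewrite ltnNge leqW //= eqSS subSn.
Qed.

Lemma joined_cons_at A x s k : 0 < x -> A <= k ->
  joined (x :: s) (k - A) = if k < A + x then k.+1 < A + x else joined s (k - (A + x)).
Proof.
by move=> x0 Ak; rewrite joined_cons // ltn_subLR // -subSn // ltn_subLR ?leqW // subnDA.
Qed.

Lemma joined_cat s t k : all (leq 1) s ->
  joined (s ++ t) k = if k < sumn s then joined s k else joined t (k - sumn s).
Proof.
elim: s k => [|x s IH] k /=; first by rewrite subn0.
move=> /andP[x0 sp]; rewrite !joined_cons // IH //.
case: (ltnP k x) => kx; first by rewrite ltn_addr.
by rewrite -ltn_subLR // subnDA.
Qed.

Lemma joined_lt s k : all (leq 1) s -> k < sumn s -> joined s k -> k.+1 < sumn s.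
Proof.
elim: s k => [|x s IH] k //= /andP[x0 sp] ks; rewrite joined_cons //.
case: (ltnP k x) => kx; first by move=> lt; rewrite ltn_addr.
have ks' : k - x < sumn s by nlia.
by move=> /(IH _ sp ks'); nlia.
Qed.

(** The positions that a block x followed by a block z take, from A on, after
    these blocks have been exchanged. *)
Definition block_swap A x z j :=
  if (A <= j < A + x) then j + z
  else if (A + x <= j < A + x + z) then j - x else j.

Lemma block_swap_lo A x z j : j < A -> block_swap A x z j = j.
Proof.
move=> jA; rewrite /block_swap !(leqNgt _ j) jA.
by rewrite (_ : j < A + x) // ltn_addr.
Qed.

Lemma block_swap_hi A x z j : A + x + z <= j -> block_swap A x z j = j.
Proof.
move=> jA; rewrite /block_swap !(ltnNge j) jA andbF.
by rewrite (_ : A + x <= j) ?andbF //; nlia.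
Qed.

Lemma block_swap_l A x z j : A <= j -> j < A + x -> block_swap A x z j = j + z.
Proof. by rewrite /block_swap => -> ->. Qed.

Lemma block_swap_r A x z j : A + x <= j -> j < A + x + z -> block_swap A x z j = j - x.
Proof. by rewrite /block_swap => xj jz; rewrite ltnNge xj andbF jz. Qed.

Lemma block_swapK A x z j : block_swap A z x (block_swap A x z j) = j.
Proof.
rewrite /block_swap; case: (ltnP j A) => jA.
  rewrite /= (_ : (A + x <= j) = false) /=; last by nlia.
  rewrite (_ : (A <= j) = false) /=; last by nlia.
  by rewrite (_ : (A + z <= j) = false) //; nlia.
rewrite /=; case: (ltnP j (A + x)) => jx.
  rewrite (_ : (A <= j + z < A + z) = false); last by apply/negP; nlia.
  rewrite (_ : A + z <= j + z < A + z + x) ?addnK //.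
  by apply/andP; split; nlia.
case: (ltnP j (A + x + z)) => jz /=.
  rewrite (_ : A <= j - x < A + z); last by nlia.
  by rewrite subnK //; nlia.
rewrite (_ : (A <= j < A + z) = false); last by apply/negP; nlia.
by rewrite (_ : (A + z <= j < A + z + x) = false) //; apply/negP; nlia.
Qed.

(** For a composition with consecutive parts z and x, or with their sum as a
    part, against the composition with x before z. *)
Lemma joined_swap s1 s2 x z a k (b := s1 ++ [:: x; z] ++ s2)
    (w := block_swap (sumn s1) z x) :
  all (leq 1) s1 -> 0 < x -> 0 < z ->
  a = s1 ++ [:: z; x] ++ s2 \/ a = s1 ++ [:: z + x] ++ s2 ->
  joined a k -> w k < w k.+1 -> w k.+1 = (w k).+1 /\ joined b (w k).
Proof.
move=> sp x0 z0 aE; set A := sumn s1.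
have jb j : joined b j = if j < A then joined s1 j else
    if j < A + x then j.+1 < A + x else if j < A + x + z then j.+1 < A + x + z
    else joined s2 (j - (A + x + z)).
  rewrite /b joined_cat // -/A; case: ltnP => // Aj; rewrite joined_cons_at //.
  by case: ltnP => // xj; rewrite joined_cons_at.
have ja j : joined a j -> if j < A then joined s1 j else
    if j < A + x + z then j.+1 < A + x + z else joined s2 (j - (A + x + z)).
  rewrite (addnAC A x).
  case: aE => ->; rewrite joined_cat // -/A; case: ltnP => // Aj.
    rewrite joined_cons_at //; case: ltnP => jz; first by case: ifP; nlia.
    by rewrite joined_cons_at.
  by rewrite joined_cons_at ?addn_gt0 ?z0 // addnA.
have j1 : k < A -> joined s1 k -> k.+1 < A by exact: joined_lt.
move=> /ja; rewrite jb /w -/A.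
case: (ltnP k A) => [kA /[dup] kj /(j1 kA) kA1|Ak]; first by rewrite !block_swap_lo // kA.
case: (ltnP k (A + x + z)) => kT; last first.
  rewrite !block_swap_hi; [move=> jk _; split=> //|nlia..].
  rewrite (_ : (k < A) = false); last by nlia.
  rewrite (_ : (k < A + x) = false); last by nlia.
  by rewrite (_ : (k < A + x + z) = false) //; nlia.
move=> k1T; case: (ltnP k (A + z)) => kz.
  rewrite block_swap_l //; case: (ltnP k.+1 (A + z)) => k1z.
    rewrite block_swap_l; [|nlia..]; move=> _; split; first by nlia.
    rewrite (_ : (k + x < A) = false); last by nlia.
    rewrite (_ : (k + x < A + x) = false); last by nlia.
    rewrite (_ : (k + x < A + x + z) = true); last by nlia.
    by nlia.
  rewrite block_swap_r; [|nlia..]; nlia.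
rewrite !block_swap_r //; [move=> _|nlia..].
split; first by nlia.
rewrite (_ : (k - z < A) = false); last by nlia.
rewrite (_ : (k - z < A + x) = true); last by nlia.
by nlia.
Qed.

(** Conversely, positions joined after the exchange come from joined ones. *)
Lemma joined_unswap s1 s2 x z a j (b := s1 ++ [:: x; z] ++ s2)
    (w := block_swap (sumn s1) x z) :
  all (leq 1) s1 -> 0 < x -> 0 < z ->
  a = s1 ++ [:: z; x] ++ s2 \/ a = s1 ++ [:: z + x] ++ s2 ->
  joined b j -> w j.+1 = (w j).+1 /\ joined a (w j).
Proof.
move=> sp x0 z0 aE; set A := sumn s1.
have jb : joined b j -> if j < A then joined s1 j else
    if j < A + x then j.+1 < A + x else if j < A + x + z then j.+1 < A + x + z
    else joined s2 (j - (A + x + z)).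
  rewrite /b joined_cat // -/A; case: ltnP => // Aj; rewrite joined_cons_at //.
  by case: ltnP => // xj; rewrite joined_cons_at.
have ja k : (if k < A then joined s1 k else
    if k < A + z then k.+1 < A + z else if k < A + x + z then k.+1 < A + x + z
    else joined s2 (k - (A + x + z))) -> joined a k.
  rewrite (addnAC A x).
  case: aE => ->; rewrite joined_cat // -/A; case: ltnP => // Ak.
    rewrite joined_cons_at //; case: ltnP => // kz.
    by rewrite joined_cons_at.
  rewrite joined_cons_at ?addn_gt0 ?z0 // addnA; case: ltnP => kz.
    by case: ifP; nlia.
  by case: ifP => [|_] //; nlia.
have j1 : j < A -> joined s1 j -> j.+1 < A by exact: joined_lt.
move=> /jb jbj; suff [h1 h2] : w j.+1 = (w j).+1 /\ (if w j < A then joined s1 (w j) else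
    if w j < A + z then (w j).+1 < A + z else if w j < A + x + z then (w j).+1 < A + x + z
    else joined s2 (w j - (A + x + z))) by split=> //; exact: ja.
move: jbj; rewrite /w -/A.
case: (ltnP j A) => [jA /[dup] jj /(j1 jA) jA1|Aj]; first by rewrite !block_swap_lo // jA.
case: (ltnP j (A + x)) => jx.
  move=> j1x; rewrite !block_swap_l ?leqW //; split; first by nlia.
  rewrite (_ : (j + z < A) = false); last by nlia.
  rewrite (_ : (j + z < A + z) = false); last by nlia.
  rewrite (_ : (j + z < A + x + z) = true); last by nlia.
  by nlia.
case: (ltnP j (A + x + z)) => jT.
  move=> j1T; rewrite !block_swap_r ?leqW //; split; first by nlia.
  rewrite (_ : (j - x < A) = false); last by nlia.
  rewrite (_ : (j - x < A + z) = true); last by nlia.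
  by nlia.
rewrite !block_swap_hi ?leqW // => jj; split=> //.
rewrite (_ : (j < A) = false); last by nlia.
rewrite (_ : (j < A + z) = false); last by nlia.
by rewrite (_ : (j < A + x + z) = false) //; nlia.
Qed.

Lemma composition_of (y : nat -> bool) n : exists a,
  [/\ all (leq 1) a, sumn a = n.+1 & forall k, k < n -> joined a k = y k].
Proof.
elim: n y => [|n IH] y; first by exists [:: 1].
have [a [ap an aj]] := IH (fun k => y k.+1).
case: (boolP (y 0)) => y0; last first.
  exists (1 :: a); split=> [//||k kn]; first by rewrite /= an.
  rewrite joined_cons //; case: k kn => [|k] kn /=; first by rewrite (negPf y0).
  by rewrite subSS subn0 aj.
case: a ap an aj => [//|x s] /= /andP[x0 sp] an aj.
exists (x.+1 :: s); split=> [//||k kn]; first by rewrite /= addSn an.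
rewrite joined_cons //; case: k kn => [|k] kn; first by rewrite y0 /=.
by rewrite -aj // joined_cons // subSS !ltnS.
Qed.

Lemma size_le_sumn a : all (leq 1) a -> size a <= sumn a.
Proof. by elim: a => [|x s IH] //= /andP[x0 /IH]; nlia. Qed.

(** Every composition is reached from a sorted one with allowed parts by
    exchanging consecutive parts and adding some of them. *)
Lemma composition_ind (allowed : nat -> Prop) (good : nat -> nat -> Prop)
    (P : seq nat -> Prop) n :
  (forall s1 s2 x z, all (leq 1) (s1 ++ [:: x; z] ++ s2) ->
     sumn (s1 ++ [:: x; z] ++ s2) = n ->
     P (s1 ++ [:: x; z] ++ s2) -> P (s1 ++ [:: z; x] ++ s2)) ->
  (forall s1 s2 x z, all (leq 1) (s1 ++ [:: x; z] ++ s2) ->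
     sumn (s1 ++ [:: x; z] ++ s2) = n -> good x z ->
     P (s1 ++ [:: x; z] ++ s2) -> P (s1 ++ [:: z + x] ++ s2)) ->
  (forall k, 0 < k -> ~ allowed k ->
     exists x z, [/\ 0 < x, 0 < z, k = x + z & good x z]) ->
  (forall a, all (leq 1) a -> sumn a = n -> sorted leq a ->
     (forall x, x \in a -> allowed x) -> P a) ->
  forall a, all (leq 1) a -> sumn a = n -> P a.
Proof.
move=> Pswap Psplit split Pbase.
have Pperm s t p : perm_eq s t -> all (leq 1) (p ++ t) -> sumn (p ++ t) = n ->
    P (p ++ t) -> P (p ++ s).
  elim: s t p => [|x s IH] t p; first by rewrite perm_sym => /perm_nilP->.
  move=> st; have xt : x \in t by rewrite -(perm_mem st) mem_head.
  have [t1 [t2 tE]] : exists t1 t2, t = t1 ++ x :: t2 by case/splitPr: xt => t1 t2; exists t1, t2.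
  have st' : perm_eq s (t1 ++ t2).
    by move: st; rewrite tE -(cat1s x t2) perm_sym perm_catCA perm_cons perm_sym.
  rewrite {}tE {xt st t}.
  have front p' : all (leq 1) (p' ++ t1 ++ x :: t2) -> sumn (p' ++ t1 ++ x :: t2) = n ->
      P (p' ++ t1 ++ x :: t2) -> P (p' ++ x :: t1 ++ t2).
    elim: t1 {st'} p' => [//|y t1 IHt] p' ap an Py.
    have -> : p' ++ x :: (y :: t1) ++ t2 = p' ++ [:: x; y] ++ (t1 ++ t2) by [].
    apply: Pswap; first by move: ap; rewrite !all_cat /= ?all_cat /=; do ![case: (all _ _) => //=]; rewrite ?andbT ?andbF // => /andP[-> /andP[_ ->]].
      by move: an; rewrite !sumn_cat /= ?sumn_cat /=; nlia.
    have -> : p' ++ [:: y; x] ++ t1 ++ t2 = (rcons p' y) ++ x :: t1 ++ t2 by rewrite cat_rcons.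
    by apply: IHt; rewrite cat_rcons.
  move=> ap an Pt; rewrite -cat_rcons; apply: (IH (t1 ++ t2)) => //.
  - by move: ap; rewrite cat_rcons !all_cat /= ?all_cat /=; do ![case: (all _ _) => //=]; rewrite ?andbT ?andbF.
  - by move: an; rewrite cat_rcons !sumn_cat /= ?sumn_cat /=; nlia.
  - by rewrite cat_rcons; exact: front.
have Pbase' a : all (leq 1) a -> sumn a = n -> (forall x, x \in a -> allowed x) -> P a.
  move=> ap an al; have sa : perm_eq a (sort leq a) by rewrite perm_sym perm_sort.
  have sp : all (leq 1) (sort leq a) by rewrite all_sort.
  have sn : sumn (sort leq a) = n by rewrite -an; apply: perm_sumn; rewrite perm_sym.
  apply: (Pperm _ _ [::] sa) => //; apply: Pbase => //.
    exact: sort_sorted leq_total _.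
  by move=> x; rewrite mem_sort; exact: al.
have H d a : n - size a < d -> all (leq 1) a -> sumn a = n -> P a.
  elim: d a => [|d IH] a; rewrite ?ltnS => ad ap an; first by [].
  have [[k ka nk]|h] := pselect (exists2 k, k \in a & ~ allowed k); last first.
  - by apply: Pbase' => // x xa; apply: contrapT => nx; apply: h; exists x.
  - have [s1 [s2 aE]] : exists s1 s2, a = s1 ++ k :: s2.
      by case/splitPr: ka => s1 s2; exists s1, s2.
    have k0 : 0 < k by exact: (allP ap).
    have [x [z [x0 z0 kE g]]] := split k k0 nk.
    rewrite kE addnC in aE.
    have eqn : sumn (s1 ++ [:: x; z] ++ s2) = n.
      by rewrite -an aE !sumn_cat /=; nlia.
    have lea : all (leq 1) (s1 ++ [:: x; z] ++ s2).
      by move: ap; rewrite aE !all_cat /= x0 z0 => /and3P[-> _ ->].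
    rewrite aE; apply: Psplit => //; apply: IH => //.
    have := size_le_sumn lea; rewrite eqn; move: ad; rewrite aE !size_cat /=; nlia.
by move=> a; exact: H (ltnSn _).
Qed.

End Compositions.

Section BlockExchange.
Variables (F : finFieldType) (m : nat).
Local Notation GL := (GLn F m).
Local Notation idx := 'I_m.+1.
Local Notation U := (Un F m).
Implicit Types (y : nat -> F) (w : 'S_m.+1).

Lemma block_swap_lt A x z j n : (A + x + z <= n)%N -> (j < n)%N ->
  (block_swap A x z j < n)%N.
Proof. by rewrite /block_swap => An jn; do 2?case: ifP; nlia. Qed.

Lemma block_swap_perm A x z : (A + x + z <= m.+1)%N ->
  exists w : 'S_m.+1, (forall j : idx, w j = block_swap A x z j :> nat) /\
    (forall j : idx, (w^-1)%g j = block_swap A z x j :> nat).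
Proof.
move=> An; have Az : (A + z + x <= m.+1)%N by rewrite addnAC.
pose f (j : idx) : idx := inord (block_swap A x z j).
pose f' (j : idx) : idx := inord (block_swap A z x j).
have fE j : f j = block_swap A x z j :> nat by rewrite inordK // block_swap_lt.
have fE' j : f' j = block_swap A z x j :> nat by rewrite inordK // block_swap_lt.
have fK : cancel f f' by move=> j; apply: val_inj; rewrite /= fE' fE block_swapK.
have fK' : cancel f' f by move=> j; apply: val_inj; rewrite /= fE fE' block_swapK.
exists (perm (can_inj fK)); split=> j; first by rewrite permE fE.
rewrite -fE'; congr (val _); apply: (@perm_inj _ (perm (can_inj fK))).
by rewrite permKV permE fK'.
Qed.

Lemma pairing_swap y y' w u : u \in U ->
  (forall k, (k < m)%N -> y k != 0 ->
     ((w^-1)%g (inord k) < (w^-1)%g (inord k.+1))%N ->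
     (w^-1)%g (inord k.+1) = ((w^-1)%g (inord k)).+1 :> nat /\
     y' ((w^-1)%g (inord k)) = y k) ->
  (forall j, (j < m)%N -> y' j != 0 ->
     w (inord j.+1) = (w (inord j)).+1 :> nat /\ y (w (inord j)) = y' j) ->
  pairing y (u ^ pm F w)%g = pairing y' u.
Proof.
move=> uU h1 h2; have ul (i j : idx) : (j < i)%N -> GLval u i j = 0.
  by move: uU; rewrite in_Un => /andP[/borelP H _] /H.
pose c (k j : nat) := (w (inord j) == k :> nat) && (w (inord j.+1) == k.+1 :> nat).
pose T k j : F := if c k j then y' j * GLval u (inord j) (inord j.+1) else 0.
transitivity (\sum_(k < m) \sum_(j < m) T k j).
  apply: eq_bigr => k _; rewrite /superdiag conj_pmE.
  have [yk|yk] := eqVneq (y k) 0.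
    rewrite yk mul0r big1 // => j _; rewrite /T; case: ifP => // /andP[/eqP wj _].
    have [->|yj] := eqVneq (y' j) 0; first by rewrite mul0r.
    by have [_] := h2 j (ltn_ord j) yj; rewrite wj yk => y0; rewrite -y0 eqxx in yj.
  have wk : (w ((w^-1)%g (inord k)) = k :> nat) by rewrite permKV inordK // ltnS ltnW.
  have wk1 : (w ((w^-1)%g (inord k.+1)) = k.+1 :> nat) by rewrite permKV inordK // ltnS.
  set i := ((w^-1)%g (inord k)) in wk *; set i' := ((w^-1)%g (inord k.+1)) in wk1 *.
  have cE (j : 'I_m) : c k j -> inord j = i /\ inord j.+1 = i'.
    move=> /andP[/eqP e1 /eqP e2]; split; apply: (@perm_inj _ w); apply: val_inj.
      by rewrite /= e1 wk.
    by rewrite /= e2 wk1.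
  have [ii'|i'i] := ltnP i i'; last first.
    have neq : i' != i.
      by apply/eqP => E; move: wk1; rewrite E wk => /eqP; rewrite -{1}[nat_of_ord k]addn0 -addn1 eqn_add2l.
    rewrite ul ?mulr0; last by rewrite ltn_neqAle neq.
    rewrite big1 // => j _; rewrite /T; case: ifP => // /cE[e1 e2].
    move: i'i; rewrite -e1 -e2 !inordK ?ltnS ?ltn_ord //; last by rewrite ltnW.
    by rewrite ltnn.
  have [i1 yi] := h1 k (ltn_ord k) yk ii'.
  have im : (i < m)%N by have := ltn_ord i'; rewrite i1 ltnS.
  rewrite (bigD1 (Ordinal im)) //= big1 ?addr0 => [|j jn].
    have e1 : inord i = i by rewrite inord_val.
    have e2 : inord i.+1 = i' by rewrite -i1 inord_val.
    by rewrite /T /c e1 e2 wk wk1 !eqxx /= yi.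
  rewrite /T; case: ifP => // /cE[e1 _]; case/eqP: jn; apply: val_inj => /=.
  by rewrite -e1 inordK // ltnW // ltnS.
rewrite exchange_big /=; apply: eq_bigr => j _; rewrite /superdiag.
have [yj|yj] := eqVneq (y' j) 0.
  by rewrite yj mul0r big1 // => k _; rewrite /T yj mul0r if_same.
have [w1 _] := h2 j (ltn_ord j) yj.
have km : (w (inord j) < m)%N by have := ltn_ord (w (inord j.+1)); rewrite w1 ltnS.
rewrite (bigD1 (Ordinal km)) //= /T /c eqxx w1 eqxx /= big1 ?addr0 // => k kn.
by case: ifP => // /andP[/eqP E _]; case/eqP: kn; apply: val_inj.
Qed.

Section Elements.
Variables (R : idomainType) (psi : F -> R).
Hypothesis psi0 : psi 0 = 1.
Hypothesis psiD : forall a a', psi (a + a') = psi a * psi a'.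
Hypothesis natR : forall n, (0 < n)%N -> n%:R != 0 :> R.
Hypothesis psi_nontriv : exists a, psi a != 1.

Definition comp_char (a : seq nat) (k : nat) : F := (joined a k)%:R.

Lemma comp_char_neq0 a k : (comp_char a k != 0) = joined a k.
Proof. by rewrite /comp_char; case: joined; rewrite ?oner_eq0 ?eqxx. Qed.

Lemma hatU_swap s1 s2 x z a (b := s1 ++ [:: x; z] ++ s2) :
  all (leq 1) s1 -> (0 < x)%N -> (0 < z)%N -> sumn b = m.+1 ->
  a = s1 ++ [:: z; x] ++ s2 \/ a = s1 ++ [:: (z + x)%N] ++ s2 ->
  exists w : 'S_m.+1,
    hatU m psi (comp_char b) * (gr R (pm F w) * Ey m psi (comp_char a)) =
    ((-1) ^+ odd_perm w * #|Upat F w|%:R) *: Ey m psi (comp_char b).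
Proof.
move=> sp x0 z0 bn aE; have Axz : (sumn s1 + x + z <= m.+1)%N.
  by rewrite -bn !sumn_cat /=; nlia.
have [w [wE wVE]] := block_swap_perm Axz; exists w.
have h2 j : (j < m)%N -> comp_char b j != 0 ->
    w (inord j.+1) = (w (inord j)).+1 :> nat /\ joined a (w (inord j)).
  move=> jm; rewrite comp_char_neq0 => /(joined_unswap sp x0 z0 aE).
  by have j1 : (j < m.+1)%N by [rewrite ltnS ltnW]; rewrite !wE !inordK.
apply: hatU_pm_Ey => // [u /UpatP[uU _]|].
  rewrite /chr; congr psi; apply: pairing_swap => // [k km|j jm yj].
    have k1 : (k < m.+1)%N by rewrite ltnS ltnW.
    rewrite comp_char_neq0 !wVE !inordK // => ka lt.
    have [e1 e2] := joined_swap sp x0 z0 aE ka lt; split=> //.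
    by rewrite /comp_char ka e2.
  have [-> e] := h2 j jm yj; split=> //.
  by move: yj; rewrite comp_char_neq0 /comp_char e => ->.
apply/forallP => j; apply/implyP => yj; have [e _] := h2 j (ltn_ord j) yj.
by rewrite !permM ltn_w0 e.
Qed.

End Elements.
End BlockExchange.

Section RowCount.
Variables (F : finFieldType) (n : nat).
Local Notation q := #|F|.

Lemma card_row_space t (A : 'M[F]_(t, n)) : row_free A ->
  #|[set v : 'rV[F]_n | (v <= A)%MS]| = (q ^ t)%N.
Proof.
move=> fA; have inj := @row_free_inj _ 1%N _ _ _ fA.
have -> : [set v : 'rV[F]_n | (v <= A)%MS] = [set w *m A | w in [set: 'rV[F]_t]].
  apply/setP => v; rewrite inE; apply/submxP/imsetP => [[w ->]|[w _ ->]].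
    by exists w; rewrite ?inE.
  by exists w.
by rewrite card_imset // cardsT card_mx mul1n.
Qed.

Lemma card_row_zero s : (s <= n)%N ->
  #|[set v : 'rV[F]_n | [forall j : 'I_n, (j < s)%N ==> (v 0 j == 0)]]| =
  (q ^ (n - s))%N.
Proof.
move=> sn; pose E : 'M[F]_(n - s, n) := \matrix_(i, j) (j == s + i :> nat)%N%:R.
have lt (i : 'I_(n - s)) : (s + i < n)%N by rewrite -ltn_subRL.
have fE : row_free E.
  apply/row_freeP; exists E^T; apply/matrixP => i i'; rewrite !mxE.
  rewrite (bigD1 (Ordinal (lt i))) //= big1 ?addr0 => [|j jn]; rewrite !mxE.
    by rewrite eqxx mul1r /= eqn_add2l.
  rewrite (_ : (j == s + i :> nat)%N = false) ?mul0r //.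
  by apply: contraNF jn => /eqP e; apply/eqP/val_inj.
rewrite -(card_row_space fE); apply: eq_card => v; rewrite !inE.
apply/forallP/submxP => [v0|[w ->] j]; last first.
  apply/implyP => js; rewrite mxE big1 // => i _; rewrite mxE.
  by rewrite (_ : (j == s + i :> nat)%N = false) ?mulr0 //; nlia.
exists (\row_i v 0 (Ordinal (lt i))); apply/rowP => j; rewrite mxE.
case: (ltnP j s) => js.
  have /implyP/(_ js)/eqP-> := v0 j; rewrite big1 // => i _; rewrite !mxE.
  by rewrite (_ : (j == s + i :> nat)%N = false) ?mulr0 //; nlia.
have jl : (j - s < n - s)%N by rewrite ltn_sub2r // (leq_ltn_trans js).
rewrite (bigD1 (Ordinal jl)) //= big1 ?addr0 => [|i ij]; rewrite !mxE /=.
  have -> : (j == s + (j - s) :> nat)%N by rewrite subnKC.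
  by rewrite mulr1; congr (v 0 _); apply: val_inj; rewrite /= subnKC.
rewrite (_ : (j == s + i :> nat)%N = false) ?mulr0 //.
by apply: contraNF ij => /eqP e; apply/eqP/val_inj; rewrite /= e addKn.
Qed.

Lemma row_free_col_mx t (v : 'rV[F]_n) (A : 'M[F]_(t, n)) :
  row_free (col_mx v A) = row_free A && ~~ (v <= A)%MS.
Proof.
rewrite -!kermx_eq0; apply/rowV0P/andP => [H|[/rowV0P fA vA] w].
  split.
    apply/rowV0P => w; rewrite sub_kermx => /eqP wA.
    have /H/eqP : (row_mx 0 w <= kermx (col_mx v A))%MS.
      by rewrite sub_kermx mul_row_col wA mul0mx addr0.
    by rewrite row_mx_eq0 => /andP[_ /eqP].
  apply/negP => /submxP[w vE].
  have /H/eqP : (row_mx 1%:M (- w) <= kermx (col_mx v A))%MS.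
    by rewrite sub_kermx mul_row_col mul1mx mulNmx -vE subrr.
  by rewrite row_mx_eq0 => /andP[/eqP/matrixP/(_ 0 0)/eqP]; rewrite !mxE oner_eq0.
rewrite sub_kermx -[w]hsubmxK mul_row_col; set a := lsubmx w; set b := rsubmx w.
rewrite (mx11_scalar a) mul_scalar_mx => /eqP E.
have a0 : a 0 0 = 0.
  apply: contraNeq vA => a0; apply/submxP; exists (- (a 0 0)^-1 *: b).
  apply: (scalerI a0); rewrite scalemxAl scalerA mulrN mulfV // scaleN1r mulNmx.
  by move/eqP: E; rewrite addr_eq0 => /eqP.
have b0 : b = 0.
  by apply: fA; rewrite sub_kermx -E a0 scale0r add0r.
by rewrite a0 b0 raddf0 row_mx0.
Qed.

Variable st : nat -> nat.
Hypothesis st_mono : forall i j, (i <= j)%N -> (j < n)%N -> (st i <= st j)%N.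
Hypothesis st_le : forall i, (i < n)%N -> (st i <= i)%N.

(** The last t rows of an invertible matrix whose row i starts with st i zeros. *)
Definition low_rows t : {set 'M[F]_(t, n)} :=
  [set A | row_free A & [forall i : 'I_t, forall j : 'I_n,
     (j < st (n - t + i))%N ==> (A i j == 0)]].

Lemma card_low_rowsS t : (t < n)%N ->
  #|low_rows t.+1| = ((q ^ (n - st (n - t.+1)) - q ^ t) * #|low_rows t|)%N.
Proof.
move=> tn; set s := st (n - t.+1).
pose Z := [set v : 'rV[F]_n | [forall j : 'I_n, (j < s)%N ==> (v 0 j == 0)]].
pose D := [set p : 'rV[F]_n * 'M[F]_(t, n) |
  (p.2 \in low_rows t) && (p.1 \in Z :\: [set v : 'rV[F]_n | (v <= p.2)%MS])].
have -> : low_rows t.+1 = [set col_mx p.1 p.2 | p in D].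
  apply/setP => A.
  have [v [A' ->]] : exists v A', A = col_mx v A' :> 'M_(1 + t, n).
    by exists (usubmx (A : 'M_(1 + t, n))), (dsubmx (A : 'M_(1 + t, n))); rewrite vsubmxK.
  have -> : (col_mx v A' \in [set col_mx p.1 p.2 | p in D]) = ((v, A') \in D).
    apply/imsetP/idP => [[[v1 A1] h /= /eq_col_mx[-> ->]] //|h].
    by exists (v, A').
  rewrite !inE /= row_free_col_mx; set P := [forall i : 'I_t.+1, _].
  set Q := [forall i : 'I_t, _]; set Zv := [forall j : 'I_n, (j < s)%N ==> _].
  have -> : P = Q && Zv.
    apply/forallP/andP => [H|[/forallP HA /forallP Hv] i].
      split; apply/forallP => i.
        apply/forallP => j; have /forallP/(_ j) := H (rshift 1 i).
        by rewrite (col_mxEd v A' i j) /= addnA addn1 subnSK.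
      by have /forallP/(_ i) := H (lshift t (0 : 'I_1)); rewrite (col_mxEu v A' 0 i) /= addn0.
    apply/forallP => j; case: (split_ordP (i : 'I_(1 + t))) => i' ->.
      by rewrite (col_mxEu v A' i' j) ord1 /= addn0.
    by have /forallP/(_ j) := HA i'; rewrite (col_mxEd v A' i' j) /= addnA addn1 subnSK.
  by rewrite -!andbA; congr (_ && _); rewrite andbCA.
rewrite card_imset; last by move=> [v A] [v' A'] E; have [/= -> ->] := @eq_col_mx _ 1 t n v A v' A' E.
rewrite -sum1_card.
transitivity (\sum_(A in low_rows t) \sum_(v in Z :\: [set v | (v <= A)%MS]) 1)%N.
  rewrite (exchange_big_dep predT) //= pair_big_dep /=.
  by apply: eq_bigl => p; rewrite !inE /=.
rewrite mulnC -sum_nat_const; apply: eq_bigr => A; rewrite inE => /andP[fA /forallP HA].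
rewrite sum1_card cardsDS ?card_row_space ?card_row_zero //.
  by apply: leq_trans (st_le _) _; rewrite ?leq_subr // ltn_subrL /= (leq_ltn_trans _ tn).
apply/fintype.subsetP => v; rewrite !inE => /submxP[w ->].
apply/forallP => j; apply/implyP => js; rewrite mxE big1 // => i _.
have /forallP/(_ j)/implyP/(_ _)/eqP-> := HA i; rewrite ?mulr0 //.
apply: leq_trans js _; apply: st_mono; first by nlia.
by have := ltn_ord i; nlia.
Qed.

Lemma card_low_rows t : (t <= n)%N ->
  #|low_rows t| = (\prod_(i < t) (q ^ (n - st (n - i.+1)) - q ^ i))%N.
Proof.
elim: t => [|t IH] tn.
  rewrite big_ord0; apply/eqP/cards1P; exists 0; apply/setP => A.
  rewrite !inE [A]flatmx0 eqxx; apply/andP; split.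
    by apply/row_freeP; exists 0; apply/matrixP => -[].
  by apply/forallP => -[].
by rewrite (card_low_rowsS tn) (IH (ltnW tn)) big_ord_recr mulnC.
Qed.

End RowCount.

Section ParabolicCount.
Variables (F : finFieldType) (m : nat).
Local Notation GL := (GLn F m).
Local Notation q := #|F|.

Lemma card_Pblk_rows (blk st : nat -> nat) :
  (forall i j, (i <= j)%N -> (j < m.+1)%N -> (st i <= st j)%N) ->
  (forall i, (i < m.+1)%N -> (st i <= i)%N) ->
  (forall i j, (i < m.+1)%N -> (blk j < blk i)%N = (j < st i)%N) ->
  #|Pblk F m blk| = (\prod_(i < m.+1) (q ^ (m.+1 - st (m.+1 - i.+1)) - q ^ i))%N.
Proof.
move=> st_mono st_le blkE; rewrite -(card_low_rows F st_mono st_le (leqnn _)).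
have inj : injective (fun g : GL => GLval g) by exact: val_inj.
rewrite -(card_imset _ inj); apply: eq_card => A; rewrite inE.
apply/imsetP/andP => [[g /PblkP gP ->]|[fA /forallP HA]].
  split; first by rewrite row_free_unit; exact: (valP g).
  apply/forallP => i; apply/forallP => j; apply/implyP.
  by rewrite subnn add0n -blkE // => /gP->.
have uA : A \in unitmx by rewrite -row_free_unit.
exists (to_GL A); rewrite ?to_GLE //; apply/PblkP => i j; rewrite to_GLE // blkE // => ji.
by have /forallP/(_ j)/implyP/(_ _)/eqP-> := HA i; rewrite // subnn add0n.
Qed.

Lemma logn_card_Pblk l (blk st : nat -> nat) : prime l -> coprime l q ->
  (forall i j, (i <= j)%N -> (j < m.+1)%N -> (st i <= st j)%N) ->
  (forall i, (i < m.+1)%N -> (st i <= i)%N) ->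
  (forall i j, (i < m.+1)%N -> (blk j < blk i)%N = (j < st i)%N) ->
  logn l #|Pblk F m blk| = (\sum_(i < m.+1) logn l (q ^ (i - st i).+1 - 1))%N.
Proof.
move=> lp lq st_mono st_le blkE; rewrite (card_Pblk_rows st_mono st_le blkE).
have q1 : (1 < q)%N by exact: card_finRing_gt1.
have powE (i : 'I_m.+1) : (q ^ (m.+1 - st (m.+1 - i.+1)) - q ^ i =
    q ^ i * (q ^ (rev_ord i - st (rev_ord i)).+1 - 1))%N.
  rewrite mulnBr muln1 -expnD; congr (q ^ _ - _)%N; rewrite /=.
  have st_i : (st (m.+1 - i.+1) <= m.+1 - i.+1)%N by apply: st_le; nlia.
  by move: (st _) st_i (ltn_ord i) => X; nlia.
have pos j : (0 < q ^ j.+1 - 1)%N by rewrite subn_gt0 -{1}(expn0 q) ltn_exp2l.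
transitivity (\sum_(i < m.+1) logn l (q ^ (rev_ord i - st (rev_ord i)).+1 - 1))%N.
  under eq_bigr => i _ do rewrite powE.
  pose K x a := (0 < x)%N /\ logn l x = a.
  suff [] : K (\prod_(i < m.+1) (q ^ i * (q ^ (rev_ord i - st (rev_ord i)).+1 - 1)))%N
    (\sum_(i < m.+1) logn l (q ^ (rev_ord i - st (rev_ord i)).+1 - 1))%N by [].
  elim/big_ind2: _ => [|x a y b [x0 <-] [y0 <-]|i _]; first by rewrite /K logn1.
    by rewrite /K muln_gt0 x0 lognM.
  by rewrite /K muln_gt0 expn_gt0 (ltnW q1) pos logn_Gauss // coprimeXr.
by rewrite [RHS](reindex_inj rev_ord_inj).
Qed.

Lemma sum_reshape_offset (a : seq nat) (f : nat -> nat) :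
  (\sum_(i < sumn a) f (reshape_offset a i) = \sum_(x <- a) \sum_(j < x) f j)%N.
Proof.
elim: a => [|x s IH]; first by rewrite big_ord0 big_nil.
rewrite big_cons -IH /= big_split_ord /=; congr (_ + _)%N; apply: eq_bigr => j _.
  by rewrite reshape_offset_cons ltn_ord.
by rewrite reshape_offset_cons ltnNge leq_addr addKn.
Qed.

Lemma reshape_start_mono (a : seq nat) i j : (i <= j)%N -> (j < sumn a)%N ->
  (i - reshape_offset a i <= j - reshape_offset a j)%N.
Proof.
move=> ij ja; rewrite leqNgt -reshape_start ?(leq_ltn_trans ij) //.
apply/negP => lt; have := leq_trans lt (reshape_index_mono a ij).
by rewrite reshape_start // ltnn.
Qed.

Lemma reshape_offset_le (a : seq nat) i : (reshape_offset a i <= i)%N.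
Proof. exact: leq_subr. Qed.

Lemma logn_card_composition l a : prime l -> coprime l q -> sumn a = m.+1 ->
  logn l #|Pblk F m (reshape_index a)| = (\sum_(x <- a) Dval q l x)%N.
Proof.
move=> lp lq an; rewrite (@logn_card_Pblk l _ (fun i => i - reshape_offset a i)%N) //.
- rewrite -(sum_reshape_offset a (fun j => dval q l j.+1)) an; apply: eq_bigr => i _.
  by rewrite subKn // reshape_offset_le.
- by move=> i j ij; rewrite -an; exact: reshape_start_mono.
- by move=> i _; rewrite leq_subr.
- by move=> i j; rewrite -an; exact: reshape_start.
Qed.

Lemma card_comp_char a :
  #|[set: GL]| = (#|Pblk F m (reshape_index a)| * ind m (comp_char F a))%N.
Proof.
rewrite (@card_Pblk F m (reshape_index a)); last by move=> i j ij _; exact: reshape_index_mono.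
congr (_ * _)%N; apply: eq_bigl => s; apply: eq_forallb => k.
by rewrite comp_char_neq0.
Qed.

Lemma logn_ind_comp_char l a : prime l -> coprime l q -> sumn a = m.+1 ->
  logn l #|[set: GL]| = (\sum_(x <- a) Dval q l x + logn l (ind m (comp_char F a)))%N.
Proof.
move=> lp lq an; have c0 : (0 < #|[set: GL]|)%N by apply/card_gt0P; exists 1%g.
rewrite -(logn_card_composition lp lq an) (card_comp_char a) lognM //;
  by move: c0; rewrite (card_comp_char a) muln_gt0 => /andP[].
Qed.

End ParabolicCount.

Section CharParabolic.
Variables (F : finFieldType) (m : nat) (R : idomainType) (psi : F -> R).
Local Notation GL := (GLn F m).
Local Notation idx := 'I_m.+1.
Local Notation U := (Un F m).
Hypothesis psi0 : psi 0 = 1.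
Hypothesis psi_nontriv : exists a, psi a != 1.
Variables (lam : GL -> R) (y : nat -> F).
Hypothesis lamE : forall u, u \in U -> lam u = psi (pairing y u).

Lemma char_parabolicE (blk : nat -> nat) :
  (forall a b, (a <= b)%N -> (b <= m)%N -> (blk a <= blk b)%N) ->
  (forall k, (k < m)%N -> (y k != 0) = (blk k == blk k.+1)) ->
  char_parabolic (lam : {'GL_m.+1[F]} -> R) = Pblk F m blk :> {set GL}.
Proof.
move=> blk_mono blkE; apply: (Pblk_gen blk_mono (H := char_parabolic (lam : {'GL_m.+1[F]} -> R))).
- by apply: fintype.subset_trans (subset_gen _); exact: finset.subsetUl.
- move=> k km; move/eqP; rewrite -blkE // => yk.
  have k1 : (k < m.+1)%N by rewrite ltnS ltnW.
  have k2 : (k.+1 < m.+1)%N by [].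
  apply: mem_gen; apply/setUP; right; apply/imsetP.
  exists (inord k, inord k.+1) => //; rewrite inE /=; apply/andP; split.
    by apply/eqP; rewrite [LHS](inordK k2) (inordK k1).
  have [a pa] := psi_nontriv.
  have xU : xroot (inord k) (inord k.+1) ((y k)^-1 * a) \in U.
    by apply: xroot_U; rewrite (inordK k2) (inordK k1).
  apply/existsP; exists (xroot (inord k) (inord k.+1) ((y k)^-1 * a)).
  rewrite (lamE xU) pairing_xroot // mulVKf // pa andbT inE.
  apply/existsP; exists ((y k)^-1 * a); apply/eqP/matrixP => c d.
  rewrite xrootE ?(inordK k2) ?(inordK k1) // !mxE; congr (_ + _ * _).
rewrite gen_subG finset.subUset; apply/andP; split; first exact: borel_Pblk.
apply/fintype.subsetP => g /imsetP[[i j]].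
rewrite inE /= => /andP[/eqP ji /existsP[u /andP[ur lu]]] ->.
have im : (i < m)%N by have := ltn_ord j; rewrite ji ltnS.
have iE : i = inord i by rewrite inord_val.
have jE : j = inord i.+1 by rewrite -ji inord_val.
have ij : (i < j)%N by rewrite ji.
have [t uE] : exists t, u = xroot i j t.
  move: ur; rewrite inE => /existsP[t /eqP ut]; exists t; apply: GLP => c d.
  by rewrite ut xrootE // !mxE.
have yi : y i != 0.
  move: lu; rewrite lamE; last by rewrite uE; exact: xroot_U.
  rewrite uE iE jE pairing_xroot // inordK ?(ltnW im) //.
  by apply: contraNneq => ->; rewrite mul0r psi0.
have -> : perm_GL F (tperm i j) = pm F (refl m i) by rewrite /refl -iE -jE.
by apply: rPblk => //; apply/eqP; rewrite -blkE.
Qed.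

Lemma char_parabolic_index :
  #|'GL_m.+1[F] : char_parabolic (lam : {'GL_m.+1[F]} -> R)|%g = ind m y.
Proof.
pose blk k := (\sum_(i < k) (y i == 0%R))%N.
have blkS k : blk k.+1 = (blk k + (y k == 0%R))%N by rewrite /blk big_ord_recr.
have blk_mono a b : (a <= b)%N -> (b <= m)%N -> (blk a <= blk b)%N.
  move=> /subnKC <- _; elim: (b - a)%N => [|d IH]; first by rewrite addn0.
  by rewrite addnS blkS (leq_trans IH) // leq_addr.
have blkE k : (k < m)%N -> (y k != 0) = (blk k == blk k.+1).
  by move=> _; rewrite blkS -{1}[blk k]addn0 eqn_add2l; case: (y k == 0).
have PE := char_parabolicE blk_mono blkE.
rewrite -divgS ?finset.subsetT // [X in (_ %/ X)%N](_ : _ = #|Pblk F m blk|); last by rewrite -PE.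
rewrite [X in (X %/ _)%N](_ : _ = #|[set: GL]|) // (card_Pblk F blk_mono) mulKn.
  apply: eq_bigl => s; apply: eq_forallb => k; by rewrite blkE.
by apply/card_gt0P; exists 1%g; exact: (@group1 _ (Pblk_group F m blk)).
Qed.

Lemma char_parabolic_block (a : seq nat) : sumn a = m.+1 ->
  (forall k, (k < m)%N -> (y k != 0) = joined a k) ->
  char_parabolic (lam : {'GL_m.+1[F]} -> R) = block_parabolic F m.+1 a :> {set GL}.
Proof.
move=> an yE; rewrite (@char_parabolicE (reshape_index a)) //.
by move=> i j ij _; exact: reshape_index_mono.
Qed.

End CharParabolic.

Section LocalRing.
Variables (R : idomainType) (l : nat).
Hypothesis hloc : local_with_maximal_ideal (@lR_pred R l).

Lemma lR_proper : (1 : R) \notin lR_pred l.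
Proof.
have [_ H] := hloc (@lR_pred R l).
by have [[]] := H (fun=> erefl).
Qed.

(** Zorn's lemma puts any non-unit into a maximal ideal, which is lR. *)
Lemma local_unit (r : R) : r \notin lR_pred l -> r \is a GRing.unit.
Proof.
apply: contraNT => nu.
pose isI (A : set R) := [/\ A r, ~ A 1 & forall a u v, A u -> A v -> A (a * u + v)].
pose rR : set R := [set x | exists a, x = a * r]%classic.
have rRI : isI rR.
  split; first by exists 1; rewrite mul1r.
    by case=> a a1; case/negP: nu; apply/unitrPr; exists a; rewrite mulrC.
  by move=> a _ _ [b ->] [c ->]; exists (a * b + c); rewrite mulrDl mulrA.
have [F FP Ftot|A [AP Amax]] := @Zorn_bigcup R (fun A => A = set0 \/ isI A).
  have [Fne|Fe] := pselect (exists2 A, F A & isI A); last first.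
    left; rewrite -subset0 => x [A FA Ax]; case: (FP _ FA) => [A0|AI].
      by rewrite -A0.
    by case: Fe; exists A.
  have [A0 FA0 [A0r _ _]] := Fne.
  have FI A x : F A -> A x -> isI A.
    by move=> FA Ax; case: (FP _ FA) => // E; rewrite E in Ax.
  right; split; first by exists A0.
    by case=> A FA A1; have [_ /(_ A1)] := FI _ _ FA A1.
  move=> a u v [A FA Au] [A' FA' Av].
  have [AA'|A'A] := Ftot _ _ FA FA'.
    by exists A' => //; have [_ _ H] := FI _ _ FA' Av; apply: H => //; exact: AA'.
  by exists A => //; have [_ _ H] := FI _ _ FA Au; apply: H => //; exact: A'A.
have AI : isI A.
  case: AP => // A0; case: (Amax rR); last by right.
  rewrite A0; split; first exact: sub0set.
  by case: rRI => rr _ _ sub; exact: sub r rr.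
pose J : {pred R} := fun x => `[< A x >].
have JI : idealr_closed J.
  case: AI => Ar A1 Ac; split.
  - by apply/asboolP; rewrite -[0](subrr r) addrC -mulN1r; exact: Ac.
  - by apply/negP => /asboolP.
  - by move=> a u v /asboolP Au /asboolP Av; apply/asboolP; exact: Ac.
have /hloc <- : maximal_ideal J.
  split=> // J' [J0 J1 Jc] sub x.
  apply/idP/idP => [xJ'|/sub //]; apply: contraT => xJ.
  case: (Amax [set x | x \in J']%classic).
    split; first by move=> t At; apply: sub; apply/asboolP.
    by move=> /(_ x xJ') xA; case/negP: xJ; apply/asboolP.
  right; split; [by apply: sub; apply/asboolP; case: AI|by apply/negP|].
  by move=> a u v; exact: Jc.
by apply/asboolP; case: AI.
Qed.

Lemma natr_unit n : coprime l n -> n%:R \is a @GRing.unit R.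
Proof.
move=> ln; apply: local_unit; apply/negP => /asboolP[y yE].
case: (posnP l) => [l0|lpos].
  case/negP: lR_proper; apply/asboolP; exists 0.
  by move: ln yE; rewrite l0 /coprime gcd0n => /eqP-> E; rewrite -[1 in LHS]/(1%:R) E mul0r mulr0.
have [u v uv _] := egcdnP n lpos; move: ln; rewrite /coprime => /eqP ln.
have E : u%:R * l%:R = v%:R * n%:R + 1 :> R.
  by rewrite -!natrM uv ln natrD.
case/negP: lR_proper; apply/asboolP; exists (u%:R - v%:R * y).
by rewrite mulrBr [l%:R * u%:R]mulrC E mulrCA -yE addrC addKr.
Qed.

Lemma natr_pchar0 : [pchar R] =i pred0 -> forall n, (0 < n)%N -> n%:R != 0 :> R.
Proof.
move=> h n n0; apply/eqP => E.
by have [p] := natf0_pchar n0 (introT eqP E); rewrite h.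
Qed.

End LocalRing.

Section AdditiveCharacter.
Variables (F : finFieldType) (p : nat) (hp : p \in [pchar F]).

Lemma coprime_card_field l : prime l -> l != p -> coprime l #|F|.
Proof.
move=> lp ne; rewrite prime_coprime //; apply/negP => dv.
have [|x _ xo] := @Cauchy F l [set: F]%G lp; first by rewrite cardsT.
have xl : x *+ l = 0 by rewrite -FinRing.zmodXgE -xo expg_order.
have x0 : x != 0.
  apply/eqP => x0; move: xo; rewrite x0 (_ : 0 = 1%g :> F) // order1 => l1.
  by rewrite -l1 in lp.
move: xl; rewrite -mulr_natl => /eqP; rewrite mulf_eq0 (negPf x0) orbF.
rewrite -(dvdn_pcharf hp) dvdn_prime2 ?(pcharf_prime hp) // => /eqP E.
by rewrite E eqxx in ne.
Qed.

Lemma inv_mod n : coprime p n -> exists u v, (u * n = v * p + 1)%N.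
Proof.
have p1 := prime_gt1 (pcharf_prime hp).
case: (posnP n) => [->|n0 /eqP cop]; first by rewrite /coprime gcdn0 => /eqP E; rewrite E in p1.
by have [u v uv _] := egcdnP p n0; exists u, v; rewrite uv gcdnC cop.
Qed.

(** A maximal additive subset H without 1 is a complement of the prime field. *)
Lemma exists_psi (R : idomainType) (z : R) : p.-primitive_root z ->
  exists psi : F -> R, [/\ psi 0 = 1, forall a b, psi (a + b) = psi a * psi b
    & exists a, psi a != 1].
Proof.
move=> zp; have pp := pcharf_prime hp; have p0 := prime_gt0 pp.
pose good (H : {set F}) := [&& 0 \in H, 1 \notin H &
  [forall a in H, forall b in H, a + b \in H]].
have good0 : good [set 0].
  rewrite /good !inE eqxx oner_eq0 /=; apply/forall_inP => a; rewrite inE => /eqP->.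
  by apply/forall_inP => b; rewrite inE => /eqP->; rewrite addr0 inE.
have [H /maxsetP[/and3P[H0 H1 /forall_inP HD] Hmax] _] := maxset_exists good0.
have {}HD a b : a \in H -> b \in H -> a + b \in H by move=> /HD/forall_inP; apply.
have HM a n : a \in H -> a *+ n \in H.
  by move=> aH; elim: n => [|n IH]; rewrite ?mulr0n // mulrS HD.
have HN a : a \in H -> - a \in H.
  move=> aH; rewrite (_ : - a = a *+ p.-1) ?HM //; apply/eqP.
  by rewrite eq_sym -addr_eq0 -mulrSr prednK // mulrn_pchar.
have natmod n : n%:R = (n %% p)%:R :> F.
  by rewrite {1}(divn_eq n p) natrD natrM (pcharf0 hp) mulr0 add0r.
have natH n : (n%:R \in H) = (p %| n)%N.
  apply/idP/idP => [nH|]; last by rewrite (dvdn_pcharf hp) => /eqP->.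
  apply: contraT => pn; have cop : coprime p n by rewrite prime_coprime.
  have [u [v uv]] := inv_mod cop.
  case/negP: H1; have := HM _ u nH; rewrite -mulrnA mulnC uv natrD natrM (pcharf0 hp) mulr0 add0r.
  by [].
have ex a : exists k : 'I_p, a - k%:R \in H.
  have [aH|aH] := boolP (a \in H).
    by exists (Ordinal p0); rewrite subr0.
  pose H' := [set x : F | [exists j : 'I_p, x - a *+ j \in H]].
  have amod n : a *+ n = a *+ (n %% p) by rewrite -mulr_natl natmod mulr_natl.
  have sub : H \subset H'.
    apply/fintype.subsetP => x xH; rewrite inE; apply/existsP.
    by exists (Ordinal p0); rewrite mulr0n subr0.
  have aH' : a \in H'.
    rewrite inE; apply/existsP; exists (Ordinal (prime_gt1 pp)).
    by rewrite mulr1n subrr.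
  have : 1 \in H'.
    apply: contraT => n1; case/negP: aH; rewrite -(Hmax H') //.
    apply/and3P; split=> //; first exact: (fintype.subsetP sub).
    apply/forall_inP => x; rewrite inE => /existsP[j xj].
    apply/forall_inP => y; rewrite inE => /existsP[j' yj]; rewrite inE; apply/existsP.
    exists (Ordinal (ltn_pmod (j + j') p0)).
    by rewrite /= -amod mulrnDr opprD addrACA HD.
  rewrite inE => /existsP[j jH].
  have cop : coprime p j.
    rewrite prime_coprime //; apply: contra H1 => /dvdnP[k jE].
    by move: jH; rewrite amod jE modnMl mulr0n subr0.
  have [u [v uv]] := inv_mod cop.
  exists (Ordinal (ltn_pmod u p0)); rewrite /= -natmod.
  have := HN _ (HM _ u jH); rewrite mulrnBl opprB -mulrnA mulnC uv.
  by rewrite amod modnMDl (modn_small (prime_gt1 pp)) mulr1n.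
have uniq a (k j : nat) : a - k%:R \in H -> a - j%:R \in H -> (k = j %[mod p])%N.
  wlog jk : j k / (j <= k)%N.
    by move=> W; case/orP: (leq_total j k) => [/W//|/W H' kH jH]; rewrite H'.
  move=> kH jH; apply/eqP; rewrite eqn_mod_dvd // -natH natrB //.
  have := HD _ _ jH (HN _ kH).
  by rewrite opprB addrC addrA subrK.
pose h a : nat := xchoose (ex a).
have hP a : a - (h a)%:R \in H by exact: (xchooseP (ex a)).
have zmod (k j : nat) : (k = j %[mod p])%N -> z ^+ k = z ^+ j.
  by move=> kj; rewrite -(prim_expr_mod zp k) kj prim_expr_mod.
exists (fun a => z ^+ h a); split.
- rewrite -(expr0 z); apply: zmod; apply: (uniq 0) => //.
  by rewrite subr0.
- move=> a b; rewrite -exprD; apply: zmod; apply: (uniq (a + b)) => //.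
  by rewrite natrD opprD addrACA HD.
exists 1; rewrite (zmod _ 1%N); last by apply: (uniq 1); rewrite // subrr.
by rewrite -(prim_order_dvd zp) gtnNdvd // prime_gt1.
Qed.

End AdditiveCharacter.

Opaque GLn.
Section Duality.
Variables (F : finFieldType) (m : nat) (R : idomainType) (psi : F -> R).
Local Notation GL := (GLn F m).
Local Notation idx := 'I_m.+1.
Local Notation U := (Un F m).
Local Notation B := (Bn F m).
Local Notation RG := (gralg R GL).
Local Notation eps := (@eps F m R).
Local Notation Ey := (Ey m psi).
Local Notation hatU := (hatU m psi).
Local Notation dotg := (@dotg F m.+1 R).
Local Notation gr_adj := (@gr_adj F m.+1 R).
Hypothesis psi0 : psi 0 = 1.
Hypothesis psiD : forall a a', psi (a + a') = psi a * psi a'.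
Hypothesis natR : forall n, (0 < n)%N -> n%:R != 0 :> R.
Hypothesis psi_nontriv : exists a, psi a != 1.
Implicit Types (y : nat -> F) (x z : RG).

Definition oppy y (k : nat) := - y k.

Lemma ind_oppy y : ind m (oppy y) = ind m y.
Proof.
by apply: eq_bigl => s; apply: eq_forallb => k; rewrite /oppy oppr_eq0.
Qed.

Lemma chr_oppy y (u : GL) : chr psi (oppy y) u = psi (- pairing y u).
Proof. by rewrite /chr pairingN. Qed.

Lemma gr_adjD x z : gr_adj (x + z) = gr_adj x + gr_adj z.
Proof. by apply/ffunP => g; rewrite !ffunE. Qed.

Lemma gr_adjZ (r : R) x : gr_adj (r *: x) = r *: gr_adj x.
Proof. by apply/ffunP => g; rewrite !ffunE. Qed.

Lemma gr_adj0 : gr_adj 0 = 0.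
Proof. by apply/ffunP => g; rewrite !ffunE. Qed.

Lemma gr_adj_hatU y : gr_adj (hatU y) = hatU (oppy y).
Proof.
rewrite /hatU (big_morph _ gr_adjD gr_adj0) [RHS](reindex_inj invg_inj) /=.
rewrite [RHS](eq_bigl (fun u => u \in U)); last by move=> u; rewrite -[Un F m]/(gval (unitri_group F m)) groupV.
by apply: eq_bigr => u uU; rewrite gr_adjZ gr_adj_gr chr_oppy pairingV // opprK.
Qed.

Lemma dotg_hatU y x z : dotg (hatU y * x) z = dotg x (hatU (oppy y) * z).
Proof. by rewrite dotg_adj gr_adj_hatU. Qed.

Lemma Ey_torus y y' : (forall k, (k < m)%N -> (y k == 0) = (y' k == 0)) ->
  exists g : GL, gr R g * Ey y = Ey y'.
Proof.
move=> yy'; have [d d0 dE] := torus_char yy'.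
have UdE : (U :^ dgm d)%g = U.
  apply/eqP; rewrite eqEcard cardJg leqnn andbT; apply/fintype.subsetP => _ /imsetP[u uU ->].
  exact: dgm_conj_U.
exists (dgm d).
have EyE y0 : Ey y0 = \sum_(u in U) chr psi y0 u *: (gr R u * eps).
  by rewrite /Ey /hatU mulr_suml; apply: eq_bigr => u _; rewrite gsMl.
rewrite !EyE mulr_sumr.
rewrite (reindex_inj (conjg_inj (dgm d))) /=.
rewrite (eq_bigl (fun u => u \in U)); last by move=> u; rewrite -{1}UdE memJ_conjg.
apply: eq_bigr => u uU; rewrite gsMr /chr dE; congr (_ *: _).
by rewrite -[in RHS](dgm_eps R d0) !mulrA -!grM conjgE mulKVg.
Qed.

Lemma Ey_inj y (r s : R) : r *: Ey y = s *: Ey y -> r = s.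
Proof.
move=> /ffunP/(_ (pm F (w0 m))); rewrite !gsE Ey_w0 //.
by apply: mulIf; rewrite signr_eq0.
Qed.

(** The form on I is a perfect substitute for the pairing between eigenvectors:
    an element a of the group ring moves Ey y with a unit coefficient towards
    Ey y' exactly if its adjoint moves the opposite vectors back. *)
Lemma dotg_Ey_oppy y y' (a : RG) : exists r : R,
  dotg (a * Ey y) (Ey (oppy y')) = r * (#|B| * ind m y)%:R /\
  hatU (oppy y) * (gr_adj a * Ey (oppy y')) = r *: Ey (oppy y).
Proof.
have [r rE] : exists r, hatU (oppy y) * (gr_adj a * Ey (oppy y')) = r *: Ey (oppy y).
  by apply: (hatU_line psiD); rewrite /Ey !mulrA; exact: Uspan_ideal.
exists r; split=> //.
rewrite dotg_adj dotg_hatU rE dotgC dotgZl (dotg_Ey_eps _ psi0 psiD psi_nontriv).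
by rewrite ind_oppy.
Qed.

Lemma dotg_Ey_self y :
  dotg (Ey y) (Ey (oppy y)) = #|U|%:R * (#|B| * ind m y)%:R.
Proof.
rewrite {1}/Ey dotg_hatU (hatU_Ey _ psi0 psiD) dotgC dotgZl.
by rewrite (dotg_Ey_eps _ psi0 psiD psi_nontriv) ind_oppy.
Qed.

End Duality.
Transparent GLn.

Section LayerClass.
Variables (R : comPzRingType) (l : nat) (gT : finGroupType).
Variables (V : lmodType (gralg R gT)) (N N' : submod V).
Local Notation M := (subquo (red_image l N) (red_image l N')).

Lemma mem_red_image (W : submod V) x : reflect (exists2 x', x' \in W & exists z, x = x' + z *+ l)
  (red_pi l x \in red_image l W).
Proof.
apply: (iffP (asboolP _)) => [[x' [y [xW /asboolP[z ->] /red_piP[w E]]]]|[x' xW [z E]]].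
  exists x' => //; exists (z + w); rewrite mulrnDl addrA -E addrC subrK //.
exists x', (z *+ l); split=> //; last by rewrite E.
by apply/asboolP; exists z.
Qed.

(** The class in (N + lV) / (N' + lV) of an element of N, and a junk value
    elsewhere. *)
Definition lay (x : V) : M := qmod_pi _ (insubd (0 : submod_of (red_image l N)) (red_pi l x)).

Lemma lay_val x : x \in N ->
  submod_val (insubd (0 : submod_of (red_image l N)) (red_pi l x)) = red_pi l x.
Proof.
move=> xN; rewrite -[submod_val _]/(val _) insubdK //.
by apply/mem_red_image; exists x => //; exists 0; rewrite mul0rn addr0.
Qed.

Lemma lay_eq (w : submod_of (red_image l N)) x : x \in N -> submod_val w = red_pi l x ->
  qmod_pi _ w = lay x.
Proof. by move=> xN wx; congr qmod_pi; apply: val_inj; rewrite /= lay_val. Qed.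

Lemma lay_surj (u : M) : exists2 x, x \in N & u = lay x.
Proof.
have [w ->] : exists w, u = qmod_pi _ w.
  by eexists; exact: (esym (qmod_reprK u)).
have : red_pi l (red_repr (submod_val w)) \in red_image l N.
  by rewrite red_reprK; exact: submod_valP.
case/mem_red_image => x xN [z E]; exists x => //; apply: lay_eq => //.
rewrite -[LHS]red_reprK E; apply/red_piP; exists z.
by rewrite addrC addKr.
Qed.

Lemma lay_eq0 x : x \in N -> (lay x = 0) <-> (exists2 x', x' \in N' & exists z, x = x' + z *+ l).
Proof.
move=> xN.
have -> : 0 = qmod_pi (Submod (restr_closed (red_image l N) (red_image l N'))) 0.
  by apply/esym; exact: (raddf0 (\pi_(Quotient.quot _)%qT)).
transitivity (red_pi l x \in red_image l N'); last first.
  by split=> /mem_red_image.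
rewrite qmod_piE subr0 -[_ \in Submod _]/(submod_val _ \in _) lay_val //.
Qed.

Lemma layZ (a : gralg R gT) x : x \in N -> lay (a *: x) = red_coef l a *: lay x.
Proof.
move=> xN; apply/esym; rewrite -[LHS]qmod_piZ; apply: lay_eq; first by rewrite rpredZ.
by rewrite -[LHS]/(red_coef l a *: submod_val _) lay_val // [RHS]red_piZ.
Qed.

Lemma layB x y : x \in N -> y \in N -> lay (x - y) = lay x - lay y.
Proof.
move=> xN yN; have E : lay (x - y) + lay y = lay x.
  rewrite -[LHS]qmod_piD; apply: lay_eq => //.
  rewrite -[LHS]/(submod_val _ + submod_val _) !lay_val ?rpredB //.
  by rewrite -red_piD subrK.
by rewrite -E addrK.
Qed.

Lemma lay_inj x y : x \in N -> y \in N -> lay x = lay y ->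
  exists2 x', x' \in N' & exists z, x = y + x' + z *+ l.
Proof.
move=> xN yN /eqP; rewrite -subr_eq0 -layB // => /eqP/lay_eq0.
case=> [|x' xN' [z E]]; first by rewrite rpredB.
by exists x' => //; exists z; rewrite -addrA -E addrC subrK.
Qed.

End LayerClass.

Section Scalars.
Variables (S : comPzRingType) (gT : finGroupType).

Definition gconst (s : S) : gralg S gT := s *: (1 : gralg S gT).

Lemma gconst_zmod : zmod_morphism gconst.
Proof. by move=> s t; rewrite /gconst scalerBl. Qed.

Lemma gconst_monoid : monoid_morphism gconst.
Proof.
split=> [|s t]; first by rewrite /gconst scale1r.
by rewrite /gconst gsMl mul1r scalerA.
Qed.

HB.instance Definition _ := GRing.isZmodMorphism.Build S (gralg S gT) gconst gconst_zmod.
HB.instance Definition _ := GRing.isMonoidMorphism.Build S (gralg S gT) gconst gconst_monoid.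

Lemma gconstM s (x : gralg S gT) : gconst s * x = s *: x.
Proof. by rewrite /gconst gsMl mul1r. Qed.

Lemma gconstC s (x : gralg S gT) : x * gconst s = gconst s * x.
Proof.
by rewrite gconstM /gconst gsMr_comm ?mulr1 // => b; rewrite mulrC.
Qed.

End Scalars.

Section RedCoef.
Variables (R : comPzRingType) (l : nat) (gT : finGroupType).

Lemma red_coef_gr (g : gT) : red_coef l (gr R g) = gr (residue R l) g.
Proof.
apply/ffunP => h; rewrite !ffunE; case: (h == g) => //; exact: res_pi0.
Qed.

Lemma red_coefZ (r : R) (x : gralg R gT) : red_coef l (r *: x) = res_pi l r *: red_coef l x.
Proof. by apply/ffunP => h; rewrite !ffunE res_piM. Qed.

Lemma red_coef_sum (J : finType) (P : pred J) (f : J -> gralg R gT) :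
  red_coef l (\sum_(j | P j) f j) = \sum_(j | P j) red_coef l (f j).
Proof.
apply: (big_morph _ (@red_coefD R l gT)).
by apply/ffunP => h; rewrite !ffunE res_pi0.
Qed.

End RedCoef.

Section SteinbergLattice.
Variables (F : finFieldType) (m : nat) (R : idomainType) (l : nat) (psi : F -> R).
Local Notation GL := (GLn F m).
Local Notation U := (Un F m).
Local Notation B := (Bn F m).
Local Notation RG := (gralg R GL).
Local Notation eps := (@eps F m R).
Local Notation Ey := (Ey m psi).
Local Notation hatU := (hatU m psi).
Local Notation dotg := (@dotg F m.+1 R).
Local Notation I := (st_lattice F m.+1 R).
Implicit Types (y : nat -> F) (X Y Z : I) (a : RG).

Definition iv X : RG := submod_val X.

Lemma iv_inj X Y : iv X = iv Y -> X = Y.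
Proof. by move=> E; apply: val_inj; exact: E. Qed.

Lemma ivZ a X : iv ((a : gralg R {'GL_m.+1[F]}) *: X) = a * iv X. Proof. by []. Qed.

Lemma ivD X Y : iv (X + Y) = iv X + iv Y. Proof. by []. Qed.

Lemma iv_sum (J : finType) (P : pred J) (f : J -> I) :
  iv (\sum_(j | P j) f j) = \sum_(j | P j) iv (f j).
Proof. exact: (big_morph iv ivD). Qed.

Lemma ivMn X n : iv (X *+ n) = iv X *+ n.
Proof. by elim: n => [|n IH]; rewrite ?mulr0n // !mulrS ivD IH. Qed.

Lemma iv_eps : iv (st_eps F m.+1 R) = eps. Proof. by []. Qed.

Lemma Uspan_iv X : Uspan (iv X).
Proof.
have /asboolP[a xE] := submod_valP X.
by rewrite /iv xE; exact: Uspan_ideal.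
Qed.

Lemma iv_E_elt (lam : GL -> R) y : (forall u, u \in U -> lam u = chr psi y u) ->
  iv (E_elt (lam : {'GL_m.+1[F]} -> R)) = Ey y.
Proof.
move=> lamE; rewrite /E_elt iv_sum /Ey /hatU mulr_suml.
apply: eq_bigr => u uU; rewrite ivZ iv_eps.
by have -> : lam u = chr psi y u by exact: lamE.
Qed.

Definition iE y : I := E_elt (chr psi y : {'GL_m.+1[F]} -> R).

Lemma iv_iE y : iv (iE y) = Ey y. Proof. exact: iv_E_elt. Qed.

End SteinbergLattice.

Section Valuation.
Variables (R : idomainType) (l : nat).
Hypothesis lp : prime l.
Hypothesis hloc : local_with_maximal_ideal (@lR_pred R l).
Hypothesis natR : forall n, (0 < n)%N -> n%:R != 0 :> R.

Lemma natr_logn n : (0 < n)%N ->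
  exists2 k : R, k \is a GRing.unit & n%:R = l%:R ^+ logn l n * k.
Proof.
move=> n0; have [k lk nE] := pfactor_coprime lp n0.
by exists k%:R; [exact: (natr_unit hloc)|rewrite {1}nE natrM natrX mulrC].
Qed.

Lemma powl_neq0 d : l%:R ^+ d != 0 :> R.
Proof. by rewrite expf_neq0 // natR // prime_gt0. Qed.

Lemma mem_lR_mul (r s : R) : r \in lR_pred l -> r * s \in lR_pred l.
Proof. by case/asboolP=> t ->; apply/asboolP; exists (t * s); rewrite mulrA. Qed.

Lemma unit_notin_lR (r : R) : r \is a GRing.unit -> r \notin lR_pred l.
Proof.
move=> ru; apply/negP => /(mem_lR_mul (r^-1)); rewrite divrr //.
exact/negP/(lR_proper hloc).
Qed.

Lemma mem_lR_coef (r s : R) n c : (0 < n)%N -> (logn l n < c)%N ->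
  r * n%:R = l%:R ^+ c * s -> r \in lR_pred l.
Proof.
move=> n0 nc; have [k ku ->] := natr_logn n0.
rewrite -(subnKC nc) addSn exprS exprD mulrCA -!mulrA [l%:R * _]mulrCA.
move=> /(mulfI (powl_neq0 _)) E; apply/asboolP.
exists (l%:R ^+ (c - (logn l n).+1) * s * k^-1).
by rewrite !mulrA -[X in X * k^-1]mulrA -E mulrK.
Qed.

End Valuation.

Section Layers.
Variables (F : finFieldType) (m : nat) (R : idomainType) (l : nat) (psi : F -> R) (c : nat).
Local Notation GL := (GLn F m).
Local Notation U := (Un F m).
Local Notation B := (Bn F m).
Local Notation RG := (gralg R GL).
Local Notation K := (residue R l).
Local Notation eps := (@eps F m R).
Local Notation Ey := (Ey m psi).
Local Notation hatU := (hatU m psi).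
Local Notation dotg := (@dotg F m.+1 R).
Local Notation I := (st_lattice F m.+1 R).
Local Notation iE := (iE m psi).
Local Notation iv := (@iv F m R).
Local Notation filt := (st_filt F m.+1 R l).
Local Notation M := (layer F m.+1 R l c).
Local Notation ind := (ind m).
Hypothesis lp : prime l.
Hypothesis lq : coprime l #|F|.
Hypothesis hloc : local_with_maximal_ideal (@lR_pred R l).
Hypothesis natR : forall n, (0 < n)%N -> n%:R != 0 :> R.
Hypothesis psi0 : psi 0 = 1.
Hypothesis psiD : forall a a', psi (a + a') = psi a * psi a'.
Hypothesis psi_nontriv : exists a, psi a != 1.
Implicit Types (y : nat -> F) (X Y Z : I) (a : RG) (x : M).

Lemma ind_gt0 y : (0 < ind y)%N.
Proof.
rewrite -(char_parabolic_index psi0 psi_nontriv (fun u _ => erefl : chr psi y u = _)).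
exact: indexg_gt0.
Qed.

Lemma card_B_neq0 : #|B|%:R != 0 :> R.
Proof. by rewrite natR //; apply/card_gt0P; exists 1%g; exact: (@group1 _ (borel_group F m)). Qed.

Lemma mem_filtP d X :
  X \in filt d <-> forall Y, exists r, dotg (iv X) (iv Y) = #|B|%:R * (l%:R ^+ d * r).
Proof.
have B0 := card_B_neq0.
have BF0 : tofrac (#|B|%:R : R) != 0 by rewrite tofrac_eq0.
have key Y r : st_form X Y = tofrac (l%:R ^+ d * r) <->
    dotg (iv X) (iv Y) = #|B|%:R * (l%:R ^+ d * r).
  rewrite /st_form (_ : #|borel F m.+1|%:R = tofrac (#|B|%:R : R)); last first.
    by rewrite tofracMn tofrac1.
  split=> [E|E].
    apply/eqP; rewrite -tofrac_eq; apply/eqP.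
    rewrite [LHS](_ : _ = tofrac (dotg (iv X) (iv Y)) / tofrac #|B|%:R * tofrac #|B|%:R).
      by rewrite E -tofracM mulrC.
    by rewrite divfK.
  rewrite (_ : dotg _ _ = #|B|%:R * (l%:R ^+ d * r)) //.
  by rewrite tofracM mulrAC divff // mul1r.
split=> [/asboolP H Y|H]; last apply/asboolP => Y.
  by have [r rE] := H Y; exists r; apply/key.
by have [r rE] := H Y; exists r; apply/key.
Qed.

Local Notation nu y := (logn l (ind y)).
Local Notation lay := (@lay R l _ I (filt c) (filt c.+1)).

Definition sc (r : R) X : I := gconst {'GL_m.+1[F]} r *: X.

Lemma iv_sc r X : iv (sc r X) = r *: iv X.
Proof. by rewrite /sc ivZ [LHS]gconstM. Qed.

Lemma iE_filt d y : (d <= nu y)%N -> iE y \in filt d.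
Proof.
move=> dn; apply/mem_filtP => Y; rewrite iv_iE.
have [r ->] := dotg_Ey psiD y (Uspan_iv Y).
have [k _ E] := natr_logn lp hloc (ind_gt0 y).
rewrite (dotg_Ey_eps _ psi0 psiD psi_nontriv) natrM E -(subnKC dn) exprD.
exists (r * (l%:R ^+ (nu y - d) * k)).
by rewrite mulrCA; congr (_ * _); rewrite -mulrA mulrCA.
Qed.

Lemma filt_coef d y r : (nu y < d)%N -> sc r (iE y) \in filt d -> r \in lR_pred l.
Proof.
move=> nd /mem_filtP/(_ (st_eps F m.+1 R))[s].
rewrite iv_sc iv_iE iv_eps dotgZl (dotg_Ey_eps _ psi0 psiD psi_nontriv) natrM mulrCA.
by move/(mulfI card_B_neq0); exact: (mem_lR_coef lp hloc natR (ind_gt0 y) nd).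
Qed.

Lemma hatU_iE y X : exists r, (hatU y : gralg R {'GL_m.+1[F]}) *: X = sc r (iE y).
Proof.
have [r rE] := hatU_line psiD y (Uspan_iv X).
by exists r; apply: iv_inj; rewrite ivZ iv_sc iv_iE.
Qed.

Lemma sc_lR y r : r \in lR_pred l -> exists Z, sc r (iE y) = Z *+ l.
Proof.
case/asboolP=> s ->; exists (sc s (iE y)); apply: iv_inj.
by rewrite ivMn !iv_sc mulr_natl -scalerMnl.
Qed.

Lemma lay_sc_lR y r : sc r (iE y) \in filt c -> r \in lR_pred l -> lay (sc r (iE y)) = 0.
Proof.
move=> rf rl; have [Z ZE] := sc_lR y rl; apply/lay_eq0 => //.
by exists 0; [exact: rpred0|exists Z; rewrite add0r].
Qed.

Lemma card_U_unit : #|U|%:R \is a @GRing.unit R.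
Proof.
by apply: (natr_unit hloc); rewrite -Upat1 card_Upat coprimeXr.
Qed.

Definition hw y : gralg K {'GL_m.+1[F]} := @red_coef R l {'GL_m.+1[F]} (hatU y).
Definition vw y : M := lay (iE y).

Lemma vw_neq0 y : nu y = c -> vw y <> 0.
Proof.
move=> yc; have yf : iE y \in filt c by apply: iE_filt; rewrite yc.
move/lay_eq0 => /(_ yf)[X Xf [Z E]].
have [r rE] := hatU_iE y X; have [s sE] := hatU_iE y Z.
have rl : r \in lR_pred l.
  by apply: (@filt_coef c.+1 y); rewrite ?yc // -rE rpredZ.
have : #|U|%:R = r + l%:R * s.
  apply: (Ey_inj psi0 psiD psi_nontriv (y := y)).
  transitivity (hatU y * Ey y); first by rewrite (hatU_Ey _ psi0 psiD).
  rewrite -[in LHS]iv_iE [in LHS]E ivD ivMn mulrDr.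
  have -> : hatU y * iv X = r *: iv (iE y) by rewrite -iv_sc -rE.
  have hZ : hatU y * iv Z = s *: iv (iE y) by rewrite -iv_sc -sE.
  by rewrite mulrnAr hZ !iv_iE scalerDl mulr_natl scalerMnl.
case/asboolP: rl => t -> E'.
have := unit_notin_lR hloc card_U_unit; rewrite E' -mulrDr.
by case/negP; apply/asboolP; exists (t + s).
Qed.

Lemma layer_projE y x : hw y *: x != 0 ->
  [/\ nu y = c, exists b, vw y = b *: x & exists b, hw y *: x = b *: vw y].
Proof.
have [X Xf ->] := lay_surj x => hx.
have [r rE] := hatU_iE y X.
have rf : sc r (iE y) \in filt c by rewrite -rE rpredZ.
have hE : hw y *: lay X = lay (sc r (iE y)) by rewrite -rE layZ.
have rl : r \notin lR_pred l.
  by apply: contraNN hx => rl; rewrite hE lay_sc_lR.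
have yc : nu y = c.
  case: (ltngtP (nu y) c) => // lt.
    by case/negP: rl; exact: filt_coef lt rf.
  case/eqP: hx; rewrite hE; apply/lay_eq0 => //.
  exists (sc r (iE y)); first by rewrite rpredZ // iE_filt.
  by exists 0; rewrite mul0rn addr0.
have yf : iE y \in filt c by apply: iE_filt; rewrite yc.
have ru := local_unit hloc rl.
split=> //; last first.
  by exists (red_coef l (gconst {'GL_m.+1[F]} r)); rewrite hE /vw -layZ.
exists (@red_coef R l {'GL_m.+1[F]} (r^-1 *: hatU y)).
rewrite -layZ //; congr lay; apply: iv_inj; rewrite ivZ gsMl -ivZ rE iv_sc scalerA.
by rewrite mulVr // scale1r.
Qed.

Lemma layer_proj_v y : nu y = c -> hw y *: vw y != 0.
Proof.
move=> yc; have yf : iE y \in filt c by apply: iE_filt; rewrite yc.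
apply/eqP; rewrite -layZ // => E; apply: (vw_neq0 yc).
have -> : vw y = red_coef l (gconst {'GL_m.+1[F]} (#|U|%:R^-1 : R)) *: lay ((hatU y : gralg R {'GL_m.+1[F]}) *: iE y).
  rewrite -layZ ?rpredZ //; congr lay; apply: iv_inj.
  rewrite !ivZ [RHS]gconstM iv_iE (hatU_Ey _ psi0 psiD) scalerA mulVr ?scale1r //.
  exact: card_U_unit.
by rewrite E scaler0.
Qed.

End Layers.

Section LayerHypotheses.
Variables (F : finFieldType) (m : nat) (R : idomainType) (l : nat) (psi : F -> R) (c : nat).
Local Notation GL := (GLn F m).
Local Notation U := (Un F m).
Local Notation B := (Bn F m).
Local Notation RG := (gralg R GL).
Local Notation K := (residue R l).
Local Notation eps := (@eps F m R).
Local Notation Ey := (Ey m psi).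
Local Notation hatU := (hatU m psi).
Local Notation dotg := (@dotg F m.+1 R).
Local Notation I := (st_lattice F m.+1 R).
Local Notation iE := (iE m psi).
Local Notation iv := (@iv F m R).
Local Notation filt := (st_filt F m.+1 R l).
Local Notation M := (layer F m.+1 R l c).
Local Notation ind := (ind m).
Hypothesis lp : prime l.
Hypothesis lq : coprime l #|F|.
Hypothesis hloc : local_with_maximal_ideal (@lR_pred R l).
Hypothesis natR : forall n, (0 < n)%N -> n%:R != 0 :> R.
Hypothesis psi0 : psi 0 = 1.
Hypothesis psiD : forall a a', psi (a + a') = psi a * psi a'.
Hypothesis psi_nontriv : exists a, psi a != 1.
Implicit Types (y : nat -> F) (X Y Z : I) (a : RG) (x : M).


Local Notation nu y := (logn l (ind y)).
Local Notation lay := (@lay R l _ I (filt c) (filt c.+1)).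
Local Notation vw := (@vw F m R l psi c).
Local Notation hw := (@hw F m R l psi).

Lemma vw_move y y' a : nu y = c -> Ey y' = a * Ey y ->
  exists b, vw y' = b *: vw y.
Proof.
move=> yc E; have yf : iE y \in filt c by apply: iE_filt; rewrite ?yc.
exists (@red_coef R l {'GL_m.+1[F]} a); rewrite /vw -layZ //; congr lay.
by apply: iv_inj; rewrite ivZ !iv_iE.
Qed.

Lemma vw_torus y y' : nu y = c -> (forall k, (k < m)%N -> (y k == 0) = (y' k == 0)) ->
  exists b, vw y' = b *: vw y.
Proof.
by move=> yc /(Ey_torus psi)[g E]; apply: (vw_move (a := gr R g) yc); rewrite E.
Qed.

Lemma layer_sym y y' : nu y = c -> nu y' = c ->
  (exists b, vw y' = b *: vw y) -> exists b, vw y = b *: vw y'.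
Proof.
move=> yc yc' [b].
have yf : iE y \in filt c by apply: iE_filt; rewrite ?yc.
have yf' : iE y' \in filt c by apply: iE_filt; rewrite ?yc'.
have oppf : iE (oppy y') \in filt c by apply: iE_filt; rewrite ?ind_oppy ?yc'.
have af : red_lift b *: iE y \in filt c by exact: (@rpredZ _ _ (filt c) _ _ yf).
rewrite -[b]red_liftK /vw -layZ // => /(lay_inj yf' af)[X /(mem_filtP _ natR) Xf [Z E]].
have [a E'] : exists a, Ey y' = a * Ey y + iv X + iv Z *+ l.
  by exists (red_lift b); rewrite -!iv_iE E !ivD ivMn ivZ.
have [r [r1 r2]] := dotg_Ey_oppy psi0 psiD psi_nontriv y y' a.
have [s sE] := Xf (iE (oppy y')).
have /(mem_filtP _ natR)/(_ Z)[t tE] := oppf.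
have key : #|U|%:R * (ind y')%:R = r * (ind y)%:R + l%:R ^+ c.+1 * (s + t).
  apply: (mulfI (card_B_neq0 F m natR)).
  rewrite mulrCA -natrM -(dotg_Ey_self m psi0 psiD psi_nontriv).
  rewrite {1}E' !dotgDl r1 -iv_iE sE.
  have -> : dotg (iv Z *+ l) (iv (iE (oppy y'))) = l%:R * dotg (iv (iE (oppy y'))) (iv Z).
    by rewrite -scaler_nat dotgZl dotgC.
  rewrite tE natrM [l%:R * _]mulrCA [l%:R * (_ * _)]mulrA -exprS [r * (_ * _)]mulrCA.
  by rewrite -!mulrDr -addrA -mulrDr.
have rl : r \notin lR_pred l.
  apply/negP => /asboolP[r' rE].
  have [k _ kE] := natr_logn lp hloc (ind_gt0 m psi0 psi_nontriv y).
  have keyr : #|U|%:R * (ind y')%:R = l%:R ^+ c.+1 * (r' * k + (s + t)).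
    rewrite key rE kE yc [RHS]mulrDr; congr (_ + _).
    by rewrite exprS -!mulrA; congr (_ * _); rewrite mulrCA.
  have nc : (nu y' < c.+1)%N by rewrite yc'.
  have Ul := mem_lR_coef lp hloc natR (ind_gt0 m psi0 psi_nontriv y') nc keyr.
  by have := unit_notin_lR hloc (card_U_unit m lq hloc); rewrite Ul.
have ru := local_unit hloc rl.
have [g gE] : exists g : GL, gr R g * Ey (oppy y) = Ey y.
  by apply: Ey_torus => k _; rewrite /oppy oppr_eq0.
have [g' gE'] : exists g : GL, gr R g * Ey y' = Ey (oppy y').
  by apply: Ey_torus => k _; rewrite /oppy oppr_eq0.
apply: (vw_move (a := gr R g * (r^-1 *: (hatU (oppy y) * gr_adj a * gr R g'))) yc').
rewrite -mulrA gsMl -!mulrA gE' r2 scalerA mulVr // scale1r.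
by rewrite gE.
Qed.

Local Notation KG := (gralg K {'GL_m.+1[F]}).
Let psiK (t : F) : K := res_pi l (psi t).
Let grK (g : GL) : KG := gr K (g : {'GL_m.+1[F]}).

Lemma hw_hatA y : hw y = hatA grK (gconst {'GL_m.+1[F]} : {rmorphism K -> KG}) psiK y.
Proof.
rewrite /hw /hatU red_coef_sum; apply: eq_bigr => u _.
by rewrite red_coefZ red_coef_gr gconstM.
Qed.

Lemma sum_psiK : \sum_t psiK t = 0.
Proof.
have [t0 pt] := psi_nontriv.
have S0 : \sum_t psi t = 0.
  have E : psi t0 * (\sum_t psi t) = \sum_t psi t.
    rewrite [RHS](reindex_inj (addrI t0)) mulr_sumr /=.
    by apply: eq_bigr => t _; rewrite psiD.
  apply/eqP; have /eqP : (psi t0 - 1) * (\sum_t psi t) = 0 by rewrite mulrBl E mul1r subrr.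
  by rewrite mulf_eq0 subr_eq0 (negPf pt).
transitivity (res_pi l (\sum_t psi t)); last by rewrite S0 res_pi0.
by rewrite (big_morph _ (@res_piD R l) (@res_pi0 R l)).
Qed.

Lemma layer_proj_out (W : submod M) x : x \notin W ->
  exists b y, hw y *: (b *: x) \notin W.
Proof.
move=> xW; have zW : 0 = qmod_pi W 0.
  by apply/esym; exact: (raddf0 (\pi_(Quotient.quot W)%qT)).
have x0 : qmod_pi W x != 0.
  by apply: contra xW => /eqP; rewrite zW => /qmod_piE; rewrite subr0.
have gr1K : grK 1%g = 1 by [].
have grMK g h : grK (g * h)%g = grK g * grK h by exact: grM.
have gC s (b : KG) : b * gconst {'GL_m.+1[F]} s = gconst {'GL_m.+1[F]} s * b by exact: gconstC.
have pK0 : psiK 0 = 1 by rewrite /psiK psi0.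
have pKD t t' : psiK (t + t') = psiK t * psiK t' by rewrite /psiK psiD res_piM.
have qK : #|F|%:R * res_pi l (#|F|%:R^-1 : R) = 1 :> K.
  have -> : #|F|%:R = res_pi l (#|F|%:R : R).
    by elim: #|F| => [|n IH]; rewrite ?mulr0n ?res_pi0 // !mulrSr res_piD IH.
  rewrite -[LHS]res_piM divrr //; exact: (natr_unit hloc).
have [b [y H]] := hatA_neq0 gr1K grMK gC pK0 pKD sum_psiK qK x0.
exists b, y; apply: contra H => H; apply/eqP; rewrite -hw_hatA.
transitivity (qmod_pi W (hw y *: (b *: x))); first by rewrite 2!qmod_piZ.
by rewrite zW; apply/qmod_piE; rewrite subr0.
Qed.

End LayerHypotheses.

Section Components.
Variables (F : finFieldType) (m : nat) (R : idomainType) (l : nat) (psi : F -> R) (c : nat).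
Local Notation GL := (GLn F m).
Local Notation U := (Un F m).
Local Notation B := (Bn F m).
Local Notation RG := (gralg R GL).
Local Notation K := (residue R l).
Local Notation eps := (@eps F m R).
Local Notation Ey := (Ey m psi).
Local Notation hatU := (hatU m psi).
Local Notation dotg := (@dotg F m.+1 R).
Local Notation I := (st_lattice F m.+1 R).
Local Notation iE := (iE m psi).
Local Notation iv := (@iv F m R).
Local Notation filt := (st_filt F m.+1 R l).
Local Notation M := (layer F m.+1 R l c).
Local Notation ind := (ind m).
Hypothesis lp : prime l.
Hypothesis lq : coprime l #|F|.
Hypothesis hloc : local_with_maximal_ideal (@lR_pred R l).
Hypothesis natR : forall n, (0 < n)%N -> n%:R != 0 :> R.
Hypothesis psi0 : psi 0 = 1.
Hypothesis psiD : forall a a', psi (a + a') = psi a * psi a'.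
Hypothesis psi_nontriv : exists a, psi a != 1.
Variable e : nat.
Hypothesis he : is_e F l e.
Implicit Types (y : nat -> F) (a s : seq nat) (x z : nat) (N : submod M).


Local Notation nu y := (logn l (ind y)).
Local Notation lay := (@lay R l _ I (filt c) (filt c.+1)).
Local Notation vw := (@vw F m R l psi c).
Local Notation hw := (@hw F m R l psi).


Local Notation q := #|F|.
Local Notation cc := (comp_char F).

Lemma cyclic_eq (A : pzRingType) (V : lmodType A) (v w : V) :
  (exists b, v = b *: w) -> (exists b, w = b *: v) -> cyclic v = cyclic w.
Proof.
move=> [b vE] [b' wE]; apply: submodP => x; apply/cyclicP/cyclicP => -[a ->].
  by exists (a * b); rewrite vE scalerA.
by exists (a * b'); rewrite wE scalerA.
Qed.

Lemma eq_ind y y' : (forall k, (k < m)%N -> (y k == 0) = (y' k == 0)) -> ind y = ind y'.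
Proof.
by move=> yy'; apply: eq_bigl => s; apply: eq_forallb => k; rewrite yy'.
Qed.

Lemma psi_unit t : psi t \is a GRing.unit.
Proof. by apply/unitrPr; exists (psi (- t)); rewrite -psiD subrr. Qed.

Lemma cyclic_exchange s1 s2 x z a (b := s1 ++ [:: x; z] ++ s2) :
  all (leq 1) b -> sumn b = m.+1 ->
  a = s1 ++ [:: z; x] ++ s2 \/ a = s1 ++ [:: (z + x)%N] ++ s2 ->
  nu (cc a) = c -> nu (cc b) = c -> cyclic (vw (cc a)) = cyclic (vw (cc b)).
Proof.
rewrite /b all_cat /= => /and4P[sp x0 z0 _] bn aE ac bc.
have [w wE] := hatU_swap psi0 psiD natR psi_nontriv sp x0 z0 bn aE.
have tu : (-1) ^+ odd_perm w * #|Upat F w|%:R \is a @GRing.unit R.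
  rewrite unitrM unitrX ?unitrN1 //=; apply: (natr_unit hloc).
  by rewrite card_Upat coprimeXr.
have H : exists b', vw (cc b) = b' *: vw (cc a).
  apply: (vw_move lp hloc natR psi0 psiD psi_nontriv (a := ((-1) ^+ odd_perm w * #|Upat F w|%:R)^-1 *:
    (hatU (cc b) * gr R (pm F w))) ac).
  by rewrite gsMl -mulrA wE scalerA mulVr // scale1r.
by apply: cyclic_eq => //; exact: layer_sym.
Qed.

Definition component N := exists2 P : {group {'GL_m.+1[F]}}, Pstar l e c P & is_NP P N.

Lemma component_sorted a : all (leq 1) a -> sumn a = m.+1 -> sorted leq a ->
  (forall x, x \in a -> x = 1%N \/ exists i, x = (e * l ^ i)%N) ->
  nu (cc a) = c -> component (cyclic (vw (cc a))).
Proof.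
move=> ap an asrt al ac.
pose lam (u : GL) := chr psi (cc a) u.
exists (char_parabolic (lam : {'GL_m.+1[F]} -> R)).
  split.
  - by apply: fintype.subset_trans (subset_gen _); exact: finset.subsetUl.
  - exists a; split=> //; apply: (char_parabolic_block psi0 psi_nontriv (y := cc a)) => //.
    by move=> k _; rewrite comp_char_neq0.
  - rewrite /index_val (char_parabolic_index psi0 psi_nontriv (y := cc a)) //.
exists lam, (insubd 0 (red_pi l (iE (cc a)))); split=> //.
- split=> [u _|u v uU vU]; first exact: psi_unit.
  exact: chrM.
- by apply: lay_val; apply: iE_filt; rewrite ?ac.
Qed.

Lemma component_composition a : all (leq 1) a -> sumn a = m.+1 ->
  nu (cc a) = c -> component (cyclic (vw (cc a))).
Proof.
have q1 : (1 < q)%N by exact: card_finRing_gt1.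
have qE i : ((q ^ i - 1) %/ (q - 1))%N = qnum q i.
  by rewrite qnumE mulKn // subn_gt0.
have [/andP[e2 el] emin] := he; rewrite qE in el.
pose allowed k := k = 1%N \/ exists i, k = (e * l ^ i)%N.
have nuE a' : sumn a' = m.+1 -> (\sum_(x <- a') Dval q l x + nu (cc a'))%N = logn l #|[set: GL]|.
  by move=> an'; rewrite (logn_ind_comp_char lp lq an').
apply: (composition_ind (allowed := allowed) (good := fun x z => Dval q l (x + z)%N = (Dval q l x + Dval q l z)%N)
  (P := fun a => nu (cc a) = c -> component (cyclic (vw (cc a))))).
- move=> s1 s2 x z bp bn IH ac.
  have an : sumn (s1 ++ [:: z; x] ++ s2) = m.+1 by rewrite -bn !sumn_cat /=; nlia.
  have bc : nu (cc (s1 ++ [:: x; z] ++ s2)) = c.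
    have := nuE _ an; rewrite -(nuE _ bn) !big_cat !big_cons !big_nil ac /=; nlia.
  by rewrite (cyclic_exchange bp bn (or_introl erefl) ac bc); exact: IH.
- move=> s1 s2 x z bp bn g IH ac.
  have an : sumn (s1 ++ [:: (z + x)%N] ++ s2) = m.+1 by rewrite -bn !sumn_cat /=; nlia.
  have bc : nu (cc (s1 ++ [:: x; z] ++ s2)) = c.
    have := nuE _ an; rewrite -(nuE _ bn) !big_cat !big_cons !big_nil ac /=.
    by rewrite (addnC z x) g !addn0 => /addnI/esym.
  by rewrite (cyclic_exchange bp bn (or_intror erefl) ac bc); exact: IH.
- move=> k k0 nk.
  have emin' i : (1 < i)%N -> (l %| qnum q i)%N -> (e <= i)%N.
    by move=> i2 li; apply: emin; rewrite i2 qE.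
  have k1 : k <> 1%N by move=> k1; apply: nk; left.
  have ke i : k <> (e * l ^ i)%N by move=> ki; apply: nk; right; exists i.
  have [x [z [x0 z0 kE g]]] := Dval_split q1 lp lq e2 el emin' k0 k1 ke.
  by exists x, z; split=> //; rewrite -kE.
- by move=> a' ap an asrt al; exact: component_sorted.
Qed.

Lemma componentP N : component N <-> exists2 y, nu y = c & N = cyclic (vw y).
Proof.
split=> [[P [_ _ Pc] [lam [w [[lu lm] PE wE NE]]]]|[y yc ->]].
  have lam0 (u : GL) : u \in U -> (lam : GL -> R) u != 0.
    by move=> uU; apply: contraTneq (lu u uU) => ->; rewrite unitr0.
  have [y yE] := char_class psi0 psiD psi_nontriv natR lam0 lm.
  have yc : nu y = c.
    by rewrite -Pc /index_val -PE (char_parabolic_index psi0 psi_nontriv yE).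
  exists y => //; rewrite NE; congr cyclic; apply: lay_eq.
    by apply: iE_filt; rewrite ?yc.
  rewrite wE /F_elt; congr red_pi; apply: iv_inj.
  by rewrite iv_iE (iv_E_elt yE).
have [a [ap an aj]] := composition_of (fun k => y k != 0) m.
have ya k : (k < m)%N -> (y k == 0) = (cc a k == 0).
  by move=> /aj; rewrite -(comp_char_neq0 F) => /negb_inj.
have ac : nu (cc a) = c by rewrite -(eq_ind ya).
rewrite (cyclic_eq (v := vw y) (w := vw (cc a))); first exact: component_composition.
- by apply: vw_torus => // k /ya.
- by apply: vw_torus.
Qed.

End Components.

Theorem theorem4p6 (F : finFieldType) (n : nat) (R : idomainType)
    (p l e : nat)
    (hn : (2 <= n)%N)
    (hp : p \in [pchar F]) (hl : prime l) (hlp : l != p)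
    (hPID : is_PID R) (hloc : local_with_maximal_ideal (@lR_pred R l))
    (hchar : [pchar R] =i pred0)
    (hroot : exists z : R, p.-primitive_root z)
    (he : is_e F l e)
    (c : nat) (hc : is_Pvalue F n l c) :
  let S : set (submod (layer F n R l c)) :=
    [set N | exists2 P : {group {'GL_n[F]}}, Pstar l e c P & is_NP P N]%classic in
  [/\ forall N, S N -> irreducible_lmod (submod_of N),
      forall N N', S N -> S N' -> N <> N' ->
        ~ isomorphic_lmod (submod_of N) (submod_of N')
    & is_direct_sum S].

Proof.
case: n hn hc => [//|m] _ _ S.
have lq := coprime_card_field hp hl hlp.
have natR := natr_pchar0 hchar.
have [z zp] := hroot.
have [psi [psi0 psiD psi_nontriv]] := exists_psi hp zp.
have projE := layer_projE hl hloc natR psi0 psiD psi_nontriv (m := m) (c := c).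
have proj_v := layer_proj_v hl lq hloc natR psi0 psiD psi_nontriv (m := m) (c := c).
have proj_out := layer_proj_out lq hloc psi0 psiD psi_nontriv (m := m) (c := c).
have sym := layer_sym hl lq hloc natR psi0 psiD psi_nontriv (m := m) (c := c).
have SP := componentP hl lq hloc natR psi0 psiD psi_nontriv (m := m) (c := c) he.
split.
- exact: (S_irreducible projE proj_v proj_out sym SP).
- exact: (S_non_isomorphic projE proj_v sym SP).
- exact: (S_direct_sum projE proj_v proj_out sym SP).
Qed.
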